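(* Let $\alpha\in\mathbb{R}^2$ with $|\alpha|=1$, let $L>0$, and let $\mathcal{C}\subset\mathbb{T}^2$ be the segment $\gamma(t)=t\alpha$, $0\le t\le L$. Let $\{m\}\subseteq S$ be a sequence such that $N_m\to\infty$ and such that, for some $0<\epsilon<\frac12$ and all sufficiently large $m$ in the sequence, \[\min_{\mu\neq\mu'\in\mathcal{E}_m}|\mu-\mu'|>(\sqrt{m})^{1-\epsilon}.\] Then $\mathrm{Var}(\mathcal{Z})=O\big(\frac{m}{N_m}\big)$.
   Context: $\mathbb{T}^2=\mathbb{R}^2/\mathbb{Z}^2$. $S=\{m: m=a^2+b^2,\ a,b\in\mathbb{Z}\}$. For $m\in S$, $\mathcal{E}_m=\{\mu\in\mathbb{Z}^2:|\mu|^2=m\}$ and $N_m=|\mathcal{E}_m|$. The arithmetic random wave is $F(x)=\frac{1}{\sqrt{N_m}}\sum_{\mu\in\mathcal{E}_m}a_\mu e^{2\pi i\langle\mu,x\rangle}$, where $a_\mu$ are complex standard Gaussian random variables ($\mathbb{E}a_\mu=0$, $\mathbb{E}|a_\mu|^2=1$), independent save for the relations $a_{-\mu}=\overline{a_\mu}$. $\mathcal{Z}=|\{x:F(x)=0\}\cap\mathcal{C}|$ is the number of nodal intersections of $F$ with $\mathcal{C}$. *)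

(* Defs.v *)
From HB Require Import structures.
From mathcomp Require Import all_boot all_order all_algebra.
From mathcomp Require Import finmap.
From mathcomp Require Import all_classical all_reals all_analysis.
From mathcomp Require Import complex ring.

Set Implicit Arguments.
Unset Strict Implicit.
Unset Printing Implicit Defensive.

Import Order.TTheory GRing.Theory Num.Theory.
Import numFieldNormedType.Exports.

Local Open Scope classical_set_scope.
Local Open Scope ring_scope.

Definition sum_of_two_squares (m : nat) : Prop :=
  exists a b : int, m%:Z = a ^+ 2 + b ^+ 2.

Definition lattice_circle (m : nat) : set (int * int) :=
  [set mu | mu.1 ^+ 2 + mu.2 ^+ 2 = m%:Z].

Lemma finite_lattice_circle (m : nat) : finite_set (lattice_circle m).
Proof.
have bound (x y : int) : x ^+ 2 + y ^+ 2 = m%:Z -> (`|x| < m.+1)%N.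
  move=> xy; rewrite ltnS -lez_nat abszE.
  apply: (@le_trans _ _ (`|x| ^+ 2)).
    have [->|x0] := eqVneq x 0; first by rewrite normr0.
    by rewrite expr2 ler_peMl // -gtz0_ge1 normr_gt0.
  by rewrite -normrX ger0_norm ?sqr_ge0 // -xy lerDl sqr_ge0.
pose f (n : nat * nat * (bool * bool)) : int * int :=
  ((-1) ^+ n.2.1 * n.1.1%:Z, (-1) ^+ n.2.2 * n.1.2%:Z).
apply: (@sub_finite_set _ _ (f @` ((`I_m.+1 `*` `I_m.+1) `*` setT))).
  move=> [x y] xy; have yx : y ^+ 2 + x ^+ 2 = m%:Z by rewrite addrC; exact: xy.
  exists ((`|x|%N, `|y|%N), (x < 0, y < 0)) => /=.
    by split => //; split; [exact: (bound x y) | exact: (bound y x)].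
  by rewrite /f /= !abszE -!numEsign.
apply: finite_image; apply: finite_setX; last exact: finite_finset.
by apply: finite_setX; exact: finite_II.
Qed.

(* Cardinality through [fset_set], which is empty on infinite sets: see
   [finite_lattice_circle]. *)
Definition lattice_count (m : nat) : nat := #|` fset_set (lattice_circle m) |.

Section plane.
Variable R : realType.

(* The norm of [R * R] in the library is the sup norm. *)
Definition euclid_norm (x : R * R) : R := Num.sqrt (x.1 ^+ 2 + x.2 ^+ 2).

Definition int_vec (mu : int * int) : R * R := (mu.1%:~R, mu.2%:~R).

Definition dotp (x y : R * R) : R := x.1 * y.1 + x.2 * y.2.

(* The infimum of a finite set, hence a minimum if the circle has at least two
   lattice points. *)
Definition min_lattice_distance (m : nat) : R :=
  inf [set r | exists mu nu : int * int,
    [/\ lattice_circle m mu, lattice_circle m nu, mu != nu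
      & r = euclid_norm (int_vec (mu - nu))]].

Definition frac_part (x : R) : R := x - (Num.floor x)%:~R.

(* A point of the torus R^2/Z^2 is encoded by its representative in [0, 1[^2. *)
Definition torus_proj (x : R * R) : R * R := (frac_part x.1, frac_part x.2).

Definition torus_segment (alpha : R * R) (L : R) : set (R * R) :=
  [set torus_proj (t * alpha.1, t * alpha.2) | t in `[0, L]].

Definition expi (theta : R) : R[i] := (cos theta +i* sin theta)%C.

Lemma expi_periodic (theta : R) (n : int) :
  expi (theta + 2 * pi * n%:~R) = expi theta.
Proof.
have nat_periodic (t : R) (k : nat) : expi (t + 2 * pi * k%:R) = expi t.
  have -> : 2 * pi * k%:R = (pi *+ 2) *+ k :> R by rewrite mulr_natr mulr_natl.
  by rewrite /expi (periodicn (@cosD2pi R)) (periodicn (@sinD2pi R)).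
case: n => k; first exact: nat_periodic.
rewrite -(nat_periodic _ k.+1) -addrA -mulrDr NegzE mulrNz.
by rewrite -pmulrn addNr mulr0 addr0.
Qed.

End plane.

Section arithmetic_random_wave.
Context {R : realType} {d : measure_display} {T : measurableType d}.
Variable P : probability T R.

Definition mutually_independent (I : choiceType) (d' : measure_display)
    (T' : measurableType d') (A : set I) (X : I -> T -> T') : Prop :=
  forall (J : {fset I}) (B : I -> set T'),
    [set` J] `<=` A -> (forall i, i \in J -> measurable (B i)) ->
    P (\bigcap_(i in [set` J]) (X i @^-1` B i)) =
    (\prod_(i <- J) P (X i @^-1` B i))%E.

Definition re_im (Y : T -> R[i]) : T -> R * R :=
  fun w => (complex.Re (Y w), complex.Im (Y w)).

(* The real and imaginary parts are independent N(0, 1/2); the second parameter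
   of [normal_prob] is the standard deviation. *)
Definition standard_complex_gaussian (Y : T -> R[i]) : Prop :=
  measurable_fun setT (re_im Y) /\
  forall B : set (R * R), measurable B ->
    P (re_im Y @^-1` B) =
    (normal_prob 0 (Num.sqrt 2^-1) \x normal_prob 0 (Num.sqrt 2^-1))%E B.

(* "Independent save for the relations a_(-mu) = conj a_mu": independence holds
   along every set of lattice points that does not contain both mu and -mu. *)
Definition wave_coefficients (m : nat) (a : int * int -> T -> R[i]) : Prop :=
  [/\ forall mu, lattice_circle m mu -> standard_complex_gaussian (a mu),
      forall mu w, lattice_circle m mu -> a (- mu) w = conjc (a mu w)
    & forall A : set (int * int), A `<=` lattice_circle m ->
        (forall mu, A mu -> ~ A (- mu)) ->
        mutually_independent A (fun mu => re_im (a mu))].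

Definition random_wave (m : nat) (a : int * int -> T -> R[i]) (w : T)
    (x : R * R) : R[i] :=
  ((Num.sqrt (lattice_count m)%:R)^-1)%:C%C *
  \sum_(mu \in lattice_circle m)
    a mu w * expi (2 * pi * dotp (int_vec R mu) x).

Lemma random_wave_torus (m : nat) (a : int * int -> T -> R[i]) (w : T)
    (x : R * R) : random_wave m a w (torus_proj x) = random_wave m a w x.
Proof.
congr (_ * _); apply: eq_fsbigr => mu _; congr (_ * _).
rewrite -(expi_periodic _
  (mu.1 * Num.floor x.1 + mu.2 * Num.floor x.2)) -mulrDr.
by congr (expi (_ * _)); rewrite /dotp /int_vec /torus_proj /frac_part /=; ring.
Qed.

(* Points of the torus are counted, not parameters t. The value is 0 if there
   are infinitely many of them, which has probability 0 for m > 0. *)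
Definition nodal_intersections (m : nat) (a : int * int -> T -> R[i])
    (alpha : R * R) (L : R) (w : T) : R :=
  (#|` fset_set ([set x | random_wave m a w x = 0]
                 `&` torus_segment alpha L) |)%:R.

End arithmetic_random_wave.

(* Main.v *)
Require Import Defs.
From HB Require Import structures.
From mathcomp Require Import all_boot all_order all_algebra.
From mathcomp Require Import finmap.
From mathcomp Require Import all_classical all_reals all_analysis.
From mathcomp Require Import complex.
From mathcomp Require Import measurable_realfun ring lra.
Set Implicit Arguments.
Unset Strict Implicit.
Unset Printing Implicit Defensive.
Import Order.TTheory GRing.Theory Num.Theory.
Import numFieldNormedType.Exports.
Local Open Scope classical_set_scope.
Local Open Scope ring_scope.

(** On the segment, the random wave is a nonzero multiple of the stationary
    Gaussian process [f t = n^(-1/2) \sum_mu (x_mu cos (om_mu t) - y_mu sin (om_mu t))],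
    where [mu] runs over one half of the circle, [n] is the number of its points,
    [om_mu = 2 pi <mu, alpha>], and the [x_mu, y_mu] are independent N(0, 1/2)
    variables. Almost surely, the number of zeros is the increasing limit of the
    numbers of sign changes of [f] along finer and finer grids, and by Fatou's
    lemma it suffices to bound the variances of the latter uniformly.

    Let [Om = 2 pi sqrt m]. Up to a null event, [f] changes sign between [t] and
    [t + eta] when [|U| <= k |V|], where [U] and [V] are the normalisations of
    [f t + f (t + eta)] and [f (t + eta) - f t], which are independent, and
    [k <= eta Om]. The segment is cut into [K], of order [sqrt m], blocks of
    length of order [1 / Om]. If the correlations of two cells are small, the
    covariance of the two events is at most a multiple of [k^2] times the sum of
    their squares, because the terms of first order cancel by symmetry. If some
    correlation between two blocks is not small, it is not small for any pair of
    cells of these blocks, and one uses that the number of sign changes in a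
    block has a bounded second moment, since [j] sign changes force
    [|f| <= h^j sup |f^(j)|] on a block of length [h]. In both cases the
    covariance is controlled by the mean square of the correlations, which is
    [O(1 / n)] by an estimate of Dirichlet kernels, as soon as the sums
    [\sum_nu (1 + (om_mu - om_nu)^2)^(-1)] are bounded. The variance is thus
    [O(K^2 / n) = O(m / N)].

    The separation hypothesis bounds these sums: two lattice points in a strip of
    width 1 orthogonal to [alpha], on the same side of the line [R alpha], are at
    distance at most [sqrt (1 + 2 sqrt m)], which is less than
    [(sqrt m)^(1 - eps)] for large [m], hence they coincide. *)

(** * Densities and Gaussian integrals *)

(** The bound must survive refining the grid to the limit: with [c] cells per block and [c]
    unbounded, the covariance of two cells has to be [O(c^-2)] times a squared correlation. The
    values of [f] at the ends of a cell merge as [eta] tends to 0. Their normalised sum and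
    difference do not degenerate: they are independent by stationarity, a sign change becomes a thin
    double cone, and the correlations with another such pair are averages with weights bounded
    uniformly in [eta]. The cone is centrally symmetric, which removes the terms of odd order.
    Density comparison fails for neighbouring cells, whose pairs almost coincide; the moment bound
    that replaces it must depend neither on [c] nor on the number of frequencies. A correlation is
    small below 1/32. Being Lipschitz of constant [4 Om], it varies by at most 1/64 over two blocks
    of length at most [1 / (512 Om)], so that a large one remains above 1/64. Gaussian vectors are
    lists of vectors acting by smoothing operators, so that no joint density of the whole family and
    no nondegeneracy is required. *)

Section density.
Local Open Scope ereal_scope.
Context d (T : measurableType d) (R : realType).
Variables (mu nu : {measure set T -> \bar R}) (g : T -> R).
Hypotheses (mg : measurable_fun setT g) (g0 : forall x, (0 <= g x)%R).
Hypothesis nuE : forall A, measurable A -> nu A = \int[mu]_(x in A) (g x)%:E.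

Import HBNNSimple.

Let nnsfun_density (h : {nnsfun T >-> R}) :
  \int[nu]_x (h x)%:E = \int[mu]_x ((h x)%:E * (g x)%:E).
Proof.
transitivity (\sum_(x \in range h) (x%:E * nu (h @^-1` [set x]))).
  by rewrite integralT_nnsfun sintegralE.
under [RHS]eq_integral do rewrite fimfunE -fsumEFin//.
have mz x t : [set x] x -> 0 <= (x * \1_(h @^-1` [set x]) t)%:E.
  by move=> _; exact: nnfun_muleindic_ge0.
transitivity (\int[mu]_t
   (\sum_(y \in range h) ((y * \1_(h @^-1` [set y]) t)%:E * (g t)%:E))).
  rewrite ge0_integral_fsum//; last 2 first.
  - move=> y; apply: emeasurable_funM; apply/measurable_EFinP => //.
    exact: measurable_funM.
  - move=> y x _; apply: mule_ge0; last by rewrite lee_fin.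
    exact: nnfun_muleindic_ge0.
  apply: eq_fsbigr => y _.
  have [y0|y0] := ltP y 0%R.
    rewrite preimage_nnfun0// measure0 mule0 integral0_eq// => t _.
    by rewrite indic0 mulr0 mul0e.
  under [RHS]eq_integral do rewrite EFinM -muleA.
  rewrite ge0_integralZl//; last 2 first.
  - by apply: emeasurable_funM; apply/measurable_EFinP.
  - by move=> t _; rewrite mule_ge0 ?lee_fin.
  rewrite nuE// [in LHS]integral_mkcond; congr (_ * _).
  apply: eq_integral => t _.
  rewrite patchE indicE; case: ifPn => _; by rewrite ?mul1e ?mul0e.
apply: eq_integral => t _; rewrite ge0_mule_fsuml// => y.
exact: nnfun_muleindic_ge0.
Qed.

Lemma ge0_integral_density (F : T -> \bar R) :
  measurable_fun setT F -> (forall x, 0 <= F x) ->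
  \int[nu]_x F x = \int[mu]_x (F x * (g x)%:E).
Proof.
move=> mF F0; pose h := nnsfun_approx measurableT mF.
transitivity (limn (fun n => \int[nu]_x (h n x)%:E)).
  rewrite -monotone_convergence//.
  - apply: eq_integral => x _; apply/esym/cvg_lim => //.
    exact: cvg_nnsfun_approx.
  - by move=> n; exact/measurable_EFinP.
  - by move=> n x _; rewrite lee_fin.
  - by move=> x _ a b ab; rewrite lee_fin; exact/lefP/nd_nnsfun_approx.
under eq_fun do rewrite nnsfun_density.
rewrite -monotone_convergence//.
- apply: eq_integral => x _; apply/cvg_lim => //.
  by apply: cvgeZr => //; exact: cvg_nnsfun_approx.
- move=> n; apply: emeasurable_funM; exact/measurable_EFinP.
- by move=> n x _; rewrite mule_ge0 ?lee_fin.
- move=> x _ a b ab; rewrite lee_wpmul2r ?lee_fin//.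
  exact/lefP/nd_nnsfun_approx.
Qed.

End density.

Section affine.
Context {R : realType}.
Local Notation mu := (@lebesgue_measure R).
Local Open Scope ereal_scope.

Let aff (c b : R) (x : measurableTypeR R) : measurableTypeR R := (c * x + b)%R.

Let measurable_aff c b : measurable_fun setT (aff c b).
Proof. by apply: measurable_funD => //; exact: measurable_funM. Qed.

(** The image of Lebesgue measure under the affine map, multiplied by [|c|], agrees with Lebesgue
    measure on half-open intervals, hence everywhere. *)
Lemma ge0_integral_affine (c b : R) (F : R -> \bar R) : c != 0%R ->
  measurable_fun setT F -> (forall x, 0 <= F x) ->
  \int[mu]_x F (c * x + b)%R = (`|c|^-1)%:E * \int[mu]_x F x.
Proof.
move=> c0 mF F0.
pose k : {nonneg R} := NngNum (normr_ge0 c).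
have cN0 : `|c|%R != 0%R by rewrite normr_eq0.
pose pf := measure_function_pushforward__canonical__measure_function_Measure
  mu (measurable_aff c b).
pose nu := mscale k pf.
have nuE A : measurable A -> mu A = nu A.
  apply: lebesgue_measure_unique => X [[u v] /= uv <-].
  rewrite /nu /mscale /= /pushforward /=.
  have -> : aff c b @^-1` `]u, v] =
      if (0 < c)%R then `]((u - b) / c)%R, ((v - b) / c)%R]%classic
      else `[((v - b) / c)%R, ((u - b) / c)%R[%classic.
    apply/seteqP; split => x /=; rewrite /aff.
      case: ltP => cp /=; rewrite !in_itv /= => /andP[h1 h2].
        by rewrite ltr_pdivrMr// ler_pdivlMr//; apply/andP; split; lra.
      have cn : (c < 0)%R by rewrite lt_neqAle c0.
      by rewrite ler_ndivrMr// ltr_ndivlMr//; apply/andP; split; lra.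
    case: ltP => cp /=; rewrite !in_itv /=.
      by rewrite ltr_pdivrMr// ler_pdivlMr// => /andP[h1 h2]; apply/andP; split; lra.
    have cn : (c < 0)%R by rewrite lt_neqAle c0.
    by rewrite ler_ndivrMr// ltr_ndivlMr// => /andP[h1 h2]; apply/andP; split; lra.
  case: ltP => cp.
    rewrite !lebesgue_measure_itv /= !lte_fin ltr_pM2r ?invr_gt0// ltrD2r.
    case: ifP => _; last by rewrite mule0.
    by rewrite -!EFinD -EFinM gtr0_norm//; congr EFin; field; rewrite gt_eqF.
  have cn : (c < 0)%R by rewrite lt_neqAle c0.
  rewrite !lebesgue_measure_itv /= !lte_fin ltr_nM2r ?invr_lt0// ltrD2r.
  case: ifP => _; last by rewrite mule0.
  by rewrite -!EFinD -EFinM ltr0_norm//; congr EFin; field; rewrite lt_eqF.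
have -> : \int[mu]_x F x = \int[nu]_x F x.
  by apply: eq_measure_integral => A mA _; exact: nuE.
rewrite ge0_integral_mscale// muleA -EFinM mulVf// mul1e.
rewrite ge0_integral_pushforward//=; exact: measurable_aff.
Qed.

End affine.

Section gaussian.
Context {R : realType}.
Local Notation mu := (@lebesgue_measure R).

Definition gauss_density (x : R) : R := (Num.sqrt pi)^-1 * expR (- x ^+ 2).

(* [normal_prob] lives on [measurableTypeR R], whose products are not
   recognised as the canonical [R * R]. *)
Definition to_real (x : measurableTypeR R) : R := x.

Lemma measurable_to_real : measurable_fun setT to_real.
Proof. by move=> _ A mA; rewrite setTI. Qed.

HB.instance Definition _ :=
  isMeasurableFun.Build _ _ _ _ to_real measurable_to_real.

Definition gauss : probability R R :=
  distribution (normal_prob (0 : R) (Num.sqrt 2^-1)) to_real.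

Definition gauss2 : probability (R * R)%type R := (gauss \x gauss)%E.

Lemma gauss_density_ge0 x : 0 <= gauss_density x.
Proof. by rewrite mulr_ge0 ?expR_ge0 ?invr_ge0. Qed.

Lemma measurable_gauss_density : measurable_fun setT gauss_density.
Proof.
apply: measurable_funM => //; apply: measurableT_comp => //.
by apply: measurableT_comp => //; exact: measurable_funX.
Qed.

Lemma gauss_densityE : normal_pdf 0 (Num.sqrt 2^-1) = gauss_density.
Proof.
apply/funext => x; rewrite normal_pdfE ?sqrtr_eq0 -?ltNge//.
rewrite /normal_peak /normal_fun subr0 sqr_sqrtr// -[2^-1 *+ 2]mulr_natr.
by rewrite mulVf// divr1 -[_ *+ 2]mulr_natr mulrAC mulVf// mul1r.
Qed.

Local Open Scope ereal_scope.

Lemma ge0_integral_gauss (F : R -> \bar R) :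
  measurable_fun setT F -> (forall x, 0 <= F x) ->
  \int[gauss]_x F x = \int[mu]_x (F x * (gauss_density x)%:E).
Proof.
move=> mF F0; rewrite ge0_integral_distribution//.
rewrite (@ge0_integral_density _ _ _ mu (normal_prob (0 : R) (Num.sqrt 2^-1))
  gauss_density)//.
- exact: measurable_gauss_density.
- exact: gauss_density_ge0.
- by move=> A mA; rewrite -gauss_densityE.
Qed.

(** For [c != 0] a rotation splits into two affine substitutions in one variable: for fixed [y] set
    [u = c x - s y], then for fixed [u] the second coordinate is [y / c + (s / c) u]. The factors
    [1 / |c|] and [|c|] cancel. For [c = 0] the variables are exchanged, up to signs. *)
Lemma ge0_integral_rotation (c s : R) (G : R * R -> \bar R) :
  (c ^+ 2 + s ^+ 2 = 1)%R -> measurable_fun setT G -> (forall x, 0 <= G x) ->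
  \int[mu]_x \int[mu]_y G (c * x - s * y, s * x + c * y)%R =
  \int[mu]_x \int[mu]_y G (x, y).
Proof.
move=> cs1 mG G0.
have mpair (T1 : measurableType _) (u v : T1 -> R) : measurable_fun setT u ->
    measurable_fun setT v -> measurable_fun setT (fun z => G (u z, v z)).
  by move=> mf mg; apply: measurableT_comp => //; exact: measurable_fun_pair.
have mlin (a b k : R) : measurable_fun setT (fun z : R => a * z + b * k)%R.
  by apply: measurable_funD => //; exact: measurable_funM.
have [c0|c0] := eqVneq c 0%R.
  have s1 : `|s|%R = 1%R.
    by apply/eqP; rewrite -sqrp_eq1// real_normK ?num_real// -cs1 c0 expr0n add0r.
  have s0 : s != 0%R by rewrite -normr_eq0 s1.
  transitivity (\int[mu]_x \int[mu]_y G (y, s * x)%R).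
    apply: eq_integral => x _.
    rewrite -[RHS]mul1e -[1]/(1%:E) -[1%R]invr1 -s1 -normrN.
    rewrite -(@ge0_integral_affine _ (- s) 0%R) ?oppr_eq0//; last exact: mpair.
    apply: eq_integral => y _; rewrite c0; congr (G (_, _)); ring.
  have mG' : measurable_fun setT (fun z : R * R => G (z.2, s * z.1)%R).
    by apply: mpair => //; exact: measurable_funM.
  rewrite (fubini_tonelli (m1 := mu) (m2 := mu) _ mG' (fun z => G0 _)) /=.
  apply: eq_integral => x _.
  rewrite -[RHS]mul1e -[1]/(1%:E) -[1%R]invr1 -s1.
  rewrite -(@ge0_integral_affine _ s 0%R)//; last exact: mpair.
  by apply: eq_integral => y _; rewrite addr0.
have mGr : measurable_fun setT
    (fun z : R * R => G (c * z.1 - s * z.2, s * z.1 + c * z.2)%R).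
  apply: mpair; [apply: measurable_funB|apply: measurable_funD];
  exact: measurable_funM.
rewrite (fubini_tonelli (m1 := mu) (m2 := mu) _ mGr (fun z => G0 _)) /=.
transitivity (\int[mu]_y ((`|c|^-1)%:E * \int[mu]_u G (u, c^-1 * y + s / c * u)%R)).
  apply: eq_integral => y _.
  rewrite -(@ge0_integral_affine _ c (- (s * y)))//; last first.
    by apply: mpair => //; apply: measurable_funD => //; exact: measurable_funM.
  apply: eq_integral => x _; congr (G (_, _)).
  have e : (y = (c ^+ 2 + s ^+ 2) * y)%R by rewrite cs1 mul1r.
  have -> : (c^-1 * y + s / c * (c * x - s * y) = (y + s * (c * x - s * y)) / c)%R.
    by field.
  by apply: (mulIf c0); rewrite divfK// {2}e; ring.
have mG' : measurable_fun setT (fun z : R * R => G (z.1, c^-1 * z.2 + s / c * z.1)%R).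
  by apply: mpair => //; apply: measurable_funD; exact: measurable_funM.
under eq_integral.
  move=> y _; rewrite -ge0_integralZl//; last first.
    by apply: mpair => //; apply: measurable_funD => //; exact: measurable_funM.
  over.
have mG'' : measurable_fun setT
    (fun z : R * R => (`|c|^-1)%:E * G (z.1, c^-1 * z.2 + s / c * z.1)%R).
  by apply: emeasurable_funM; [exact: measurable_cst|exact: mG'].
have nG'' (z : R * R) : 0 <= (`|c|^-1)%:E * G (z.1, c^-1 * z.2 + s / c * z.1)%R.
  by rewrite mule_ge0 ?lee_fin.
rewrite -(fubini_tonelli (m1 := mu) (m2 := mu) _ mG'' nG'') /=.
apply: eq_integral => x _.
have mGx : measurable_fun setT (fun y => G (x, y)) by exact: mpair.
rewrite ge0_integralZl ?lee_fin//; last first.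
  by apply: mpair => //; apply: measurable_funD => //; exact: measurable_funM.
rewrite (@ge0_integral_affine _ c^-1 (s / c * x)%R (fun y => G (x, y)))// ?invr_eq0//.
by rewrite muleA -EFinM normfV invrK mulVf ?mul1e// normr_eq0.
Qed.

End gaussian.

(** * Gaussian vectors *)

Section gauss_smoothing.
Context {R : realType}.
Local Notation mu := (@lebesgue_measure R).
Local Notation vec := (R * R * (R * R))%type.

Definition vcomb (a : R) (v : vec) (b : R) (w : vec) : vec :=
  ((a * v.1.1 + b * w.1.1, a * v.1.2 + b * w.1.2),
   (a * v.2.1 + b * w.2.1, a * v.2.2 + b * w.2.2)).

Definition vzero : vec := ((0, 0), (0, 0)).

Local Open Scope ereal_scope.

(** The mean of [F (x + g v)] over a Gaussian [g]. Composing these operators along a list of vectors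
    gives the mean of [F] under the law of the random combination of these vectors, whatever the
    rank of its covariance. *)
Definition smooth (v : vec) (F : vec -> \bar R) (x : vec) : \bar R :=
  \int[gauss]_g F (vcomb 1 x g v).

Definition nnmeas (F : vec -> \bar R) :=
  measurable_fun setT F /\ forall x, 0 <= F x.

Lemma measurable_vcomb d (T : measurableType d) (a b : T -> R) (v w : T -> vec) :
  measurable_fun setT a -> measurable_fun setT b ->
  measurable_fun setT v -> measurable_fun setT w ->
  measurable_fun setT (fun t => vcomb (a t) (v t) (b t) (w t)).
Proof.
move=> ma mb mv mw.
have m11 (u : T -> vec) : measurable_fun setT u -> measurable_fun setT (fun t => (u t).1.1).
  by move=> mu'; do 2 apply: measurableT_comp => //.
have m12 (u : T -> vec) : measurable_fun setT u -> measurable_fun setT (fun t => (u t).1.2).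
  by move=> mu'; apply: measurableT_comp => //; apply: measurableT_comp => //.
have m21 (u : T -> vec) : measurable_fun setT u -> measurable_fun setT (fun t => (u t).2.1).
  by move=> mu'; apply: measurableT_comp => //; apply: measurableT_comp => //.
have m22 (u : T -> vec) : measurable_fun setT u -> measurable_fun setT (fun t => (u t).2.2).
  by move=> mu'; apply: measurableT_comp => //; apply: measurableT_comp => //.
by apply: measurable_fun_pair; apply: measurable_fun_pair;
  apply: measurable_funD; apply: measurable_funM; auto.
Qed.

Lemma nnmeas_vcomb (F : vec -> \bar R) d (T : measurableType d) (a b : T -> R)
    (v w : T -> vec) : nnmeas F ->
  measurable_fun setT a -> measurable_fun setT b ->
  measurable_fun setT v -> measurable_fun setT w ->
  measurable_fun setT (fun t => F (vcomb (a t) (v t) (b t) (w t))).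
Proof.
move=> [mF _] ma mb mv mw.
by apply: (measurableT_comp mF); exact: measurable_vcomb.
Qed.

Lemma nnmeas_smooth v F : nnmeas F -> nnmeas (smooth v F).
Proof.
move=> nF; split; last by move=> x; apply: integral_ge0 => g _; apply: nF.2.
apply: (@measurable_fun_fubini_tonelli_F _ _ _ _ _ gauss
  (fun z : vec * R => F (vcomb 1 z.1 z.2 v))).
  exact: nnmeas_vcomb.
by move=> z; exact: nF.2.
Qed.

Lemma smooth0 F x : smooth vzero F x = F x.
Proof.
rewrite /smooth (_ : (fun g => _) = fun=> F x).
  by rewrite integral_cst// [X in _ * X]probability_setT mule1.
apply/funext => g; congr F; case: x => [[a b] [c d]].
by rewrite /vcomb /=; congr ((_, _), (_, _)); ring.
Qed.

(** The joint density of two independent Gaussian variables depends only on the sum of their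
    squares, so they may be rotated; the rotation is then carried over to the pair [(v, w)]. *)
Lemma smooth_rotation c s v w F : (c ^+ 2 + s ^+ 2 = 1)%R -> nnmeas F ->
  smooth v (smooth w F) = smooth (vcomb c v s w) (smooth (vcomb (- s) v c w) F).
Proof.
move=> cs1 nF; apply/funext => x.
pose K (z : R * R) := F (vcomb 1 (vcomb 1 x z.1 v) z.2 w).
have mK : measurable_fun setT K.
  by apply: nnmeas_vcomb => //; exact: measurable_vcomb.
have nK z : 0 <= K z by exact: nF.2.
have mg : measurable_fun setT (fun z : R => (gauss_density z)%:E).
  by apply/measurable_EFinP; exact: measurable_gauss_density.
have gge0 z : 0 <= (gauss_density z)%:E :> \bar R.
  by rewrite lee_fin gauss_density_ge0.
have mp (L : R * R -> \bar R) : measurable_fun setT L ->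
   forall a, measurable_fun setT (fun b => L (a, b)).
  by move=> mL a; apply: measurableT_comp => //; exact: measurable_fun_pair.
have dbl (L : R * R -> \bar R) : measurable_fun setT L -> (forall z, 0 <= L z) ->
    \int[gauss]_a \int[gauss]_b L (a, b) =
    \int[mu]_a \int[mu]_b (L (a, b) * (gauss_density a)%:E * (gauss_density b)%:E).
  move=> mL nL.
  rewrite ge0_integral_gauss; last 2 first.
  - exact: (@measurable_fun_fubini_tonelli_F _ _ _ _ _ gauss L).
  - by move=> a; exact: integral_ge0.
  apply: eq_integral => a _; rewrite ge0_integral_gauss//; last exact: mp.
  have mLa : measurable_fun setT (fun b => L (a, b) * (gauss_density b)%:E).
    by apply: emeasurable_funM; [exact: mp|exact: mg].
  have nLa b : setT b -> 0 <= L (a, b) * (gauss_density b)%:E.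
    by move=> _; rewrite mule_ge0.
  rewrite -(ge0_integralZr mu measurableT mLa nLa (gge0 a)).
  by apply: eq_integral => b _; rewrite muleAC.
rewrite /smooth.
transitivity (\int[gauss]_a \int[gauss]_b K (a, b)); first by [].
transitivity (\int[gauss]_a \int[gauss]_b K (c * a - s * b, s * a + c * b)%R); last first.
  apply: eq_integral => a _; apply: eq_integral => b _; congr F.
  by case: x v w {K mK nK} => [[? ?] [? ?]] [[? ?] [? ?]] [[? ?] [? ?]];
    rewrite /vcomb /=; congr ((_, _), (_, _)); ring.
have mr : measurable_fun setT (fun z : R * R => (c * z.1 - s * z.2, s * z.1 + c * z.2)%R).
  apply: measurable_fun_pair; [apply: measurable_funB|apply: measurable_funD];
  exact: measurable_funM.
rewrite (dbl K mK nK).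
rewrite (dbl (fun z : R * R => K (c * z.1 - s * z.2, s * z.1 + c * z.2)%R)
  (measurableT_comp mK mr) (fun z => nK _)).
rewrite -(ge0_integral_rotation (G := fun z => K z * (gauss_density z.1)%:E
  * (gauss_density z.2)%:E) cs1); last 2 first.
- by do 2 (apply: emeasurable_funM; last exact: (measurableT_comp mg)).
- by move=> z; rewrite !mule_ge0.
apply: eq_integral => a _; apply: eq_integral => b _ /=.
rewrite -!muleA; congr (_ * _); rewrite -!EFinM; congr EFin.
rewrite /gauss_density mulrACA -expRD [RHS]mulrACA -expRD; congr (_ * _)%R.
have -> : (- a ^+ 2 + - b ^+ 2 = - ((c ^+ 2 + s ^+ 2) * (a ^+ 2 + b ^+ 2)))%R.
  by rewrite cs1; ring.
by congr expR; ring.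
Qed.

Lemma smoothN v F : nnmeas F -> smooth (vcomb (-1) v 0 vzero) F = smooth v F.
Proof.
move=> nF; have := @smooth_rotation (-1) 0 v vzero F.
rewrite sqrrN expr1n expr0n addr0 => /(_ erefl nF).
have -> : vcomb (- 0) v (-1) vzero = vzero.
  by rewrite /vcomb /= !(mulr0, oppr0, mul0r, addr0).
have s0 : smooth vzero F = F by apply/funext => x; exact: smooth0.
by rewrite s0 => ->.
Qed.

(** A quarter turn exchanges the two vectors up to a sign, which [smoothN], a half turn, removes. *)
Lemma smoothC v w F : nnmeas F -> smooth v (smooth w F) = smooth w (smooth v F).
Proof.
move=> nF; have e : (0 ^+ 2 + 1 ^+ 2 = 1 :> R)%R by rewrite expr0n expr1n add0r.
rewrite (smooth_rotation v w e nF).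
have -> : vcomb 0 v 1 w = w.
  by case: v w => [[? ?] [? ?]] [[? ?] [? ?]];
    rewrite /vcomb /=; congr ((_, _), (_, _)); ring.
have -> : vcomb (-1) v 0 w = vcomb (-1) v 0 vzero.
  by congr ((_, _), (_, _)); rewrite /= !mul0r.
by rewrite smoothN.
Qed.

End gauss_smoothing.

(** * Triangular form of a Gaussian vector in dimension 4 *)

Section cholesky.
Context {R : realType}.
Local Notation vec := (R * R * (R * R))%type.

Definition smooths (vs : seq vec) (F : vec -> \bar R) := foldr smooth F vs.

Lemma nnmeas_smooths vs F : nnmeas F -> nnmeas (smooths vs F).
Proof. by elim: vs => //= v vs IH nF; apply: nnmeas_smooth; exact: IH. Qed.

Definition vlinear (l : vec -> R) :=
  forall a v b w, l (vcomb a v b w) = a * l v + b * l w.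

(** The second clause carries the covariance along with the law; it later identifies the entries of
    the triangular form. *)
Definition same_smoothing (vs ws : seq vec) :=
  (forall F, nnmeas F -> smooths vs F = smooths ws F) /\
  forall p q, vlinear p -> vlinear q ->
    \sum_(v <- vs) p v * q v = \sum_(w <- ws) p w * q w.

Lemma same_smoothing_cons v vs ws :
  same_smoothing vs ws -> same_smoothing (v :: vs) (v :: ws).
Proof.
move=> [h1 h2]; split; first by move=> F nF /=; rewrite h1.
by move=> p q lp lq; rewrite !big_cons h2.
Qed.

Lemma same_smoothing_trans vs ws us :
  same_smoothing vs ws -> same_smoothing ws us -> same_smoothing vs us.
Proof.
move=> [h1 h2] [h3 h4]; split; first by move=> F nF; rewrite h1// h3.
by move=> p q lp lq; rewrite h2// h4.
Qed.

Lemma same_smoothing_swap v w vs :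
  same_smoothing [:: v, w & vs] [:: w, v & vs].
Proof.
split; first by move=> F nF /=; rewrite smoothC//; exact: nnmeas_smooths.
by move=> p q lp lq; rewrite !big_cons; ring.
Qed.

Lemma same_smoothing_rotation c s v w vs : c ^+ 2 + s ^+ 2 = 1 ->
  same_smoothing [:: v, w & vs] [:: vcomb c v s w, vcomb (- s) v c w & vs].
Proof.
move=> cs1; split.
  by move=> F nF /=; rewrite (smooth_rotation _ _ cs1)//; exact: nnmeas_smooths.
move=> p q lp lq; rewrite !big_cons !lp !lq !addrA; congr (_ + _).
by rewrite -[LHS]mul1r -cs1; ring.
Qed.

(* Gaussian elimination by rotations: [(g, h)] and its rotations have the same
   law, and a rotation of [(v, w)] makes [l] vanish on the second vector. *)
Lemma smoothing_pivot (l : vec -> R) (vs : seq vec) : vlinear l -> exists w vs',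
  [/\ same_smoothing vs (w :: vs'), 0 <= l w, {in vs', forall v, l v = 0}
    & forall l', vlinear l' -> {in vs, forall v, l' v = 0} ->
        {in w :: vs', forall v, l' v = 0}].
Proof.
move=> ll; elim: vs => [|v vs [w [vs' [e lw lvs' h]]]].
  have l0 l' : vlinear l' -> l' vzero = 0.
    move=> ll'; have := ll' 0 vzero 0 vzero; rewrite !mul0r addr0.
    by rewrite /vcomb /= !mul0r addr0.
  exists vzero, [::]; split => //.
  - split; first by move=> F nF /=; apply/funext => x; rewrite smooth0.
    by move=> p q lp lq; rewrite big_nil big_seq1 !l0// mul0r.
  - by rewrite l0.
  - by move=> l' ll' _ v; rewrite inE => /eqP ->; exact: l0.
have e1 := same_smoothing_trans (same_smoothing_cons v e) (same_smoothing_swap v w vs').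
have e2 := same_smoothing_trans e1 (same_smoothing_swap w v vs').
have hsub l' : vlinear l' -> {in v :: vs, forall v, l' v = 0} ->
    l' v = 0 /\ {in w :: vs', forall v, l' v = 0}.
  move=> ll' l'0; split; first by apply: l'0; rewrite mem_head.
  by apply: h => // u us; apply: l'0; rewrite inE us orbT.
set r := Num.sqrt (l v ^+ 2 + l w ^+ 2).
have r2 : r ^+ 2 = l v ^+ 2 + l w ^+ 2 by rewrite sqr_sqrtr// addr_ge0// sqr_ge0.
have [r0|r0] := eqVneq r 0.
  have /andP[/eqP lv0 _] : (l v == 0) && (l w == 0).
    by rewrite -[l v == 0]sqrf_eq0 -[l w == 0]sqrf_eq0 -paddr_eq0 ?sqr_ge0// -r2 r0 expr0n.
  exists w, (v :: vs'); split => //.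
    by move=> u; rewrite inE => /orP[/eqP -> //|]; exact: lvs'.
  move=> l' ll' l'0 u; have [l'v h'] := hsub l' ll' l'0.
  rewrite !inE => /or3P[/eqP ->|/eqP -> //|uvs']; apply: h'; first exact: mem_head.
  by rewrite inE uvs' orbT.
have cs1 : (l v / r) ^+ 2 + (l w / r) ^+ 2 = 1.
  by rewrite !exprMn -mulrDl -r2 exprVn mulfV// sqrf_eq0.
exists (vcomb (l v / r) v (l w / r) w),
  (vcomb (- (l w / r)) v (l v / r) w :: vs'); split.
- exact: same_smoothing_trans e2 (same_smoothing_rotation _ _ _ cs1).
- rewrite ll (_ : _ + _ = r ^+ 2 / r); last by rewrite r2; ring.
  by rewrite expr2 mulfK// sqrtr_ge0.
- move=> u; rewrite inE => /orP[/eqP ->|]; last exact: lvs'.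
  by rewrite ll; ring.
- move=> l' ll' l'0 u; have [l'v h'] := hsub l' ll' l'0.
  have l'w : l' w = 0 by apply: h'; exact: mem_head.
  rewrite !inE => /or3P[/eqP ->|/eqP -> //|uvs'].
  + by rewrite ll' l'v l'w !mulr0 addr0.
  + by rewrite ll' l'v l'w !mulr0 addr0.
  + by apply: h'; rewrite inE uvs' orbT.
Qed.

(** Four pivots, one for each coordinate, each preserving the zeros already obtained. The vectors
    left over have four vanishing coordinates and smooth trivially. *)
Lemma smoothing_cholesky (vs : seq vec) : exists w1 w2 w3 w4 : vec,
  [/\ forall F, nnmeas F ->
        smooths vs F = smooth w1 (smooth w2 (smooth w3 (smooth w4 F))),
      forall p q, vlinear p -> vlinear q -> \sum_(v <- vs) p v * q v =
        p w1 * q w1 + p w2 * q w2 + p w3 * q w3 + p w4 * q w4,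
      [/\ 0 <= w1.1.1, 0 <= w2.1.2, 0 <= w3.2.1 & 0 <= w4.2.2],
      w2.1.1 = 0 /\ w3.1 = (0, 0) & w4.1 = (0, 0) /\ w4.2.1 = 0].
Proof.
have l11 : vlinear (fun v : vec => v.1.1) by [].
have l12 : vlinear (fun v : vec => v.1.2) by [].
have l21 : vlinear (fun v : vec => v.2.1) by [].
have l22 : vlinear (fun v : vec => v.2.2) by [].
have [w1 [vs1 [e1 d1 z1 k1]]] := smoothing_pivot vs l11.
have [w2 [vs2 [e2 d2 z2 k2]]] := smoothing_pivot vs1 l12.
have [w3 [vs3 [e3 d3 z3 k3]]] := smoothing_pivot vs2 l21.
have [w4 [vs4 [e4 d4 z4 k4]]] := smoothing_pivot vs3 l22.
have e : same_smoothing vs [:: w1, w2, w3, w4 & vs4].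
  apply: (same_smoothing_trans e1); apply: same_smoothing_cons.
  apply: (same_smoothing_trans e2); apply: same_smoothing_cons.
  by apply: (same_smoothing_trans e3); apply: same_smoothing_cons.
have t l' (ws ws' : seq vec) w : {in w :: ws', forall v : vec, l' v = 0 :> R} ->
   l' w = 0 /\ {in ws', forall v : vec, l' v = 0}.
  move=> h; split; first by apply: h; rewrite mem_head.
  by move=> v vws; apply: h; rewrite inE vws orbT.
have [z11w2 z11v2] := t _ vs _ _ (k2 _ l11 z1).
have [z11w3 z11v3] := t _ vs _ _ (k3 _ l11 z11v2).
have [z12w3 z12v3] := t _ vs _ _ (k3 _ l12 z2).
have [z11w4 z11v4] := t _ vs _ _ (k4 _ l11 z11v3).
have [z12w4 z12v4] := t _ vs _ _ (k4 _ l12 z12v3).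
have [z21w4 z21v4] := t _ vs _ _ (k4 _ l21 z3).
have v40 : {in vs4, forall v, v = vzero}.
  move=> v vv; rewrite /vzero; move: (z11v4 v vv) (z12v4 v vv) (z21v4 v vv) (z4 v vv).
  by case: v {vv} => [[? ?] [? ?]] /= -> -> -> ->.
have l0 l' : vlinear l' -> l' vzero = 0.
  move=> ll'; have := ll' 0 vzero 0 vzero; rewrite !mul0r addr0.
  by rewrite /vcomb /= !mul0r addr0.
have [eF eG] := e.
exists w1, w2, w3, w4; split.
- move=> F nF; rewrite (eF F nF).
  transitivity (smooth w1 (smooth w2 (smooth w3 (smooth w4 (smooths vs4 F))))).
    by [].
  suff -> : smooths vs4 F = F by [].
  elim: {e e4 z4 k4 z11v4 z12v4 z21v4 eF eG} vs4 v40 => // v vs4 IH v40.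
  transitivity (smooth v (smooths vs4 F)); first by [].
  have -> : v = vzero by apply: v40; rewrite mem_head.
  rewrite IH; last by move=> u uv; apply: v40; rewrite inE uv orbT.
  by apply: funext => x; exact: smooth0.
- move=> p q lp lq; rewrite eG// !big_cons big_seq big1 ?addr0 ?addrA//.
  by move=> v /v40 ->; rewrite !l0// mul0r.
- by split.
- by split => //; case: w3 {e e3 d3 k3 eF eG} z11w3 z12w3 => [[? ?] ?] /= -> ->.
- by split => //; case: w4 {e e4 d4 k4 eF eG} z11w4 z12w4 {z21w4} => [[? ?] ?] /= -> ->.
Qed.

End cholesky.

(** A measure that factors on rectangles is the product measure, so Tonelli applies to the law of an
    independent pair. *)
Lemma ge0_integral_product_unique d1 d2 (T1 : measurableType d1)
    (T2 : measurableType d2) (R : realType)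
    (m1 : {sigma_finite_measure set T1 -> \bar R})
    (m2 : {sigma_finite_measure set T2 -> \bar R})
    (m' : {measure set (T1 * T2)%type -> \bar R}) (G : T1 * T2 -> \bar R) :
  (forall A B, measurable A -> measurable B -> m' (A `*` B) = m1 A * m2 B)%E ->
  measurable_fun setT G -> (forall z, 0 <= G z)%E ->
  (\int[m']_z G z = \int[m1]_x \int[m2]_y G (x, y))%E.
Proof.
move=> m'E mG G0; rewrite -[RHS](fubini_tonelli1 (m1 := m1) (m2 := m2) G mG G0).
by apply: eq_measure_integral => E mE _; rewrite -(product_measure_unique m'E).
Qed.

(** * Law of a sum of independent Gaussian terms *)

Section independent_sum.
Context {R : realType} d (T : measurableType d) (P : probability T R).
Context {I : choiceType} (A : set I) (X : I -> T -> R * R) (p q : I -> R * R * (R * R)).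
Local Notation vec := (R * R * (R * R))%type.
Hypothesis mX : forall i, A i -> measurable_fun setT (X i).
Hypothesis indepX : mutually_independent P A X.
Hypothesis lawX : forall i, A i -> forall B, measurable B ->
  P (X i @^-1` B) = gauss2 B.

Fixpoint gaussian_sum (s : seq I) (w : T) : vec :=
  if s is i :: s' then
    vcomb 1 (vcomb 1 (gaussian_sum s' w) (X i w).1 (p i)) (X i w).2 (q i)
  else vzero.

(** The vectors of the head go to the end of the list: its variables are added last to the sum,
    hence integrated innermost. *)
Fixpoint sum_vectors (s : seq I) : seq vec :=
  if s is i :: s' then sum_vectors s' ++ [:: p i; q i] else [::].

Lemma big_sum_vectors (f : vec -> R) s :
  \sum_(v <- sum_vectors s) f v = \sum_(i <- s) (f (p i) + f (q i)).
Proof.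
elim: s => [|i s IH] /=; first by rewrite !big_nil.
by rewrite big_cat /= IH !big_cons big_nil addr0 addrC.
Qed.

Lemma measurable_gaussian_sum s : {in s, forall i, A i} ->
  measurable_fun setT (gaussian_sum s).
Proof.
elim: s => [_|i s IH sA]; first exact: measurable_cst.
have mXi : measurable_fun setT (X i) by apply/mX/sA; rewrite mem_head.
have mS : measurable_fun setT (gaussian_sum s).
  by apply: IH => j js; apply: sA; rewrite inE js orbT.
apply: measurable_vcomb; first exact: measurable_cst.
- exact: measurableT_comp.
- apply: measurable_vcomb; [exact: measurable_cst| |exact: mS|exact: measurable_cst].
  exact: measurableT_comp.
- exact: measurable_cst.
Qed.

Local Open Scope ereal_scope.

Let measurable_bigcap_preim (J : {fset I}) C : {in J, forall i, A i} ->
  (forall i, i \in J -> measurable (C i)) ->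
  measurable (\bigcap_(i in [set` J]) (X i @^-1` C i)).
Proof.
move=> JA mC; apply: fin_bigcap_measurable => //= i iJ.
by rewrite -[X in measurable X]setTI; apply: (mX (JA _ iJ)) => //; exact: mC.
Qed.

(** Mutual independence speaks only of preimages under single variables. Keeping an arbitrary finite
    set [J] of further variables in the statement lets the induction move [i] from the sum into
    [J]. *)
Lemma gaussian_sum_indep s (J : {fset I}) (B : set vec) (C : I -> set (R * R)) :
  uniq s -> {in s, forall i, A i} -> {in J, forall i, A i} ->
  {in s, forall i, i \notin J} -> measurable B ->
  (forall i, i \in J -> measurable (C i)) ->
  P (gaussian_sum s @^-1` B `&` \bigcap_(i in [set` J]) (X i @^-1` C i)) =
  P (gaussian_sum s @^-1` B) * \prod_(i <- J) P (X i @^-1` C i).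
Proof.
elim: s J B C => [|i s IH] J B C.
  move=> _ _ JA _ mB mC; have JA' : [set` J] `<=` A by move=> i /= /JA.
  rewrite -(indepX JA' mC).
  have [B0|B0] := pselect (B vzero).
    have -> : gaussian_sum [::] @^-1` B = setT by apply/seteqP; split.
    by rewrite setTI probability_setT mul1e.
  have -> : gaussian_sum [::] @^-1` B = set0 by apply/seteqP; split.
  by rewrite set0I measure0 mul0e.
move=> /= /andP[nis us] sA JA sJ mB mC.
have Ai : A i by apply: sA; rewrite mem_head.
have sA' : {in s, forall i, A i} by move=> j js; apply: sA; rewrite inE js orbT.
have mXi := mX Ai.
have mS := measurable_gaussian_sum sA'.
have mD := measurable_bigcap_preim JA mC.
set D := \bigcap_(i in [set` J]) _ in mD *.
pose Y (w : T) : vec * (R * R) := (gaussian_sum s w, X i w).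
have mY : measurable_fun setT Y by exact: measurable_fun_pair.
(* [nu] is the law of the pair (partial sum, [X i]) on the event [D], and [nu1] the same law without
   restriction. Both factor on rectangles by the induction hypothesis, and they differ by the factor
   [P D]; the event to be measured is the preimage of the set [E] below. *)
pose nu := measure_function_pushforward__canonical__measure_function_Measure
  (mrestr P mD) mY.
pose nu1 := measure_function_pushforward__canonical__measure_function_Measure P mY.
pose Sm : {mfun T >-> vec} := HB.pack (gaussian_sum s)
  (isMeasurableFun.Build _ _ _ _ _ mS).
pose Xm : {mfun T >-> (R * R)%type} := HB.pack (X i)
  (isMeasurableFun.Build _ _ _ _ _ mXi).
pose c : {nonneg R} := NngNum (fine_ge0 (measure_ge0 P D)).
have cE : \prod_(j <- J) P (X j @^-1` C j) = c%:num%:E.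
  by rewrite /= fineK ?fin_num_measure// -(indepX _ mC)// => j /= /JA.
have iJ : i \notin J by apply: sJ; rewrite mem_head.
have nuE (E1 : set vec) (E2 : set (R * R)) : measurable E1 -> measurable E2 ->
    nu (E1 `*` E2) = distribution P Sm E1 * mscale c (distribution P Xm) E2.
  move=> mE1 mE2.
  pose C' j := if j == i then E2 else C j.
  have := IH (i |` J)%fset E1 C' us sA'.
  have -> : gaussian_sum s @^-1` E1 `&` \bigcap_(j in [set` (i |` J)%fset]) X j @^-1` C' j
     = Y @^-1` (E1 `*` E2) `&` D.
    apply/seteqP; split => w /=.
      move=> [wE1 h]; split; first split => //.
        by have := h i; rewrite /= !inE eqxx /C' eqxx; apply.
      move=> j /= jJ; have := h j; rewrite /= !inE jJ orbT /C'.
      by case: eqP => [ji|_]; [rewrite -ji jJ in iJ|apply].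
    move=> [[wE1 wE2] h]; split => // j /=; rewrite !inE /C'.
    case: eqP => [-> //|_] /= jJ; exact: h.
  move=> h; transitivity (P (Y @^-1` (E1 `*` E2) `&` D)); first by [].
  rewrite h{h}; last first.
  - move=> j; rewrite !inE /C'; case: eqP => //= _; exact: mC.
  - exact: mE1.
  - move=> j js; rewrite !inE negb_or; apply/andP; split.
      by apply: contraNneq nis => <-.
    by apply: sJ; rewrite inE js orbT.
  - by move=> j; rewrite !inE => /orP[/eqP ->//|]; exact: JA.
  rewrite /distribution /mscale /= /pushforward /= -cE; congr (_ * _).
  rewrite big_fsetU1//= /C' eqxx muleC; congr (_ * _).
  apply: eq_fbigr => j jJ _; case: eqP => // ji.
  by rewrite -ji jJ in iJ.
have nu1E (E1 : set vec) (E2 : set (R * R)) : measurable E1 -> measurable E2 ->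
    nu1 (E1 `*` E2) = distribution P Sm E1 * distribution P Xm E2.
  move=> mE1 mE2.
  have := IH [fset i]%fset E1 (fun=> E2) us sA'.
  have -> : gaussian_sum s @^-1` E1 `&` \bigcap_(j in [set` [fset i]%fset]) X j @^-1` E2
     = Y @^-1` (E1 `*` E2).
    apply/seteqP; split => w /=.
      by move=> [wE1 h]; split => //; have := h i; rewrite /= !inE eqxx; apply.
    by move=> [wE1 wE2]; split => // j /=; rewrite !inE => /eqP ->.
  rewrite big_seq_fset1 => h; transitivity (P (Y @^-1` (E1 `*` E2))); first by [].
  apply: h => //.
  - by move=> j; rewrite !inE => /eqP ->.
  - by move=> j js; rewrite !inE; apply: contraNneq nis => <-.
pose E := [set z : vec * (R * R) | B (vcomb 1 (vcomb 1 z.1 z.2.1 (p i)) z.2.2 (q i))].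
have mE : measurable E.
  rewrite -[E]setTI.
  have mh : measurable_fun setT (fun z : vec * (R * R) =>
      vcomb 1 (vcomb 1 z.1 z.2.1 (p i)) z.2.2 (q i)).
    have m2 : measurable_fun setT (fun z : vec * (R * R) => z.2.1).
      exact: measurableT_comp.
    have m3 : measurable_fun setT (fun z : vec * (R * R) => z.2.2).
      exact: measurableT_comp.
    apply: measurable_vcomb => //; exact: measurable_vcomb.
  exact: mh.
have h1 := product_measure_unique nuE mE.
have h2 := product_measure_unique nu1E mE.
transitivity (nu E); first by [].
transitivity (nu1 E * c%:num%:E); last by rewrite cE.
rewrite -h1 -h2 muleC /product_measure1 -ge0_integralZl//.
exact: measurable_fun_xsection.
Qed.

(** For a fixed partial sum, integrating the independent pair [X i] smooths [F] along [p i] and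
    [q i]; the induction hypothesis applies to the smoothed function. *)
Lemma integral_gaussian_sum s (F : vec -> \bar R) :
  uniq s -> {in s, forall i, A i} -> nnmeas F ->
  \int[P]_w F (gaussian_sum s w) = smooths (sum_vectors s) F vzero.
Proof.
elim: s F => [|i s IH] F.
  move=> _ _ [_ F0]; transitivity (\int[P]_w cst (F vzero) w); first by [].
  by rewrite integral_cst// [X in _ * X]probability_setT mule1.
move=> /= /andP[nis us] sA nF.
have Ai : A i by apply: sA; rewrite mem_head.
have sA' : {in s, forall i, A i} by move=> j js; apply: sA; rewrite inE js orbT.
have mXi := mX Ai.
have mS := measurable_gaussian_sum sA'.
pose Y (w : T) : vec * (R * R) := (gaussian_sum s w, X i w).
have mY : measurable_fun setT Y by exact: measurable_fun_pair.
pose nu := measure_function_pushforward__canonical__measure_function_Measure P mY.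
pose Sm : {mfun T >-> vec} := HB.pack (gaussian_sum s)
  (isMeasurableFun.Build _ _ _ _ _ mS).
have nuE (E1 : set vec) (E2 : set (R * R)) : measurable E1 -> measurable E2 ->
    nu (E1 `*` E2) = distribution P Sm E1 * gauss2 E2.
  move=> mE1 mE2; rewrite -(lawX Ai)//.
  have := @gaussian_sum_indep s [fset i]%fset E1 (fun=> E2) us sA'.
  have -> : gaussian_sum s @^-1` E1 `&` \bigcap_(j in [set` [fset i]%fset]) X j @^-1` E2
     = Y @^-1` (E1 `*` E2).
    apply/seteqP; split => w /=.
      by move=> [wE1 h]; split => //; have := h i; rewrite /= !inE eqxx; apply.
    by move=> [wE1 wE2]; split => // j /=; rewrite !inE => /eqP ->.
  rewrite big_seq_fset1 => h; transitivity (P (Y @^-1` (E1 `*` E2))); first by [].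
  apply: h => //.
  - by move=> j; rewrite !inE => /eqP ->.
  - by move=> j js; rewrite !inE; apply: contraNneq nis => <-.
pose G (z : vec * (R * R)) := F (vcomb 1 (vcomb 1 z.1 z.2.1 (p i)) z.2.2 (q i)).
have mG : measurable_fun setT G.
  have m2 : measurable_fun setT (fun z : vec * (R * R) => z.2.1).
    exact: measurableT_comp.
  have m3 : measurable_fun setT (fun z : vec * (R * R) => z.2.2).
    exact: measurableT_comp.
  apply: (measurableT_comp nF.1); apply: measurable_vcomb => //.
  exact: measurable_vcomb.
have G0 z : 0 <= G z by exact: nF.2.
transitivity (\int[P]_w smooth (p i) (smooth (q i) F) (gaussian_sum s w)); last first.
  rewrite IH//; last by apply: nnmeas_smooth; exact: nnmeas_smooth.
  by rewrite /smooths foldr_cat.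
transitivity (\int[nu]_z G z).
  by rewrite ge0_integral_pushforward.
rewrite (ge0_integral_product_unique (m1 := distribution P Sm) (m2 := gauss2) nuE mG G0).
transitivity (\int[distribution P Sm]_x smooth (p i) (smooth (q i) F) x).
  apply: eq_integral => x _.
  have mGx : measurable_fun setT (fun y => G (x, y)).
    by apply: measurableT_comp => //; exact: measurable_fun_pair.
  by rewrite (fubini_tonelli1 (m1 := gauss) (m2 := gauss) _ mGx (fun y => G0 _)).
rewrite ge0_integral_distribution//.
- by apply: (nnmeas_smooth _ (nnmeas_smooth _ nF)).1.
- by move=> x; apply: (nnmeas_smooth _ (nnmeas_smooth _ nF)).2.
Qed.

End independent_sum.

(** * Two weakly correlated pairs of Gaussian variables *)

Section conditional_density.
Context {R : realType}.
Variables (r11 r12 r21 r22 a b c : R).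
Hypotheses (a0 : 0 < a) (c0 : 0 < c).
Hypothesis ha : a ^+ 2 = 1 - r11 ^+ 2 - r21 ^+ 2.
Hypothesis hab : a * b = - (r11 * r12 + r21 * r22).
Hypothesis hbc : b ^+ 2 + c ^+ 2 = 1 - r12 ^+ 2 - r22 ^+ 2.
Let rho2 := r11 ^+ 2 + r12 ^+ 2 + r21 ^+ 2 + r22 ^+ 2.
(** Determinant of the conditional covariance [I - R^T R] of the second pair given the first, where
    [R] is the matrix of the correlations [r_ij]; the numbers [a, b, c] form the triangular factor
    of this covariance. *)
Let D := (a * c) ^+ 2.

Let DE : D = a ^+ 2 * (b ^+ 2 + c ^+ 2) - (a * b) ^+ 2.
Proof. by rewrite /D; ring. Qed.

Let D_gt0 : 0 < D.
Proof. by rewrite exprn_gt0// mulr_gt0. Qed.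

Let cauchy2 (x y z t : R) : (x * z + y * t) ^+ 2 <= (x ^+ 2 + y ^+ 2) * (z ^+ 2 + t ^+ 2).
Proof.
rewrite -subr_ge0 (_ : _ - _ = (x * t - y * z) ^+ 2) ?sqr_ge0//; by ring.
Qed.

Let lower_det : 1 - rho2 <= D.
Proof.
rewrite DE ha hab hbc /rho2 -subr_ge0.
rewrite (_ : _ - _ = (r11 * r22 - r12 * r21) ^+ 2) ?sqr_ge0//; by ring.
Qed.

(** The conditional covariance is at most the identity, hence its inverse is at least the identity.
    Multiplied by the determinant, the difference is [|R y|^2 - (det R)^2 |y|^2], which is
    nonnegative by Cauchy-Schwarz because the entries of [R] have square sum at most 1. *)
Lemma cholesky_form_ge (y1 y2 : R) : rho2 <= 1 ->
  y1 ^+ 2 + y2 ^+ 2 <= (y1 / a) ^+ 2 + ((y2 - b * (y1 / a)) / c) ^+ 2.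
Proof.
move=> rho1.
set u := y1 / a; set v := (y2 - b * u) / c.
have e : D * (u ^+ 2 + v ^+ 2) =
    (b ^+ 2 + c ^+ 2) * y1 ^+ 2 - 2 * (a * b) * (y1 * y2) + a ^+ 2 * y2 ^+ 2.
  by rewrite /D /v /u; field; rewrite !gt_eqF.
rewrite -(ler_pM2l D_gt0) e DE ha hab hbc.
set p := r11 * y1 + r12 * y2; set q := r21 * y1 + r22 * y2.
set dl := r11 * r22 - r12 * r21.
have h1 : (dl * y1) ^+ 2 <= (r22 ^+ 2 + r12 ^+ 2) * (p ^+ 2 + q ^+ 2).
  have -> : dl * y1 = r22 * p + (- r12) * q by rewrite /dl /p /q; ring.
  by rewrite -[r12 ^+ 2]sqrrN; exact: cauchy2.
have h2 : (dl * y2) ^+ 2 <= (r21 ^+ 2 + r11 ^+ 2) * (p ^+ 2 + q ^+ 2).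
  have -> : dl * y2 = (- r21) * p + r11 * q by rewrite /dl /p /q; ring.
  by rewrite -[r21 ^+ 2]sqrrN; exact: cauchy2.
have h3 : rho2 * (p ^+ 2 + q ^+ 2) <= p ^+ 2 + q ^+ 2.
  by rewrite ler_piMl// addr_ge0// sqr_ge0.
rewrite -subr_ge0 (_ : _ - _ = p ^+ 2 + q ^+ 2 - (dl * y1) ^+ 2 - (dl * y2) ^+ 2).
  by move: h1 h2 h3; rewrite /rho2; set pq := _ + q ^+ 2; lra.
by rewrite /p /q /dl; ring.
Qed.

Hypotheses (b11 : `|r11| <= 32^-1) (b12 : `|r12| <= 32^-1)
  (b21 : `|r21| <= 32^-1) (b22 : `|r22| <= 32^-1).

Let sq_bound (r : R) : `|r| <= 32^-1 -> r ^+ 2 <= 1024^-1.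
Proof.
move=> h; rewrite -real_normK ?num_real//.
have -> : 1024^-1 = 32^-1 ^+ 2 :> R by rewrite exprVn -natrX.
by rewrite lerXn2r ?nnegrE.
Qed.

Let rho2_le : rho2 <= 256^-1.
Proof.
have := sq_bound b11; have := sq_bound b12; have := sq_bound b21.
by have := sq_bound b22; rewrite /rho2; lra.
Qed.

Let rho2_ge0 : 0 <= rho2.
Proof. by rewrite !addr_ge0 ?sqr_ge0. Qed.

(** The bilinear form of the inverse of the conditional covariance. *)
Definition inner_form (y1 y2 m1 m2 : R) :=
  (y1 / a) * (m1 / a) + (y2 - b * (y1 / a)) / c * ((m2 - b * (m1 / a)) / c).

Let D_ge : 63 / 64 <= D.
Proof. by have := lower_det; have := rho2_le; lra. Qed.

Lemma inner_form_le y1 y2 m1 m2 :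
  `|inner_form y1 y2 m1 m2| <= 64 / 63 * ((`|y1| + `|y2|) * (`|m1| + `|m2|)).
Proof.
have e : D * inner_form y1 y2 m1 m2 = (b ^+ 2 + c ^+ 2) * (y1 * m1)
    - (a * b) * (y1 * m2 + y2 * m1) + a ^+ 2 * (y2 * m2).
  by rewrite /D /inner_form; field; rewrite !gt_eqF.
have hs22 : `|b ^+ 2 + c ^+ 2| <= 1.
  rewrite ger0_norm ?addr_ge0 ?sqr_ge0// hbc.
  by have := sqr_ge0 r12; have := sqr_ge0 r22; lra.
have hs11 : `|a ^+ 2| <= 1.
  rewrite ger0_norm ?sqr_ge0// ha.
  by have := sqr_ge0 r11; have := sqr_ge0 r21; lra.
have hs12 : `|a * b| <= 1.
  rewrite hab normrN; apply: (le_trans (ler_normD _ _)); rewrite !normrM.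
  have h (x y : R) : `|x| <= 32^-1 -> `|y| <= 32^-1 -> `|x| * `|y| <= 1 / 2.
    move=> hx hy; apply: (le_trans (ler_pM _ _ hx hy)) => //; lra.
  by have := h _ _ b11 b12; have := h _ _ b21 b22; lra.
have h : D * `|inner_form y1 y2 m1 m2| <= (`|y1| + `|y2|) * (`|m1| + `|m2|).
  have -> : D * `|inner_form y1 y2 m1 m2| = `|D * inner_form y1 y2 m1 m2|.
    by rewrite normrM (gtr0_norm D_gt0).
  rewrite e.
  have t (k x y : R) : `|k| <= 1 -> `|k * (x * y)| <= `|x| * `|y|.
    by move=> hk; rewrite !normrM ler_piMl// mulr_ge0.
  rewrite mulrDr opprD addrA.
  apply: (le_trans (ler_normD _ _)).
  have := ler_normD ((b ^+ 2 + c ^+ 2) * (y1 * m1) - a * b * (y1 * m2)) (- (a * b * (y2 * m1))).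
  have := ler_normB ((b ^+ 2 + c ^+ 2) * (y1 * m1)) (a * b * (y1 * m2)).
  rewrite normrN.
  have := t _ y1 m1 hs22; have := t _ y1 m2 hs12; have := t _ y2 m1 hs12.
  have := t _ y2 m2 hs11; lra.
have h63 : 63 / 64 * `|inner_form y1 y2 m1 m2| <= D * `|inner_form y1 y2 m1 m2|.
  by rewrite ler_wpM2r// D_ge.
by move: h h63; set I := `|inner_form _ _ _ _|; set K := (_ + _) * _; lra.
Qed.

(** The density at [(y1, y2)] of the second pair when the first pair equals [(x1, x2)]: the
    conditional mean is [R^T x], and the triangular factor yields the two coordinates in turn. *)
Definition cond_density (x1 x2 y1 y2 : R) : R :=
  let m1 := r11 * x1 + r21 * x2 in let m2 := r12 * x1 + r22 * x2 in
  gauss_density ((y1 - m1) / a) / a *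
  (gauss_density ((y2 - (m2 + b * ((y1 - m1) / a))) / c) / c).

(** The linear terms cancel: for [z >= 0] the excess over 2 equals [(1 - exp (- z))^2 exp z], and
    [1 - exp (- z) <= z]. *)
Lemma expRDN_le (z : R) : expR z + expR (- z) <= 2 + z ^+ 2 * expR `|z|.
Proof.
wlog z0 : z / 0 <= z.
  move=> h; have [/h //|z0] := leP 0 z.
  by have := h (- z); rewrite opprK normrN sqrrN addrC; apply; lra.
rewrite ger0_norm//.
have e1 : expR z * expR (- z) = 1 by rewrite -expRD subrr expR0.
have h1 : 1 - z <= expR (- z) by have := expR_ge1Dx (- z); lra.
have h2 : 1 <= expR z by rewrite -[1]expR0 ler_expR.
have h3 : 0 <= 1 - expR (- z) by rewrite subr_ge0 -[leRHS]expR0 ler_expR; lra.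
have h4 : (1 - expR (- z)) ^+ 2 <= z ^+ 2 by rewrite lerXn2r ?nnegrE//; lra.
have h5 : (1 - expR (- z)) ^+ 2 * expR z <= z ^+ 2 * expR z.
  by rewrite ler_wpM2r// expR_ge0.
suff e : (1 - expR (- z)) ^+ 2 * expR z = expR z + expR (- z) - 2 by lra.
have -> : (1 - expR (- z)) ^+ 2 * expR z =
    expR z - 2 * (expR z * expR (- z)) + expR (- z) * (expR z * expR (- z)).
  by ring.
by rewrite e1; ring.
Qed.

Lemma sqr_le_expR (s : R) : 0 <= s -> s ^+ 2 <= 64 * expR (s / 4).
Proof.
move=> s0; have h := expR_ge1Dx (s / 8).
have -> : expR (s / 4) = expR (s / 8) ^+ 2.
  by rewrite expr2 -expRD; congr expR; field.
have h2 : (s / 8) ^+ 2 <= expR (s / 8) ^+ 2 by rewrite lerXn2r ?nnegrE ?expR_ge0//; lra.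
by apply: (le_trans _ (ler_wpM2l _ h2)); rewrite ?le_eqVlt; [apply/orP; left; apply/eqP; field|lra].
Qed.

(** The exponent of the conditional density is at most [- |y|^2 + 2 th] with [th] linear in [x].
    Adding the value at [- x] leaves [exp (2 th) + exp (- 2 th)], whose excess over 2 is quadratic
    in the correlations. The price is a factor [exp ((|x|^2 + |y|^2) / 2)], still integrable against
    the density [exp (- |x|^2)]. *)
Lemma cond_density_sym_le (x1 x2 y1 y2 : R) :
  cond_density x1 x2 y1 y2 + cond_density (- x1) (- x2) y1 y2 <=
  2 * (gauss_density y1 * gauss_density y2 * (1 + 200 * rho2 *
    (expR ((x1 ^+ 2 + x2 ^+ 2) / 2) * expR ((y1 ^+ 2 + y2 ^+ 2) / 2)))).
Proof.
set m1 := r11 * x1 + r21 * x2; set m2 := r12 * x1 + r22 * x2.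
set th := inner_form y1 y2 m1 m2.
set Y := y1 ^+ 2 + y2 ^+ 2; set X := x1 ^+ 2 + x2 ^+ 2.
have [K K0 gE] : exists2 K : R, 0 <= K & forall z, gauss_density z = K * expR (- z ^+ 2).
  by exists (Num.sqrt pi)^-1; rewrite ?invr_ge0.
have gg (z t : R) : gauss_density z * gauss_density t = K * K * expR (- (z ^+ 2 + t ^+ 2)).
  by rewrite !gE mulrACA -expRD opprD.
have half (e : R) m1' m2' : m1' = e * m1 -> m2' = e * m2 -> e ^+ 2 = 1 ->
    gauss_density ((y1 - m1') / a) / a *
      (gauss_density ((y2 - (m2' + b * ((y1 - m1') / a))) / c) / c) <=
    K * K * expR (- Y) * ((a * c)^-1 * expR (e * (2 * th))).
  move=> -> -> e1; rewrite mulrACA gg -invfM [leRHS]mulrCA [leLHS]mulrC.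
  apply: ler_wpM2l; first by rewrite invr_ge0 mulr_ge0 ?ltW.
  rewrite -!mulrA !ler_wpM2l// -expRD ler_expR.
  have : Y <= (y1 / a) ^+ 2 + ((y2 - b * (y1 / a)) / c) ^+ 2.
    by apply: cholesky_form_ge; have := rho2_le; lra.
  have n1 := sqr_ge0 (m1 / a); have n2 := sqr_ge0 ((m2 - b * (m1 / a)) / c).
  rewrite (_ : - (_ + _) = - ((y1 / a) ^+ 2 + ((y2 - b * (y1 / a)) / c) ^+ 2) +
      e * (2 * th) - e ^+ 2 * ((m1 / a) ^+ 2 + ((m2 - b * (m1 / a)) / c) ^+ 2)).
    by rewrite e1; lra.
  by rewrite /th /inner_form; field; rewrite !gt_eqF.
have h1 := half 1 m1 m2 (esym (mul1r _)) (esym (mul1r _)) (expr1n _ 2).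
have e1 : (-1 : R) ^+ 2 = 1 by rewrite sqrrN expr1n.
have h2 := half (-1) (r11 * - x1 + r21 * - x2) (r12 * - x1 + r22 * - x2)
  ltac:(rewrite /m1; ring) ltac:(rewrite /m2; ring) e1.
apply: (le_trans (lerD h1 h2)) => {h1 h2 half}.
rewrite gg -/Y -mulrDr [leRHS]mulrCA ler_wpM2l ?mulr_ge0 ?expR_ge0//.
rewrite -mulrDr mul1r mulN1r.
(* The first bound keeps the exponential of [2 th] integrable; the second shows that [th] is of
   first order in the correlations. *)
have hth : `|2 * th| <= (X + Y) / 4 /\ (2 * th) ^+ 2 <= 5 * rho2 * (X + Y) ^+ 2.
  have := inner_form_le y1 y2 m1 m2; rewrite -/th => hth.
  pose A1 := `|y1| + `|y2|; pose B1 := `|x1| + `|x2|; pose M1 := `|m1| + `|m2|.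
  have A0 : 0 <= A1 by rewrite addr_ge0.
  have B0 : 0 <= B1 by rewrite addr_ge0.
  have M0 : 0 <= M1 by rewrite addr_ge0.
  have nsq (x : R) : `|x| ^+ 2 = x ^+ 2 by rewrite real_normK ?num_real.
  have A2 : A1 ^+ 2 <= 2 * Y.
    rewrite /A1 /Y -(nsq y1) -(nsq y2) -subr_ge0.
    rewrite (_ : _ - _ = (`|y1| - `|y2|) ^+ 2) ?sqr_ge0//; by ring.
  have B2 : B1 ^+ 2 <= 2 * X.
    rewrite /B1 /X -(nsq x1) -(nsq x2) -subr_ge0.
    rewrite (_ : _ - _ = (`|x1| - `|x2|) ^+ 2) ?sqr_ge0//; by ring.
  have M2 : M1 ^+ 2 <= 2 * (rho2 * X).
    have t1 : m1 ^+ 2 <= (r11 ^+ 2 + r21 ^+ 2) * X by exact: cauchy2.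
    have t2 : m2 ^+ 2 <= (r12 ^+ 2 + r22 ^+ 2) * X by exact: cauchy2.
    have t3 : M1 ^+ 2 <= 2 * (m1 ^+ 2 + m2 ^+ 2).
      rewrite /M1 -(nsq m1) -(nsq m2) -subr_ge0.
      rewrite (_ : _ - _ = (`|m1| - `|m2|) ^+ 2) ?sqr_ge0//; by ring.
    have -> : rho2 * X = (r11 ^+ 2 + r21 ^+ 2) * X + (r12 ^+ 2 + r22 ^+ 2) * X.
      by rewrite /rho2; ring.
    by lra.
  have MB : M1 <= B1 / 16.
    have t (r r' : R) : `|r| <= 32^-1 -> `|r'| <= 32^-1 ->
        `|r * x1 + r' * x2| <= B1 / 32.
      move=> hr hr'; apply: (le_trans (ler_normD _ _)); rewrite !normrM /B1.
      have := ler_wpM2r (normr_ge0 x1) hr; have := ler_wpM2r (normr_ge0 x2) hr'.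
      lra.
    by have := t _ _ b11 b21; have := t _ _ b12 b22; rewrite -/m1 -/m2 /M1; lra.
  rewrite -/A1 -/M1 in hth.
  split.
    have AM : A1 * M1 <= A1 * (B1 / 16) by rewrite ler_wpM2l.
    have AB : A1 * B1 <= (A1 ^+ 2 + B1 ^+ 2) / 2.
      rewrite -subr_ge0 (_ : _ - _ = (A1 - B1) ^+ 2 / 2).
        by rewrite divr_ge0 ?sqr_ge0.
      by field.
    rewrite normrM ger0_norm//; move: hth AM AB A2 B2; rewrite mulrA.
    have X0 : 0 <= X by rewrite addr_ge0 ?sqr_ge0.
    have Y0 : 0 <= Y by rewrite addr_ge0 ?sqr_ge0.
    lra.
  have X0 : 0 <= X by rewrite addr_ge0 ?sqr_ge0.
  have Y0 : 0 <= Y by rewrite addr_ge0 ?sqr_ge0.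
  have h : (2 * th) ^+ 2 <= (128 / 63) ^+ 2 * (A1 ^+ 2 * M1 ^+ 2).
    have -> : (128 / 63) ^+ 2 * (A1 ^+ 2 * M1 ^+ 2) = (128 / 63 * (A1 * M1)) ^+ 2.
      by rewrite !exprMn.
    rewrite -(nsq (2 * th)) lerXn2r ?nnegrE//.
      by apply: mulr_ge0 => //; apply: mulr_ge0.
    by rewrite normrM ger0_norm//; move: hth; lra.
  apply: (le_trans h).
  have h1 : A1 ^+ 2 * M1 ^+ 2 <= (2 * Y) * (2 * (rho2 * X)).
    by apply: ler_pM => //; exact: sqr_ge0.
  have h2 : Y * X <= (X + Y) ^+ 2 / 4.
    rewrite -subr_ge0 (_ : _ - _ = (X - Y) ^+ 2 / 4); last by field.
    by rewrite divr_ge0 ?sqr_ge0.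
  have h3 : rho2 * (Y * X) <= rho2 * ((X + Y) ^+ 2 / 4) by rewrite ler_wpM2l.
  have h4 : 2 * Y * (2 * (rho2 * X)) = 4 * (rho2 * (Y * X)) by ring.
  have h5 : rho2 * ((X + Y) ^+ 2 / 4) = (rho2 * (X + Y) ^+ 2) / 4 by ring.
  have h6 : 0 <= rho2 * (X + Y) ^+ 2 by rewrite mulr_ge0// sqr_ge0.
  rewrite h4 in h1; rewrite h5 in h3.
  have h7 : (128 / 63) ^+ 2 * (A1 ^+ 2 * M1 ^+ 2) <= (128 / 63) ^+ 2 * (rho2 * (X + Y) ^+ 2).
    by rewrite ler_wpM2l ?sqr_ge0//; lra.
  rewrite -[leRHS]mulrA; apply: (le_trans h7); rewrite ler_wpM2r//.
  by rewrite (_ : (128 / 63) ^+ 2 = 16384 / 3969); [lra|field].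
have [h1 h2] := hth.
set s := X + Y in h1 h2.
have s0 : 0 <= s by rewrite !addr_ge0 ?sqr_ge0.
rewrite -expRD -mulrDl -/s.
have E1 : 1 <= expR (s / 2) by rewrite -[leLHS]expR0 ler_expR divr_ge0.
have hz : expR (2 * th) + expR (- (2 * th)) <= 2 + 320 * rho2 * expR (s / 2).
  apply: (le_trans (expRDN_le _)); rewrite lerD2l.
  (* One factor [exp (s / 4)] absorbs [s^2] at the cost of 64, the other one bounds [exp |2 th|];
     together they give [exp (s / 2)]. *)
  apply: (@le_trans _ _ ((5 * rho2 * (64 * expR (s / 4))) * expR (s / 4))).
    apply: ler_pM; rewrite ?expR_ge0 ?sqr_ge0 ?ler_expR//.
    apply: (le_trans h2); rewrite ler_wpM2l ?mulr_ge0//; exact: sqr_le_expR.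
  rewrite le_eqVlt; apply/orP; left; apply/eqP.
  have -> : expR (s / 2) = expR (s / 4) * expR (s / 4).
    by rewrite -expRD; congr expR; field.
  by ring.
have ac0 : 0 < a * c by rewrite mulr_gt0.
(* The normalising factor is the inverse square root of the determinant, which is at least
   [1 - rho2]; it too deviates from 1 only at second order. *)
have hac : (a * c)^-1 <= 1 + rho2.
  have r1 : 0 <= 1 + rho2 by rewrite addr_ge0.
  rewrite -[leLHS]mul1r ler_pdivrMr//.
  have w0 : 0 <= (1 + rho2) * (a * c) by rewrite mulr_ge0// ltW.
  rewrite -(@expr_ge1 _ 2)// exprMn -/D.
  have t1 : (1 + rho2) ^+ 2 * (1 - rho2) <= (1 + rho2) ^+ 2 * D.
    by rewrite ler_wpM2l ?sqr_ge0.
  apply: le_trans t1; rewrite -subr_ge0.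
  rewrite (_ : _ - 1 = rho2 * (1 - rho2 - rho2 ^+ 2)); last by ring.
  rewrite mulr_ge0//; have := rho2_le.
  have : rho2 ^+ 2 <= rho2.
    by rewrite expr2 ler_piMl//; have := rho2_le; lra.
  lra.
have Z0 : 0 <= expR (2 * th) + expR (- (2 * th)) by rewrite addr_ge0 ?expR_ge0.
have t1 : (a * c)^-1 * (expR (2 * th) + expR (- (2 * th))) <=
    (1 + rho2) * (2 + 320 * rho2 * expR (s / 2)).
  by apply: ler_pM => //; rewrite invr_ge0 ltW.
apply: (le_trans t1).
set E := expR (s / 2) in E1 *.
have t2 : rho2 <= rho2 * E by rewrite ler_peMr.
have t3 : rho2 * (rho2 * E) <= 256^-1 * (rho2 * E).
  by rewrite ler_wpM2r// mulr_ge0//; lra.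
rewrite (_ : (1 + rho2) * _ = 2 + 2 * rho2 + 320 * (rho2 * E) + 320 * (rho2 * (rho2 * E))).
  have q0 : 0 <= rho2 * E by rewrite mulr_ge0//; lra.
  by lra.
by ring.
Qed.

End conditional_density.

(** * Gaussian integrals over double cones *)

Section gauss_integrals.
Context {R : realType}.
Local Notation mu := (@lebesgue_measure R).
Local Open Scope ereal_scope.

Lemma measurable_gauss_density_affine (c nu : R) :
  measurable_fun setT (fun y : R => (gauss_density ((y - nu) / c) / c)%R).
Proof.
apply: measurable_funM => //.
apply: (measurableT_comp measurable_gauss_density).
by apply: measurable_funM => //; exact: measurable_funB.
Qed.

Lemma ge0_integral_gauss_affine (c nu : R) (K : R -> \bar R) : (0 < c)%R ->
  measurable_fun setT K -> (forall x, 0 <= K x) ->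
  \int[gauss]_g K (nu + c * g)%R =
  \int[mu]_y (K y * (gauss_density ((y - nu) / c) / c)%:E).
Proof.
move=> c0 mK K0.
have mKc : measurable_fun setT (fun g : R => K (nu + c * g)%R).
  apply: (measurableT_comp mK); apply: measurable_funD => //;
  exact: measurable_funM.
rewrite (ge0_integral_gauss mKc (fun x => K0 _)).
pose G y := K y * (gauss_density ((y - nu) / c) / c)%:E.
have mG : measurable_fun setT G.
  apply: emeasurable_funM => //; apply/measurable_EFinP.
  exact: measurable_gauss_density_affine.
have G0 y : 0 <= G y.
  by rewrite mule_ge0// lee_fin divr_ge0 ?gauss_density_ge0// ltW.
have c0' : c != 0%R by rewrite gt_eqF.
have h := ge0_integral_affine nu c0' mG G0.
have mGc : measurable_fun setT (fun x => G (c * x + nu)%R).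
  apply: (measurableT_comp mG); apply: measurable_funD => //;
  exact: measurable_funM.
have cE : 0 <= c%:E by rewrite lee_fin ltW.
transitivity (c%:E * \int[mu]_x G (c * x + nu)%R); last first.
  by rewrite h gtr0_norm// muleA -EFinM mulfV// mul1e.
rewrite -(ge0_integralZl mu measurableT mGc (fun _ _ => G0 _) cE).
apply: eq_integral => x _; rewrite /G.
have -> : ((c * x + nu - nu) / c = x)%R by field.
by rewrite muleCA -EFinM [(nu + _)%R]addrC [(c * (_ / c))%R]mulrC divfK.
Qed.

Lemma ge0_integral_gaussN (K : R -> \bar R) :
  measurable_fun setT K -> (forall x, 0 <= K x) ->
  \int[gauss]_g K (- g)%R = \int[gauss]_g K g.
Proof.
move=> mK K0.
have mKN : measurable_fun setT (fun g : R => K (- g)%R).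
  by apply: (measurableT_comp mK).
rewrite (ge0_integral_gauss mKN (fun x => K0 _)) (ge0_integral_gauss mK K0).
pose G y := K y * (gauss_density y)%:E.
have mG : measurable_fun setT G.
  apply: emeasurable_funM => //; apply/measurable_EFinP.
  exact: measurable_gauss_density.
have G0 y : 0 <= G y by rewrite mule_ge0// lee_fin gauss_density_ge0.
have c0' : (-1)%R != 0%R :> R by rewrite oppr_eq0 oner_eq0.
have := ge0_integral_affine 0%R c0' mG G0.
rewrite normrN1 invr1 mul1e => <-.
apply: eq_integral => x _; rewrite /G addr0 mulN1r.
by rewrite /gauss_density sqrrN.
Qed.

Lemma ge0_integral_gauss2 (K : R * R -> \bar R) :
  measurable_fun setT K -> (forall x, 0 <= K x) ->
  \int[gauss2]_z K z = \int[gauss]_x \int[gauss]_y K (x, y).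
Proof.
by move=> mK K0; rewrite (fubini_tonelli1 (m1 := gauss) (m2 := gauss) _ mK K0).
Qed.

Lemma measurable_slice (K : R * R -> \bar R) x :
  measurable_fun setT K -> measurable_fun setT (fun y => K (x, y)).
Proof.
by move=> mK; apply: (measurableT_comp mK); exact: measurable_fun_pair.
Qed.

Lemma measurable_integral_gauss (K : R * R -> \bar R) :
  measurable_fun setT K -> (forall x, 0 <= K x) ->
  measurable_fun setT (fun x => \int[gauss]_y K (x, y)).
Proof.
by move=> mK K0; exact: (@measurable_fun_fubini_tonelli_F _ _ _ _ _ gauss K).
Qed.

Lemma ge0_integral_gauss2N (K : R * R -> \bar R) :
  measurable_fun setT K -> (forall x, 0 <= K x) ->
  \int[gauss2]_z K (- z.1, - z.2)%R = \int[gauss2]_z K z.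
Proof.
move=> mK K0.
have mKN : measurable_fun setT (fun z : R * R => K (- z.1, - z.2)%R).
  apply: (measurableT_comp mK); apply: measurable_fun_pair;
  exact: measurableT_comp.
rewrite (ge0_integral_gauss2 mKN (fun z => K0 _)) (ge0_integral_gauss2 mK K0).
rewrite -(ge0_integral_gaussN (measurable_integral_gauss mK K0)); last first.
  by move=> x; exact: integral_ge0.
apply: eq_integral => x _ /=.
exact: (ge0_integral_gaussN (measurable_slice _ mK)).
Qed.

(** A double cone around the second axis, thin for small [k] and invariant under [z -> - z]. *)
Definition strip (k : R) := [set z : R * R | `|z.1| <= k * `|z.2| ]%R.

Lemma measurable_strip k : measurable (strip k).
Proof.
have m (b : bool) : measurable_fun setT (fun z : R * R => (k * `|z.2| - `|z.1|)%R).
  apply: measurable_funB; last exact: measurableT_comp.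
  by apply: measurable_funM => //; exact: measurableT_comp.
rewrite (_ : strip k = (fun z : R * R => (k * `|z.2| - `|z.1|)%R) @^-1` `[0%R, +oo[).
  by rewrite -[X in measurable X]setTI; apply: (m true).
by apply/seteqP; split => z /=; rewrite in_itv/= andbT subr_ge0.
Qed.

(** The weight consumes half of the Gaussian decay. For fixed [y] the section has length [2 k |y|],
    and the remaining function of [y] is dominated by the density of twice a standard variable of
    [gauss], whose mass is 1. *)
Lemma integral_strip_expR (k : R) : (0 <= k)%R ->
  \int[gauss2]_z ((\1_(strip k) z)%:E * (expR ((z.1 ^+ 2 + z.2 ^+ 2) / 2))%:E)
  <= (4 * k)%:E.
Proof.
move=> k0; set K := fun z => _.
have mE : measurable_fun setT (fun z : R * R => expR ((z.1 ^+ 2 + z.2 ^+ 2) / 2)%R).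
  apply: measurableT_comp => //; apply: measurable_funM => //.
  by apply: measurable_funD; apply: measurable_funX.
have mK : measurable_fun setT K.
  apply: emeasurable_funM; apply/measurable_EFinP => //.
  by apply: measurable_indic; exact: measurable_strip.
have K0 z : 0 <= K z by rewrite mule_ge0 ?lee_fin ?expR_ge0.
rewrite (fubini_tonelli2 (m1 := gauss) (m2 := gauss) _ mK K0) /fubini_G.
pose p : R := ((Num.sqrt pi)^-1)%R.
have p0 : (0 <= p)%R by rewrite invr_ge0.
have p1 : (p <= 1)%R.
  rewrite invf_le1 ?sqrtr_gt0 ?pi_gt0// -[leLHS]sqrtr1 ler_wsqrtr//.
  by have := @pi_ge2 R; lra.
have inner y : \int[gauss]_x K (x, y) <= (p * (2 * k * `|y|) * expR (y ^+ 2 / 2))%:E.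
  rewrite ge0_integral_gauss//; last first.
    by apply: measurableT_comp => //; exact: measurable_fun_pair.
  have -> : \int[mu]_x (K (x, y) * (gauss_density x)%:E) =
     \int[mu]_(x in `[(- (k * `|y|))%R, (k * `|y|)%R])
        (p * expR (- x ^+ 2 / 2) * expR (y ^+ 2 / 2))%:E.
    rewrite [RHS]integral_mkcond; apply: eq_integral => x _.
    rewrite patchE /K /= indicE.
    have -> : ((x, y) \in strip k) = (`|x| <= k * `|y|)%R.
      by apply/idP/idP; rewrite inE.
    rewrite mem_setE in_itv/= -ler_norml.
    case: ifPn => _; last by rewrite !mul0e.
    rewrite mul1e -EFinM; congr EFin; rewrite /gauss_density mulrCA -/p.
    by rewrite -mulrA -!expRD; congr (_ * expR _)%R; field.
  apply: (@le_trans _ _ (\int[mu]_(x in `[(- (k * `|y|))%R, (k * `|y|)%R])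
    (p * expR (y ^+ 2 / 2))%:E)).
    apply: ge0_le_integral => //.
    - by move=> x _; rewrite lee_fin !mulr_ge0 ?expR_ge0.
    - apply/measurable_EFinP; apply: measurable_funTS; apply: measurable_funM => //.
      apply: measurable_funM => //; apply: measurableT_comp => //.
      by apply: measurable_funM => //; apply: measurableT_comp => //;
        exact: measurable_funX.
    - move=> x _; rewrite lee_fin ler_wpM2r ?expR_ge0// ler_piMr//.
      rewrite -[leRHS]expR0 ler_expR; have := sqr_ge0 x; lra.
  rewrite integral_cst//= lebesgue_measure_itv/= lte_fin.
  have ky : (0 <= k * `|y|)%R by rewrite mulr_ge0.
  case: ifPn => _; last first.
    by rewrite mule0 lee_fin !mulr_ge0 ?expR_ge0.
  rewrite -EFinD -EFinM lee_fin le_eqVlt; apply/orP; left; apply/eqP; ring.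
have mh : measurable_fun setT (fun y : R => (p * (2 * k * `|y|) * expR (y ^+ 2 / 2))%:E).
  apply/measurable_EFinP; apply: measurable_funM.
    by apply: measurable_funM => //; apply: measurable_funM => //; exact: measurableT_comp.
  by apply: measurableT_comp => //; apply: measurable_funM => //; exact: measurable_funX.
have h0 y : 0 <= (p * (2 * k * `|y|) * expR (y ^+ 2 / 2))%:E :> \bar R.
  by rewrite lee_fin !mulr_ge0 ?expR_ge0.
apply: (@le_trans _ _ (\int[gauss]_y (p * (2 * k * `|y|) * expR (y ^+ 2 / 2))%:E)).
  apply: ge0_le_integral => //.
  - by move=> y _; exact: integral_ge0.
  - exact: (@measurable_fun_fubini_tonelli_G _ _ _ _ _ gauss K).
rewrite ge0_integral_gauss//.
have mg2 : measurable_fun setT (fun y : R => (gauss_density ((y - 0) / 2) / 2)%:E).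
  by apply/measurable_EFinP; exact: measurable_gauss_density_affine.
have g20 y : 0 <= (gauss_density ((y - 0) / 2) / 2)%:E :> \bar R.
  by rewrite lee_fin divr_ge0 ?gauss_density_ge0.
have one : \int[mu]_y (gauss_density ((y - 0) / 2) / 2)%:E = 1.
  have e := @ge0_integral_gauss_affine 2%R 0%R (cst 1) (ltr0Sn _ _)
    (measurable_cst _) (fun _ => lee01).
  transitivity (\int[gauss]_(g in [set: R]) cst (1 : \bar R) g); last first.
    by rewrite integral_cst// [X in _ * X]probability_setT mule1.
  by rewrite e; apply: eq_integral => y _; rewrite mul1e.
have k4 : 0 <= (4 * k)%:E :> \bar R by rewrite lee_fin mulr_ge0.
rewrite -[leRHS]mule1 -one -(ge0_integralZl mu measurableT mg2 (fun _ _ => g20 _) k4).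
apply: ge0_le_integral => //.
- by move=> y _; rewrite mule_ge0// lee_fin gauss_density_ge0.
- apply: emeasurable_funM => //; apply/measurable_EFinP.
  exact: measurable_gauss_density.
- by apply: emeasurable_funM => //; exact: measurable_cst.
move=> y _; rewrite -!EFinM lee_fin subr0 /gauss_density -/p.
have -> : (p * (2 * k * `|y|) * expR (y ^+ 2 / 2) * (p * expR (- y ^+ 2)) =
  2 * k * p * (p * (`|y| * expR (- y ^+ 2 / 4)) * expR (- (y / 2) ^+ 2)))%R.
  have -> : (expR (- y ^+ 2) = expR (- y ^+ 2 / 2) * (expR (- y ^+ 2 / 4) * expR (- (y / 2) ^+ 2)))%R.
    by rewrite -!expRD; congr expR; field.
  have e1 : (expR (y ^+ 2 / 2) * expR (- y ^+ 2 / 2) = 1)%R.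
    by rewrite -expRD -[RHS]expR0; congr expR; field.
  transitivity (expR (y ^+ 2 / 2) * expR (- y ^+ 2 / 2) * (2 * k * p *
      (p * (`|y| * expR (- y ^+ 2 / 4)) * expR (- (y / 2) ^+ 2))))%R.
    by ring.
  by rewrite e1 mul1r.
have hy : (`|y| * expR (- y ^+ 2 / 4) <= 1)%R.
  rewrite mulNr expRN ler_pdivrMr ?expR_gt0// mul1r.
  apply: le_trans (expR_ge1Dx _).
  rewrite -[(y ^+ 2)%R]real_normK ?num_real//.
  have := sqr_ge0 (`|y| / 2 - 1)%R; rewrite sqrrB; lra.
have t1 : (p * (`|y| * expR (- y ^+ 2 / 4)) <= 1)%R.
  apply: (le_trans (ler_wpM2l p0 hy)); rewrite mulr1//.
have E0 := expR_ge0 (- (y / 2) ^+ 2).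
rewrite (_ : (4 * k * _ = 2 * k * p * (1 * expR (- (y / 2) ^+ 2)))%R); last by field.
by apply: ler_wpM2l; [rewrite !mulr_ge0|exact: ler_wpM2r].
Qed.

End gauss_integrals.

(** * Joint probability of two double cones *)

Section gaussian_vectors.
Context {R : realType}.
Local Notation mu := (@lebesgue_measure R).
Local Notation vec := (R * R * (R * R))%type.
Implicit Types (vs : seq vec) (w : vec).

Lemma smooth_cst w (F : vec -> \bar R) : (forall x g, F (vcomb 1 x g w) = F x) ->
  smooth w F = F.
Proof.
move=> h; apply: funext => x; rewrite /smooth.
under eq_integral do rewrite h.
by rewrite integral_cst// [X in (_ * X)%E]probability_setT mule1.
Qed.

Lemma nnmeas_fst (K : R * R -> \bar R) : measurable_fun setT K ->
  (forall x, 0 <= K x)%E -> nnmeas (fun x : vec => K x.1).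
Proof. by move=> mK K0; split => //; exact: (measurableT_comp mK). Qed.

Let root1 (x : R) : x * x = 1 -> 0 <= x -> x = 1.
Proof.
move=> x1 x0; apply/eqP; rewrite -sqrp_eq1//.
by rewrite expr2 x1.
Qed.

Lemma smooths_fst_fst vs (K : R -> \bar R) : measurable_fun setT K ->
  (forall x, 0 <= K x)%E ->
  smooths vs (fun x => K x.1.1) vzero =
  (\int[gauss]_g K (Num.sqrt (\sum_(v <- vs) v.1.1 ^+ 2) * g)%R)%E.
Proof.
move=> mK K0.
have [w1 [w2 [w3 [w4 [hF hG [p1 p2 p3 p4] [z2 z3] [z4 z4']]]]]] := smoothing_cholesky vs.
have nF : nnmeas (fun x : vec => K x.1.1).
  split => //; apply: (measurableT_comp mK); exact: measurableT_comp.
rewrite hF// (@smooth_cst w4); last first.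
  by move=> x g; rewrite /= z4 /= mulr0 addr0 mul1r.
rewrite (@smooth_cst w3); last by move=> x g; rewrite /= z3 /= mulr0 addr0 mul1r.
rewrite (@smooth_cst w2); last by move=> x g; rewrite /= z2 mulr0 addr0 mul1r.
have l11 : vlinear (fun v : vec => v.1.1) by [].
have e := hG _ _ l11 l11; rewrite /= z2 z3 z4 /= !mulr0 !addr0 in e.
have -> : Num.sqrt (\sum_(v <- vs) v.1.1 ^+ 2) = w1.1.1.
  under eq_bigr do rewrite expr2.
  by rewrite e -expr2 sqrtr_sqr ger0_norm.
by rewrite /smooth; apply: eq_integral => g _; rewrite /= mulr0 add0r mulrC.
Qed.

Lemma smooths_fst vs (K : R * R -> \bar R) : measurable_fun setT K ->
  (forall x, 0 <= K x)%E ->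
  \sum_(v <- vs) v.1.1 * v.1.1 = 1 -> \sum_(v <- vs) v.1.1 * v.1.2 = 0 ->
  \sum_(v <- vs) v.1.2 * v.1.2 = 1 ->
  smooths vs (fun x => K x.1) vzero = (\int[gauss2]_z K z)%E.
Proof.
move=> mK K0 s11 s12 s22.
have [w1 [w2 [w3 [w4 [hF hG [p1 p2 p3 p4] [z2 z3] [z4 z4']]]]]] := smoothing_cholesky vs.
rewrite hF; last exact: nnmeas_fst.
rewrite (@smooth_cst w4); last first.
  by move=> [[x1 x2] x'] g; rewrite /= z4 /= !mulr0 !addr0 !mul1r.
rewrite (@smooth_cst w3); last first.
  by move=> [[x1 x2] x'] g; rewrite /= z3 /= !mulr0 !addr0 !mul1r.
have l11 : vlinear (fun v : vec => v.1.1) by [].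
have l12 : vlinear (fun v : vec => v.1.2) by [].
have e11 := hG _ _ l11 l11; rewrite /= z2 z3 z4 /= !mulr0 !addr0 s11 in e11.
have w11 := root1 (esym e11) p1.
have e12 := hG _ _ l11 l12; rewrite /= z2 z3 z4 /= !(mulr0, mul0r) !addr0 s12 w11 mul1r in e12.
have e22 := hG _ _ l12 l12; rewrite /= z3 z4 -e12 /= !(mulr0, mul0r) !addr0 add0r s22 in e22.
have w22 := root1 (esym e22) p2.
rewrite (ge0_integral_gauss2 mK K0).
apply: eq_integral => g1 _; apply: eq_integral => g2 _.
rewrite /vcomb /= z2 w11 -e12 w22; congr (K (_, _)); ring.
Qed.

(** Pivoting yields only nonnegative diagonal entries. If [c] vanished, the determinant identity
    would equate [a^2 (b^2 + c^2)], at least 1/2 for small correlations, with [(a b)^2], at most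
    1/64. *)
Lemma cholesky_diag_gt0 (r11 r12 r21 r22 a b c : R) : 0 <= a -> 0 <= c ->
  a ^+ 2 = 1 - r11 ^+ 2 - r21 ^+ 2 -> a * b = - (r11 * r12 + r21 * r22) ->
  b ^+ 2 + c ^+ 2 = 1 - r12 ^+ 2 - r22 ^+ 2 ->
  `|r11| <= 32^-1 -> `|r12| <= 32^-1 -> `|r21| <= 32^-1 -> `|r22| <= 32^-1 ->
  0 < a /\ 0 < c.
Proof.
move=> p3 p4 ha hab hbc b11 b12 b21 b22.
have le4 (r : R) : `|r| <= 32^-1 -> `|r| <= 4^-1.
  by move=> /le_trans; apply; rewrite lef_pV2 ?posrE// ler_nat.
have sq (r : R) : `|r| <= 32^-1 -> r ^+ 2 <= 16^-1.
  move=> /le4 h; rewrite -real_normK ?num_real//.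
  have -> : 16^-1 = 4^-1 ^+ 2 :> R by rewrite exprVn -natrX.
  by rewrite lerXn2r ?nnegrE.
have ha8 : 7 / 8 <= a ^+ 2 by rewrite ha; move: (sq _ b11) (sq _ b21); lra.
have hbc8 : 7 / 8 <= b ^+ 2 + c ^+ 2.
  by rewrite hbc; move: (sq _ b12) (sq _ b22); lra.
have a_gt0 : 0 < a.
  rewrite lt_neqAle p3 andbT; apply/eqP => a0; move: ha8.
  by rewrite -a0 expr0n /=; lra.
have c_gt0 : 0 < c.
  rewrite lt_neqAle p4 andbT; apply/eqP => c00.
  have e : a ^+ 2 * (b ^+ 2 + c ^+ 2) = (a * b) ^+ 2.
    by rewrite -c00 expr0n /= addr0 exprMn.
  have h3 : 1 / 2 <= (a * b) ^+ 2.
    by rewrite -e; apply: le_trans (ler_pM _ _ ha8 hbc8); lra.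
  have h4 : `|a * b| <= 1 / 8.
    rewrite hab normrN; apply: (le_trans (ler_normD _ _)); rewrite !normrM.
    move: (ler_pM (normr_ge0 _) (normr_ge0 _) (le4 _ b11) (le4 _ b12)).
    by move: (ler_pM (normr_ge0 _) (normr_ge0 _) (le4 _ b21) (le4 _ b22)); lra.
  have h5 : (a * b) ^+ 2 <= (1 / 8) ^+ 2.
    by rewrite -[leLHS]real_normK ?num_real// lerXn2r ?nnegrE//; lra.
  have : (1 / 8 : R) ^+ 2 < 1 / 2 by rewrite expr2; lra.
  by move: h3 h5; lra.
by [].
Qed.

Definition inv_gauss_density (x : R) : R := Num.sqrt pi * expR (x ^+ 2).
Local Notation ig := inv_gauss_density.

Lemma gauss_densityK x : gauss_density x * ig x = 1.
Proof.
rewrite /gauss_density mulrACA mulVf ?mul1r ?sqrtr_eq0 -?ltNge ?pi_gt0//.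
by rewrite -expRD addNr expR0.
Qed.

Lemma inv_gauss_density_ge0 x : 0 <= ig x.
Proof. by rewrite mulr_ge0 ?expR_ge0. Qed.

Lemma measurable_gauss_density_comp d (T : measurableType d) (f : T -> R) :
  measurable_fun setT f -> measurable_fun setT (fun t => gauss_density (f t)).
Proof. by move=> mf; exact: (measurableT_comp measurable_gauss_density). Qed.

Lemma measurable_inv_gauss_density_comp d (T : measurableType d) (f : T -> R) :
  measurable_fun setT f -> measurable_fun setT (fun t => ig (f t)).
Proof.
move=> mf; apply: measurable_funM => //; apply: measurableT_comp => //.
exact: measurable_funX.
Qed.

(* The density at [y] of [(m1 + a g, m2 + b g + c h)], for independent Gaussian
   [g] and [h], with respect to [gauss2]. *)
Definition relative_density (a b c m1 m2 : R) (y : R * R) : R :=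
  gauss_density ((y.1 - m1) / a) / a *
  (gauss_density ((y.2 - (m2 + b * ((y.1 - m1) / a))) / c) / c) *
  (ig y.1 * ig y.2).

Lemma measurable_relative_density a b c m1 m2 :
  measurable_fun setT (relative_density a b c m1 m2).
Proof.
have m3 : measurable_fun setT (fun y : R * R => (y.1 - m1) / a).
  by apply: measurable_funM => //; exact: measurable_funB.
apply: measurable_funM; last first.
  by apply: measurable_funM; exact: measurable_inv_gauss_density_comp.
apply: measurable_funM; apply: measurable_funM => //;
  apply: measurable_gauss_density_comp => //.
apply: measurable_funM => //; apply: measurable_funB => //.
by apply: measurable_funD => //; exact: measurable_funM.
Qed.

Lemma relative_density_ge0 a b c m1 m2 y : 0 < a -> 0 < c ->
  0 <= relative_density a b c m1 m2 y.
Proof.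
move=> a0 c0; rewrite /relative_density.
have i0 := inv_gauss_density_ge0; have g0 := @gauss_density_ge0 R.
by rewrite mulr_ge0// mulr_ge0// divr_ge0// ltW.
Qed.

(** Two affine substitutions, [y1 = m1 + a g] and then [y2 = m2 + b g + c h] with [g] expressed by
    [y1]; multiplying by the inverse Gaussian densities turns Lebesgue measure back into
    [gauss2]. *)
Lemma ge0_integral_relative_density (a b c m1 m2 : R) (iA : R * R -> \bar R) :
  0 < a -> 0 < c -> measurable_fun setT iA -> (forall y, 0 <= iA y)%E ->
  (\int[gauss]_g \int[gauss]_h iA (m1 + a * g, m2 + b * g + c * h)%R =
   \int[gauss2]_y (iA y * (relative_density a b c m1 m2 y)%:E))%E.
Proof.
move=> a_gt0 c_gt0 mA A0.
have miA d (T : measurableType d) (f g : T -> R) : measurable_fun setT f ->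
    measurable_fun setT g -> measurable_fun setT (fun t => iA (f t, g t)).
  by move=> mf mg; apply: (measurableT_comp mA); exact: measurable_fun_pair.
pose q := relative_density a b c m1 m2.
have mq : measurable_fun setT q by exact: measurable_relative_density.
have q0 y : 0 <= q y by exact: relative_density_ge0.
pose nu (y1 : R) := m2 + b * ((y1 - m1) / a).
have mnu : measurable_fun setT nu.
  apply: measurable_funD => //; apply: measurable_funM => //.
  by apply: measurable_funM => //; exact: measurable_funB.
pose K y1 := (\int[gauss]_g iA (y1, (nu y1 + c * g)%R))%E.
have K0 y : (0 <= K y)%E by apply: integral_ge0 => g _; exact: A0.
have mK : measurable_fun setT K.
  apply: (@measurable_integral_gauss _ (fun u : R * R => iA (u.1, nu u.1 + c * u.2))).
    apply: miA => //; apply: measurable_funD; last exact: measurable_funM.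
    exact: (measurableT_comp mnu).
  by move=> u; exact: A0.
have mqA : measurable_fun setT (fun y => (iA y * (q y)%:E)%E).
  by apply: emeasurable_funM => //; exact/measurable_EFinP.
have qA0 y : (0 <= iA y * (q y)%:E)%E.
  by apply: mule_ge0; [exact: A0|rewrite lee_fin].
transitivity (\int[gauss]_g K (m1 + a * g)%R)%E.
  apply: eq_integral => g _; apply: eq_integral => h _; congr (iA (_, _)).
  by rewrite /nu; field; rewrite gt_eqF.
rewrite (ge0_integral_gauss_affine _ a_gt0 mK K0) (ge0_integral_gauss2 mqA qA0).
rewrite ge0_integral_gauss; last 2 first.
- exact: (measurable_integral_gauss mqA qA0).
- by move=> x; apply: integral_ge0.
apply: eq_integral => y1 _.
have miA1 : measurable_fun setT (fun y : R => iA (y1, y)) by exact: miA.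
rewrite /K (ge0_integral_gauss_affine _ c_gt0 miA1 (fun _ => A0 _)).
have mqA1 := measurable_slice y1 mqA.
rewrite (ge0_integral_gauss mqA1 (fun _ => qA0 _)).
have t1 : measurable_fun setT (fun y => iA (y1, y) * (gauss_density ((y - nu y1) / c) / c)%:E)%E.
  apply: emeasurable_funM => //; apply/measurable_EFinP.
  exact: measurable_gauss_density_affine.
have t2 : measurable_fun setT (fun y => iA (y1, y) * (q (y1, y))%:E * (gauss_density y)%:E)%E.
  apply: emeasurable_funM => //; apply/measurable_EFinP.
  exact: measurable_gauss_density.
have t10 y : setT y -> (0 <= iA (y1, y) * (gauss_density ((y - nu y1) / c) / c)%:E)%E.
  by move=> _; apply: mule_ge0; [exact: A0|rewrite lee_fin divr_ge0 ?gauss_density_ge0// ltW].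
have t20 y : setT y -> (0 <= iA (y1, y) * (q (y1, y))%:E * (gauss_density y)%:E)%E.
  by move=> _; apply: mule_ge0 => //; rewrite lee_fin gauss_density_ge0.
have ga : (0 <= (gauss_density ((y1 - m1) / a) / a)%:E :> \bar R)%E.
  by rewrite lee_fin divr_ge0 ?gauss_density_ge0// ltW.
have g1 : (0 <= (gauss_density y1)%:E :> \bar R)%E by rewrite lee_fin gauss_density_ge0.
rewrite -(ge0_integralZr mu measurableT t1 t10 ga) -(ge0_integralZr mu measurableT t2 t20 g1).
apply: eq_integral => y2 _; rewrite -!muleA; congr (_ * _)%E; rewrite -!EFinM; congr EFin.
rewrite /q /relative_density /= -/(nu y1) mulrC.
rewrite -[LHS]mulr1 -[X in _ * X = _]mulr1 -{1}(gauss_densityK y1) -(gauss_densityK y2); ring.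
Qed.

Section cholesky_integral.
Variables (r11 r12 r21 r22 a b c k : R).
Hypotheses (k0 : 0 <= k) (a_gt0 : 0 < a) (c_gt0 : 0 < c).
Hypothesis ha : a ^+ 2 = 1 - r11 ^+ 2 - r21 ^+ 2.
Hypothesis hab : a * b = - (r11 * r12 + r21 * r22).
Hypothesis hbc : b ^+ 2 + c ^+ 2 = 1 - r12 ^+ 2 - r22 ^+ 2.
Hypotheses (b11 : `|r11| <= 32^-1) (b12 : `|r12| <= 32^-1)
  (b21 : `|r21| <= 32^-1) (b22 : `|r22| <= 32^-1).
Let rho2 := r11 ^+ 2 + r12 ^+ 2 + r21 ^+ 2 + r22 ^+ 2.
Let A := strip k.
Let iA (z : R * R) : \bar R := (\1_A z)%:E.
Let ex (z : R * R) : R := expR ((z.1 ^+ 2 + z.2 ^+ 2) / 2).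
Let ga := fine (gauss2 A).
Let q (z : R * R) :=
  relative_density a b c (r11 * z.1 + r21 * z.2) (r12 * z.1 + r22 * z.2).
(** The conditional probability that the second pair lies in the cone, given that the first pair
    equals [z]. *)
Let H z : \bar R := (\int[gauss2]_y (iA y * (q z y)%:E))%E.

Let mA : measurable_fun setT iA.
Proof. by apply/measurable_EFinP/measurable_indic; exact: measurable_strip. Qed.

Let A0 z : (0 <= iA z)%E. Proof. by rewrite lee_fin. Qed.

Let mex : measurable_fun setT (fun z => (ex z)%:E).
Proof.
apply/measurable_EFinP; apply: measurableT_comp => //; apply: measurable_funM => //.
by apply: measurable_funD; apply: measurable_funX.
Qed.

Let ex0 z : (0 <= (ex z)%:E :> \bar R)%E. Proof. by rewrite lee_fin expR_ge0. Qed.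

Let rho0 : 0 <= rho2. Proof. by rewrite !addr_ge0 ?sqr_ge0. Qed.

Let Jle : (\int[gauss2]_z (iA z * (ex z)%:E) <= (4 * k)%:E)%E.
Proof. exact: integral_strip_expR. Qed.

Let gaE : gauss2 A = ga%:E.
Proof. by rewrite fineK// fin_num_measure//; exact: measurable_strip. Qed.

Let ga0 : 0 <= ga. Proof. by rewrite fine_ge0. Qed.

Let gA : (\int[gauss2]_z iA z = ga%:E)%E.
Proof.
by rewrite -gaE (integral_indic gauss2 measurableT (measurable_strip k)) setIT.
Qed.

Let iAe0 z : (0 <= iA z * (ex z)%:E)%E.
Proof. exact: mule_ge0 (A0 z) (ex0 z). Qed.

Let mex' : measurable_fun setT (fun z => iA z * (ex z)%:E)%E.
Proof. exact: emeasurable_funM. Qed.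

Let q0 z y : 0 <= q z y. Proof. exact: relative_density_ge0. Qed.

Let mAq z : measurable_fun setT (fun y => iA y * (q z y)%:E)%E.
Proof.
by apply: emeasurable_funM => //; apply/measurable_EFinP; exact: measurable_relative_density.
Qed.

Let Aq0 z y : (0 <= iA y * (q z y)%:E)%E.
Proof. by apply: mule_ge0; [exact: A0|rewrite lee_fin]. Qed.

Let mcA (r : R) : measurable_fun setT (fun y => r%:E * iA y)%E.
Proof. by apply: emeasurable_funM => //; exact: measurable_cst. Qed.

Let mce (r : R) : measurable_fun setT (fun y => r%:E * (iA y * (ex y)%:E))%E.
Proof. by apply: emeasurable_funM => //; exact: measurable_cst. Qed.

Let cA0 (r : R) z : 0 <= r -> (0 <= r%:E * iA z)%E.
Proof. by move=> r0; apply: mule_ge0; [rewrite lee_fin|exact: A0]. Qed.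

Let ce0 (r : R) z : 0 <= r -> (0 <= r%:E * (iA z * (ex z)%:E))%E.
Proof. by move=> r0; apply: mule_ge0; [rewrite lee_fin|exact: iAe0]. Qed.

(* Only the bound on [H z + H (- z)] is of second order in the correlations: the
   terms of first order cancel. *)
Let Hsum z : (H z + H (- z.1, - z.2)%R <=
   (2 * ga)%:E + (1600 * rho2 * k)%:E * (ex z)%:E)%E.
Proof.
rewrite /H -(ge0_integralD gauss2 measurableT (fun y _ => Aq0 z y) (mAq z)
  (fun y _ => Aq0 _ y) (mAq _)).
have c0 : 0 <= 400 * rho2 * ex z.
  exact: (mulr_ge0 (mulr_ge0 (ler0n R 400) rho0) (expR_ge0 _)).
apply: (@le_trans _ _ (\int[gauss2]_y (2%:E * iA y +
   (400 * rho2 * ex z)%:E * (iA y * (ex y)%:E)))%E).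
  apply: ge0_le_integral.
  - exact: measurableT.
  - by move=> y _; apply: adde_ge0; exact: Aq0.
  - by apply: emeasurable_funD; exact: mAq.
  - by apply: emeasurable_funD; [exact: mcA|exact: mce].
  move=> y _; rewrite -ge0_muleDr ?lee_fin// /iA.
  rewrite [2 * _]mulrC [_ * (\1_A y * _)]mulrCA -mulrDr.
  apply: ler_wpM2l => //.
  have := cond_density_sym_le a_gt0 c_gt0 ha hab hbc b11 b12 b21 b22 z.1 z.2 y.1 y.2.
  rewrite -/rho2 => h.
  have i0 : 0 <= ig y.1 * ig y.2 by rewrite mulr_ge0 ?inv_gauss_density_ge0.
  have := ler_wpM2r i0 h; rewrite mulrDl /q /relative_density /= => /le_trans; apply.
  rewrite le_eqVlt; apply/orP; left; apply/eqP; rewrite /ex.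
  transitivity ((gauss_density y.1 * ig y.1) * (gauss_density y.2 * ig y.2) *
    (2 + 400 * rho2 * expR ((z.1 ^+ 2 + z.2 ^+ 2) / 2) * expR ((y.1 ^+ 2 + y.2 ^+ 2) / 2))).
    by ring.
  by rewrite !gauss_densityK !mul1r.
rewrite (ge0_integralD gauss2 measurableT (fun y _ => cA0 y (ler0n _ 2)) (mcA _)
  (fun y _ => ce0 y c0) (mce _)).
rewrite (ge0_integralZl gauss2 measurableT mA (fun y _ => A0 y)) ?lee_fin//.
rewrite (ge0_integralZl gauss2 measurableT mex' (fun y _ => iAe0 y)) ?lee_fin//.
rewrite gA -EFinM leeD2l//.
have c0' : (0 <= (400 * rho2 * ex z)%:E :> \bar R)%E by rewrite lee_fin.
apply: (le_trans (lee_wpmul2l c0' Jle)).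
by rewrite -!EFinM lee_fin le_eqVlt; apply/orP; left; apply/eqP; ring.
Qed.

(** The cone and [gauss2] are invariant under [z -> - z], so twice the integral is that of
    [H z + H (- z)] over the cone. The weight [ex] left by [Hsum] is integrated by
    [integral_strip_expR] once more, hence the second factor [k]. *)
Lemma integral_strip_le : measurable_fun setT H ->
  (\int[gauss2]_z (iA z * H z) <= (ga * ga + 3200 * rho2 * k ^+ 2)%:E)%E.
Proof.
move=> mH.
have H0 z : (0 <= H z)%E by apply: integral_ge0 => y _; exact: Aq0.
have iAN z : iA (- z.1, - z.2) = iA z.
  by rewrite /iA !indicE; congr ((nat_of_bool _)%:R%:E); apply/idP/idP;
    rewrite !inE /A /strip /= !normrN.
have mAH : measurable_fun setT (fun z => iA z * H z)%E := emeasurable_funM mA mH.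
have AH0 z : (0 <= iA z * H z)%E := mule_ge0 (A0 z) (H0 z).
have AHN0 z : (0 <= iA z * H (- z.1, - z.2)%R)%E := mule_ge0 (A0 z) (H0 _).
have mN : measurable_fun setT (fun z : R * R => (- z.1, - z.2)).
  by apply: measurable_fun_pair; exact: measurableT_comp.
have mAHN : measurable_fun setT (fun z => iA z * H (- z.1, - z.2)%R)%E.
  by apply: emeasurable_funM; [exact: mA|exact: (measurableT_comp mH mN)].
have sym : (\int[gauss2]_z (iA z * H z) = \int[gauss2]_z (iA z * H (- z.1, - z.2)%R))%E.
  transitivity (\int[gauss2]_z (iA (- z.1, - z.2)%R * H (- z.1, - z.2)%R))%E.
    exact: (esym (ge0_integral_gauss2N mAH AH0)).
  by apply: eq_integral => z _; rewrite iAN.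
have k1 : 0 <= 1600 * rho2 * k := mulr_ge0 (mulr_ge0 (ler0n R 1600) rho0) k0.
have dbl : (\int[gauss2]_z (iA z * H z) + \int[gauss2]_z (iA z * H z) <=
   (2 * (ga * ga + 3200 * rho2 * k ^+ 2))%:E)%E.
  rewrite {2}sym.
  rewrite -(ge0_integralD gauss2 measurableT (fun y _ => AH0 y) mAH (fun y _ => AHN0 y) mAHN).
  apply: (@le_trans _ _ (\int[gauss2]_z ((2 * ga)%:E * iA z +
     (1600 * rho2 * k)%:E * (iA z * (ex z)%:E)))%E).
    apply: ge0_le_integral.
    - exact: measurableT.
    - by move=> z _; exact: adde_ge0.
    - exact: (emeasurable_funD mAH mAHN).
    - by apply: emeasurable_funD; [exact: mcA|exact: mce].
    move=> z _; rewrite -(ge0_muleDr _ (H0 z) (H0 _)).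
    apply: (le_trans (lee_wpmul2l (A0 z) (Hsum z))).
    rewrite /iA lee_fin le_eqVlt; apply/orP; left; apply/eqP; ring.
  have g2 : 0 <= 2 * ga by rewrite mulr_ge0.
  rewrite (ge0_integralD gauss2 measurableT (fun y _ => cA0 y g2) (mcA _)
    (fun y _ => ce0 y k1) (mce _)).
  have g2' : (0 <= (2 * ga)%:E :> \bar R)%E by rewrite lee_fin.
  have k1' : (0 <= (1600 * rho2 * k)%:E :> \bar R)%E by rewrite lee_fin.
  rewrite (ge0_integralZl gauss2 measurableT mA (fun y _ => A0 y) g2').
  rewrite (ge0_integralZl gauss2 measurableT mex' (fun y _ => iAe0 y) k1').
  rewrite gA; apply: (le_trans (leeD2l _ (lee_wpmul2l k1' Jle))).
  by rewrite -!EFinM -EFinD lee_fin le_eqVlt; apply/orP; left; apply/eqP; ring.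
move: dbl; move: (integral _ _ _) (ga * ga + _) => [r| |] K.
- rewrite -EFinD !lee_fin => h; rewrite -(ler_pM2l (ltr0Sn R 1)).
  by rewrite mulr_natl mulr2n.
- by rewrite leye_eq.
- by move=> _; exact: leNye.
Qed.

End cholesky_integral.

(** In triangular form the first pair involves only the first two Gaussian variables, and the last
    two variables move only the second pair: smoothing along [w3] and [w4] conditions on the first
    pair. *)
Lemma smooths_strips vs (r11 r12 r21 r22 k : R) : 0 <= k ->
  \sum_(v <- vs) v.1.1 * v.1.1 = 1 -> \sum_(v <- vs) v.1.1 * v.1.2 = 0 ->
  \sum_(v <- vs) v.1.2 * v.1.2 = 1 ->
  \sum_(v <- vs) v.2.1 * v.2.1 = 1 -> \sum_(v <- vs) v.2.1 * v.2.2 = 0 ->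
  \sum_(v <- vs) v.2.2 * v.2.2 = 1 ->
  \sum_(v <- vs) v.1.1 * v.2.1 = r11 -> \sum_(v <- vs) v.1.1 * v.2.2 = r12 ->
  \sum_(v <- vs) v.1.2 * v.2.1 = r21 -> \sum_(v <- vs) v.1.2 * v.2.2 = r22 ->
  `|r11| <= 32^-1 -> `|r12| <= 32^-1 -> `|r21| <= 32^-1 -> `|r22| <= 32^-1 ->
  (smooths vs (fun x => (\1_(strip k) x.1)%:E * (\1_(strip k) x.2)%:E) vzero <=
   gauss2 (strip k) * gauss2 (strip k) +
   (3200 * (r11 ^+ 2 + r12 ^+ 2 + r21 ^+ 2 + r22 ^+ 2) * k ^+ 2)%:E)%E.
Proof.
move=> k0 s11 s12 s22 t11 t12 t22 h11 h12 h21 h22 b11 b12 b21 b22.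
have mS := @measurable_strip R k.
set A := strip k in mS *.
have mA : measurable_fun setT (fun z : R * R => (\1_A z)%:E : \bar R).
  by apply/measurable_EFinP; exact: measurable_indic.
have A0 z : (0 <= (\1_A z)%:E :> \bar R)%E by rewrite lee_fin.
have nF : nnmeas (fun x : vec => ((\1_A x.1)%:E * (\1_A x.2)%:E)%E).
  split; last by move=> x; rewrite mule_ge0.
  by apply: emeasurable_funM; exact: (measurableT_comp mA).
have [w1 [w2 [w3 [w4 [hF hG [p1 p2 p3 p4] [z2 z3] [z4 z4']]]]]] := smoothing_cholesky vs.
have l11 : vlinear (fun v : vec => v.1.1) by [].
have l12 : vlinear (fun v : vec => v.1.2) by [].
have l21 : vlinear (fun v : vec => v.2.1) by [].
have l22 : vlinear (fun v : vec => v.2.2) by [].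
(* Reading the Gram identities row by row identifies the triangular matrix: [w1 = (1, 0, r11, r12)],
   [w2 = (0, 1, r21, r22)], [w3 = (0, 0, a, b)] and [w4 = (0, 0, 0, c)]. *)
have e11 := hG _ _ l11 l11; rewrite /= z2 z3 z4 /= !mulr0 !addr0 s11 in e11.
have w11 := root1 (esym e11) p1.
have e12 := hG _ _ l11 l12; rewrite /= z2 z3 z4 /= !(mulr0, mul0r) !addr0 s12 w11 mul1r in e12.
have e22 := hG _ _ l12 l12; rewrite /= z3 z4 -e12 /= !(mulr0, mul0r) !addr0 add0r s22 in e22.
have w22 := root1 (esym e22) p2.
have f11 := hG _ _ l11 l21; rewrite /= z2 z3 z4 w11 /= !(mulr0, mul0r) !addr0 mul1r h11 in f11.
have f12 := hG _ _ l11 l22; rewrite /= z2 z3 z4 w11 /= !(mulr0, mul0r) !addr0 mul1r h12 in f12.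
have f21 := hG _ _ l12 l21; rewrite /= z3 z4 w22 -e12 /= !(mulr0, mul0r) !addr0 add0r mul1r
  h21 in f21.
have f22 := hG _ _ l12 l22; rewrite /= z3 z4 w22 -e12 /= !(mulr0, mul0r) !addr0 add0r mul1r
  h22 in f22.
have g11 := hG _ _ l21 l21; rewrite /= -f11 -f21 z4' /= !(mulr0, mul0r) !addr0 t11 in g11.
have g12 := hG _ _ l21 l22; rewrite /= -f11 -f21 -f12 -f22 z4' /= !(mulr0, mul0r) !addr0 t12 in g12.
have g22 := hG _ _ l22 l22; rewrite /= -f12 -f22 /= t22 in g22.
set a := w3.2.1 in p3 g11 g12; set b := w3.2.2 in g12 g22; set c := w4.2.2 in p4 g22.
have ha : a ^+ 2 = 1 - r11 ^+ 2 - r21 ^+ 2 by rewrite {1}g11; ring.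
have hab : a * b = - (r11 * r12 + r21 * r22).
  by apply/eqP; rewrite -subr_eq0 opprK {1}g12; apply/eqP; ring.
have hbc : b ^+ 2 + c ^+ 2 = 1 - r12 ^+ 2 - r22 ^+ 2 by rewrite {1}g22; ring.
have [a_gt0 c_gt0] := cholesky_diag_gt0 p3 p4 ha hab hbc b11 b12 b21 b22.
pose iA (z : R * R) : \bar R := (\1_A z)%:E.
pose S2 := smooth w3 (smooth w4 (fun x : vec => iA x.2)).
have nS2 : nnmeas S2.
  apply: nnmeas_smooth; apply: nnmeas_smooth; split; last by move=> x; exact: A0.
  by apply: (measurableT_comp mA).
pose V (z : R * R) : vec := vcomb 1 (vcomb 1 vzero z.1 w1) z.2 w2.
have mV : measurable_fun setT V.
  apply: measurable_vcomb => //; exact: measurable_vcomb.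
pose H z := S2 (V z).
have mH : measurable_fun setT H by exact: (measurableT_comp nS2.1).
have H0 z : (0 <= H z)%E by exact: nS2.2.
have V1 z : (V z).1 = z.
  by rewrite /V /vcomb /= z2 w11 -e12 w22; case: z => x y /=; congr (_, _); ring.
have V21 z : (V z).2.1 = r11 * z.1 + r21 * z.2.
  by rewrite /V /vcomb /= -f11 -f21; ring.
have V22 z : (V z).2.2 = r12 * z.1 + r22 * z.2.
  by rewrite /V /vcomb /= -f12 -f22; ring.
have claim1 : smooths vs (fun x => (\1_A x.1)%:E * (\1_A x.2)%:E)%E vzero =
    (\int[gauss2]_z (iA z * H z))%E.
  rewrite (hF _ nF) ge0_integral_gauss2; last 2 first.
  - exact: emeasurable_funM.
  - by move=> z; exact: mule_ge0 (A0 z) (H0 z).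
  apply: eq_integral => g1 _; apply: eq_integral => g2 _.
  have t x : smooth w4 (fun x => (\1_A x.1)%:E * (\1_A x.2)%:E)%E x =
      (iA x.1 * smooth w4 (fun x : vec => iA x.2) x)%E.
    rewrite /smooth -ge0_integralZl//.
    - apply: eq_integral => g _; congr (_ * _)%E; rewrite /iA.
      have -> // : (vcomb 1 x g w4).1 = x.1.
      by case: x => [[x1 x2] x']; rewrite /vcomb /= z4 /= !mulr0 !addr0 !mul1r.
    - by apply: (measurableT_comp mA); apply: (measurableT_comp measurable_snd);
        exact: measurable_vcomb.
    - by move=> g _; exact: A0.
    - exact: A0.
  rewrite (_ : smooth w4 _ = fun x => (iA x.1 * smooth w4 (fun x : vec => iA x.2) x)%E); last first.
    by apply: funext.
  rewrite -{1}[(g1, g2)]V1 /H /S2 -/(V (g1, g2)).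
  set x := V (g1, g2).
  have n4 : nnmeas (smooth w4 (fun x : vec => iA x.2)).
    apply: nnmeas_smooth; split; last by move=> y; exact: A0.
    by apply: (measurableT_comp mA).
  rewrite [LHS]/smooth [X in (_ = _ * X)%E]/smooth -ge0_integralZl//.
  - apply: eq_integral => g _; congr (iA _ * _)%E.
    by case: x => [[x1 x2] x']; rewrite /vcomb /= z3 /= !mulr0 !addr0 !mul1r.
  - by apply: (measurableT_comp n4.1); exact: measurable_vcomb.
  - by move=> g _; exact: n4.2.
  - exact: A0.
have HE z : H z = (\int[gauss2]_y (iA y *
    (relative_density a b c (r11 * z.1 + r21 * z.2) (r12 * z.1 + r22 * z.2) y)%:E))%E.
  rewrite -(ge0_integral_relative_density _ _ _ a_gt0 c_gt0 mA A0) /H.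
  move: (V21 z) (V22 z); move: (V z) => v <- <-.
  rewrite /S2 {1}/smooth; apply: eq_integral => g _; rewrite /smooth.
  apply: eq_integral => h _.
  rewrite /vcomb /= z4' -/a -/b -/c; congr (iA (_, _)); ring.
move: mH; rewrite claim1 (funext HE) => mH.
have -> : gauss2 A = (fine (gauss2 A))%:E by rewrite fineK// fin_num_measure.
rewrite -EFinM -EFinD.
exact: (integral_strip_le k0 a_gt0 c_gt0 ha hab hbc b11 b12 b21 b22 mH).
Qed.

End gaussian_vectors.

(** * Linear forms in independent Gaussian pairs *)

Section linear_forms.
Context {R : realType} d (T : measurableType d) (P : probability T R).
Context {I : choiceType} (A : set I) (X : I -> T -> R * R) (s : seq I).
Hypothesis mX : forall i, A i -> measurable_fun setT (X i).
Hypothesis indepX : mutually_independent P A X.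
Hypothesis lawX : forall i, A i -> forall B, measurable B ->
  P (X i @^-1` B) = gauss2 B.
Hypotheses (us : uniq s) (sA : {in s, forall i, A i}).
Local Notation vec := (R * R * (R * R))%type.
Implicit Types c : I -> R * R.

Definition lform c (w : T) : R :=
  \sum_(i <- s) ((X i w).1 * (c i).1 + (X i w).2 * (c i).2).

(** Twice the covariance of the two forms, since every coordinate of [X i] has variance 1/2; a form
    with [lform_dot c c = 1] thus has the law [gauss]. *)
Definition lform_dot c c' : R :=
  \sum_(i <- s) ((c i).1 * (c' i).1 + (c i).2 * (c' i).2).

Lemma gaussian_sum_coord p q (l : vec -> R) w : vlinear l -> l vzero = 0 ->
  l (gaussian_sum X p q s w) = lform (fun i => (l (p i), l (q i))) w.
Proof.
move=> ll l0; rewrite /lform; elim: s => [|i s' IH] /=; first by rewrite big_nil.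
by rewrite !ll !mul1r IH big_cons /=; ring.
Qed.

Let vec4 c1 c2 c3 c4 (b : bool) (i : I) : vec :=
  if b then (((c1 i).1, (c2 i).1), ((c3 i).1, (c4 i).1))
  else (((c1 i).2, (c2 i).2), ((c3 i).2, (c4 i).2)).

(** Four forms make up one Gaussian vector: the [i]-th pair contributes its two coordinates times
    the two vectors of [i]-th coefficients. The Gram sums of these vectors are the [lform_dot] of
    the forms, by [gram] below. *)
Let law4 c1 c2 c3 c4 (F : vec -> \bar R) : nnmeas F ->
  (\int[P]_w F ((lform c1 w, lform c2 w), (lform c3 w, lform c4 w)) =
   smooths (sum_vectors (vec4 c1 c2 c3 c4 true) (vec4 c1 c2 c3 c4 false) s) F vzero)%E.
Proof.
move=> nF; rewrite -(integral_gaussian_sum (P := P) (A := A) (X := X))//.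
apply: eq_integral => w _; congr F.
set v := gaussian_sum _ _ _ _ _.
have e (l : vec -> R) : vlinear l -> l vzero = 0 -> l v = _ := @gaussian_sum_coord _ _ l w.
rewrite [RHS](_ : v = ((v.1.1, v.1.2), (v.2.1, v.2.2))); last by case: (v) => [[? ?] [? ?]].
rewrite (e (fun v => v.1.1))// (e (fun v => v.1.2))// (e (fun v => v.2.1))//.
rewrite (e (fun v => v.2.2))//.
Qed.

Let gram c1 c2 c3 c4 (f g : vec -> R) (cf cg : I -> R * R) :
  (forall i, f (vec4 c1 c2 c3 c4 true i) = (cf i).1) ->
  (forall i, f (vec4 c1 c2 c3 c4 false i) = (cf i).2) ->
  (forall i, g (vec4 c1 c2 c3 c4 true i) = (cg i).1) ->
  (forall i, g (vec4 c1 c2 c3 c4 false i) = (cg i).2) ->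
  \sum_(v <- sum_vectors (vec4 c1 c2 c3 c4 true) (vec4 c1 c2 c3 c4 false) s) f v * g v =
  lform_dot cf cg.
Proof.
move=> f1 f2 g1 g2; rewrite big_sum_vectors; apply: eq_bigr => i _.
by rewrite f1 f2 g1 g2.
Qed.

Lemma measurable_lform c : measurable_fun setT (lform c).
Proof.
rewrite /lform.
have : {in s, forall i, A i} by [].
elim: s => [_|i s' IH sA'].
  by under eq_fun do rewrite big_nil; exact: measurable_cst.
under eq_fun do rewrite big_cons.
have mXi : measurable_fun setT (X i) by apply/mX/sA'; rewrite mem_head.
apply: measurable_funD; last by apply: IH => j js; apply: sA'; rewrite inE js orbT.
by apply: measurable_funD; apply: measurable_funM => //; exact: measurableT_comp.
Qed.

Lemma integral_lform c (K : R -> \bar R) : measurable_fun setT K ->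
  (forall x, 0 <= K x)%E ->
  (\int[P]_w K (lform c w) = \int[gauss]_g K (Num.sqrt (lform_dot c c) * g)%R)%E.
Proof.
move=> mK K0.
have nF : nnmeas (fun x : vec => K x.1.1).
  split => //; apply: (measurableT_comp mK); exact: measurableT_comp.
rewrite (law4 c c c c nF) (smooths_fst_fst _ mK K0).
by under eq_bigr do rewrite expr2; rewrite (@gram c c c c (fun v => v.1.1) (fun v => v.1.1) c c).
Qed.

Lemma probability_lform2 c1 c2 (B : set (R * R)) : measurable B ->
  lform_dot c1 c1 = 1 -> lform_dot c1 c2 = 0 -> lform_dot c2 c2 = 1 ->
  P [set w | B (lform c1 w, lform c2 w)] = gauss2 B.
Proof.
move=> mB h11 h12 h22.
have mK : measurable_fun setT (fun z : R * R => (\1_B z)%:E : \bar R).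
  by apply/measurable_EFinP; exact: measurable_indic.
have K0 z : (0 <= (\1_B z)%:E :> \bar R)%E by rewrite lee_fin.
have m12 : measurable_fun setT (fun w => (lform c1 w, lform c2 w)).
  by apply: measurable_fun_pair; exact: measurable_lform.
have mE : measurable [set w | B (lform c1 w, lform c2 w)].
  by rewrite -[X in measurable X]setTI; exact: m12.
have := law4 c1 c2 c1 c2 (nnmeas_fst mK K0).
rewrite (smooths_fst mK K0); last 3 first.
- by rewrite (@gram _ _ _ _ _ _ c1 c1).
- by rewrite (@gram _ _ _ _ _ _ c1 c2).
- by rewrite (@gram _ _ _ _ _ _ c2 c2).
rewrite (integral_indic gauss2 measurableT mB) setIT => <-.
rewrite -[in LHS](setIT [set w | _]) -(integral_indic P measurableT mE).
apply: eq_integral => w _; rewrite /= !indicE; congr ((nat_of_bool _)%:R%:E).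
Qed.

Lemma probability_strips (c1 c2 c3 c4 : I -> R * R) (k : R) : 0 <= k ->
  lform_dot c1 c1 = 1 -> lform_dot c1 c2 = 0 -> lform_dot c2 c2 = 1 ->
  lform_dot c3 c3 = 1 -> lform_dot c3 c4 = 0 -> lform_dot c4 c4 = 1 ->
  `|lform_dot c1 c3| <= 32^-1 -> `|lform_dot c1 c4| <= 32^-1 ->
  `|lform_dot c2 c3| <= 32^-1 -> `|lform_dot c2 c4| <= 32^-1 ->
  (P ([set w | strip k (lform c1 w, lform c2 w)] `&`
      [set w | strip k (lform c3 w, lform c4 w)]) <=
   gauss2 (strip k) * gauss2 (strip k) +
   (3200 * (lform_dot c1 c3 ^+ 2 + lform_dot c1 c4 ^+ 2 + lform_dot c2 c3 ^+ 2 +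
     lform_dot c2 c4 ^+ 2) * k ^+ 2)%:E)%E.
Proof.
move=> k0 h11 h12 h22 h33 h34 h44 b13 b14 b23 b24.
have mS := @measurable_strip R k.
have mA : measurable_fun setT (fun z : R * R => (\1_(strip k) z)%:E : \bar R).
  by apply/measurable_EFinP; exact: measurable_indic.
have nF : nnmeas (fun x : vec => ((\1_(strip k) x.1)%:E * (\1_(strip k) x.2)%:E)%E : \bar R).
  split; last by move=> x; rewrite mule_ge0 ?lee_fin.
  by apply: emeasurable_funM; exact: (measurableT_comp mA).
have mE c c' : measurable [set w | strip k (lform c w, lform c' w)].
  have m12 : measurable_fun setT (fun w => (lform c w, lform c' w)).
    by apply: measurable_fun_pair; exact: measurable_lform.
  by rewrite -[X in measurable X]setTI; exact: m12.
have := @smooths_strips R (sum_vectors (vec4 c1 c2 c3 c4 true) (vec4 c1 c2 c3 c4 false) s)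
  (lform_dot c1 c3) (lform_dot c1 c4) (lform_dot c2 c3) (lform_dot c2 c4) k k0.
rewrite (@gram _ _ _ _ _ _ c1 c1)// (@gram _ _ _ _ _ _ c1 c2)// (@gram _ _ _ _ _ _ c2 c2)//.
rewrite (@gram _ _ _ _ _ _ c3 c3)// (@gram _ _ _ _ _ _ c3 c4)// (@gram _ _ _ _ _ _ c4 c4)//.
rewrite (@gram _ _ _ _ _ _ c1 c3)// (@gram _ _ _ _ _ _ c1 c4)//.
rewrite (@gram _ _ _ _ _ _ c2 c3)// (@gram _ _ _ _ _ _ c2 c4)//.
move=> /(_ h11 h12 h22 h33 h34 h44 erefl erefl erefl erefl b13 b14 b23 b24).
apply: le_trans; rewrite -(law4 c1 c2 c3 c4 nF).
set E1 := [set w | strip k (lform c1 w, _)]; set E2 := [set w | strip k (lform c3 w, _)].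
have mE12 : measurable (E1 `&` E2) by apply: measurableI; exact: mE.
rewrite -[in leLHS](setIT (E1 `&` E2)) -(integral_indic P measurableT mE12).
rewrite le_eqVlt; apply/orP; left; apply/eqP; apply: eq_integral => w _ /=.
rewrite -EFinM indicI /=; congr EFin; congr (_ * _); rewrite !indicE;
  by congr ((nat_of_bool _)%:R); apply/idP/idP => /set_mem h; exact: mem_set.
Qed.

End linear_forms.

(** * Sign changes and zeros *)

Section sign_changes.
Context {R : realType}.
Implicit Types (f df : R -> R) (a b t x y : R).

Lemma is_derive_mvt f df a b : (forall x, is_derive x 1 f (df x)) -> a < b ->
  exists2 c, a < c < b & f b - f a = df c * (b - a).
Proof.
move=> hf ab.
have hc : {within `[a, b], continuous f}.
  by apply: derivable_within_continuous => x _; exact: ex_derive.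
have [c cab e] := MVT ab (fun x _ => hf x) hc.
by exists c => //; rewrite in_itv/= in cab.
Qed.

(** Whatever the sign of [f t], one of [c1] and [c2] carries a value on the other side of 0, so that
    [|f t|] is at most an increment of [f] on the interval. *)
Lemma norm_le_oscillation f df M a b t c1 c2 :
  (forall x, is_derive x 1 f (df x)) -> (forall x, a <= x <= b -> `|df x| <= M) ->
  a <= t <= b -> a <= c1 <= b -> a <= c2 <= b -> f c1 <= 0 -> 0 <= f c2 ->
  `|f t| <= (b - a) * M.
Proof.
move=> hf hM tab c1ab c2ab f1 f2.
have step x y : a <= x <= b -> a <= y <= b -> `|f x - f y| <= (b - a) * M.
  wlog xy : x y / y < x.
    move=> h; have [xy|xy|->] := ltgtP x y.
    - by move=> ? ?; rewrite distrC; exact: h.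
    - exact: h.
    - move=> /andP[ax xb] _; rewrite subrr normr0 mulr_ge0//.
        by rewrite subr_ge0 (le_trans ax).
      by apply: le_trans (hM a _); rewrite ?lexx/= ?(le_trans ax).
  move=> /andP[ax xb] /andP[ay yb].
  have [c /andP[yc cx] ->] := is_derive_mvt hf xy.
  have hc : a <= c <= b by rewrite (le_trans ay (ltW yc)) (le_trans (ltW cx) xb).
  rewrite normrM mulrC; apply: ler_pM => //; last exact: hM.
  by rewrite gtr0_norm ?subr_gt0//; lra.
have [ft|ft] := leP 0 (f t).
  rewrite ger0_norm//; have := step t c1 tab c1ab.
  by move=> /(le_trans (ler_norm _)); lra.
rewrite ltr0_norm//; have := step c2 t c2ab tab.
by move=> /(le_trans (ler_norm _)); lra.
Qed.

(** Zero counts as positive. The sign is thus a boolean, and the number of changes along a grid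
    cannot drop under refinement, even if [f] vanishes at a grid point. *)
Definition sign_change f x y : bool := (f x < 0) != (f y < 0).

Definition alternates f x y := (x < y) && sign_change f x y.

Lemma derive_sign f df x y : (forall x, is_derive x 1 f (df x)) -> x < y ->
  (f x < 0) != (f y < 0) -> exists2 c, x < c < y & (df c < 0) = (f y < 0).
Proof.
move=> hf xy sxy; have [c cxy e] := is_derive_mvt hf xy; exists c => //.
have xy0 : 0 < y - x by rewrite subr_gt0.
have -> : (df c < 0) = (f y - f x < 0) by rewrite e pmulr_llt0.
rewrite subr_lt0; move: sxy.
have [fx|fx] := ltP (f x) 0; have [fy|fy] := ltP (f y) 0 => // _.
  by apply/negbTE; rewrite -leNgt (le_trans (ltW fx) fy).
exact: lt_le_trans fy fx.
Qed.

(** The mean value theorem between consecutive points, where the derivative takes the sign of the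
    value at the right end. The position and the sign of the first new point are part of the
    conclusion so that the induction can prepend a point. *)
Lemma alternates_deriv f df x x1 xs a b : (forall x, is_derive x 1 f (df x)) ->
  path (alternates f) x (x1 :: xs) -> all (fun z => a <= z <= b) [:: x, x1 & xs] ->
  exists y ys, [/\ size ys = size xs, path (alternates df) y ys,
    all (fun z => a <= z <= b) (y :: ys), x < y < x1 & (df y < 0) = (f x1 < 0)].
Proof.
move=> hf; elim: xs x x1 => [|x2 xs IH] x x1 /= /andP[/andP[xx1 sxx1] pxs].
  have [y /andP[xy yx1] dy] := derive_sign hf xx1 sxx1.
  move=> /and3P[/andP[ax xb] /andP[ax1 x1b] _].
  exists y, [::]; split => //=; last by rewrite xy yx1.
  by rewrite andbT (le_trans ax (ltW xy)) (le_trans (ltW yx1) x1b).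
have [y /andP[xy yx1] dy] := derive_sign hf xx1 sxx1.
move=> /and4P[/andP[ax xb] hx1 hx2 hxs].
have [||y' [ys [sys pys ays /andP[x1y' y'x2] dy']]] := IH x1 x2.
- exact: pxs.
- by rewrite /= hx1 hx2 hxs.
move: pxs => /= /andP[/andP[_ sx12] _].
exists y, (y' :: ys); split.
- by rewrite /= sys.
- by rewrite /= pys andbT /alternates (lt_trans yx1 x1y') /= /sign_change dy dy'.
- rewrite /= -/(all _ (y' :: ys)) ays andbT (le_trans ax (ltW xy)) /=.
  by case/andP: hx1 => _; apply: le_trans; exact: ltW.
- by rewrite xy yx1.
- exact: dy.
Qed.

(** The derivative alternates one time less, so by induction it is at most [(b - a)^(k - 1) M]; as
    [f] itself changes sign, it is bounded by its oscillation, which costs one more factor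
    [b - a]. *)
Lemma alternates_bound (f : nat -> R -> R) k x xs a b M t :
  (forall j x, is_derive x 1 (f j) (f j.+1 x)) ->
  (forall x, a <= x <= b -> `|f k x| <= M) -> size xs = k ->
  path (alternates (f 0%N)) x xs -> all (fun z => a <= z <= b) (x :: xs) ->
  a <= t <= b -> `|f 0%N t| <= (b - a) ^+ k * M.
Proof.
elim: k f x xs t => [|k IH] f x xs t hf hM.
  by move=> _ _ _ tab; rewrite expr0 mul1r; exact: hM.
case: xs => // x1 xs [sxs] pxs axs tab.
have [y [ys [sys pys ays _ _]]] := alternates_deriv (hf 0%N) pxs axs.
have h1 u : a <= u <= b -> `|f 1%N u| <= (b - a) ^+ k * M.
  by apply: (IH (fun j => f j.+1) y ys u) => //; rewrite sys.
move: pxs axs => /= /andP[/andP[_ sx] _] /and3P[xab x1ab _].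
rewrite exprS -mulrA; move: sx; rewrite /sign_change.
have [f0|f0] := ltP (f 0%N x) 0; have [f1|f1] := ltP (f 0%N x1) 0 => // _.
  exact: (@norm_le_oscillation (f 0%N) (f 1%N) _ a b t x x1 (hf 0%N) h1 tab xab x1ab (ltW f0) f1).
exact: (@norm_le_oscillation (f 0%N) (f 1%N) _ a b t x1 x (hf 0%N) h1 tab x1ab xab (ltW f1) f0).
Qed.

(** A new grid point is appended exactly when the sign changes. The last selected point may lie
    before [g c], but it has the sign of [f (g c)], which is what the next step compares with. *)
Lemma alternates_grid f (g : nat -> R) c : (forall i, g i < g i.+1) ->
  exists x xs, [/\ path (alternates f) x xs,
    size xs = (\sum_(i < c) sign_change f (g i) (g i.+1))%N,
    all (fun z => g 0%N <= z <= g c) (x :: xs) &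
    (f (last x xs) < 0) = (f (g c) < 0)].
Proof.
move=> gS; elim: c => [|c [x [xs [pxs sxs axs lxs]]]].
  by exists (g 0%N), [::]; rewrite big_ord0 /= lexx.
have axs' : all (fun z => g 0%N <= z <= g c.+1) (x :: xs).
  apply: sub_all axs => z /andP[-> zc] /=; exact: le_trans zc (ltW (gS c)).
have [e|ne] := eqVneq (f (g c) < 0) (f (g c.+1) < 0).
  exists x, xs; split => //; last by rewrite lxs.
  by rewrite big_ord_recr /= /sign_change e eqxx addn0.
have lc : last x xs <= g c.
  by have /allP/(_ (last x xs) (mem_last _ _))/andP[] := axs.
have g0c : g 0%N <= g c.+1.
  by case/andP: axs' => /andP[h1 h2] _; exact: le_trans h1 h2.
exists x, (rcons xs (g c.+1)); split.
- rewrite rcons_path pxs /alternates /sign_change lxs ne andbT /=; exact: le_lt_trans lc (gS c).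
- by rewrite size_rcons big_ord_recr /= /sign_change ne addn1 sxs.
- by rewrite -rcons_cons all_rcons axs' andbT lexx andbT.
- by rewrite last_rcons.
Qed.

End sign_changes.

(** * Cells whose zeros are counted exactly by the sign change *)

Section zeros_on_grid.
Context {R : realType}.
Variables (f f1 f2 : R -> R) (M e : R).
Hypotheses (hf : forall x : R, is_derive x 1 f (f1 x)).
Hypotheses (hf1 : forall x : R, is_derive x 1 f1 (f2 x)).
Hypotheses (hM : forall x : R, `|f2 x| <= M) (e0 : 0 < e).
Implicit Types (x y z t : R).

(** Two integrations: [f1] takes both signs, hence is at most [e M], and [f] has a zero, hence is at
    most [e (e M)]. *)
Lemma turning_cell x z c1 c2 : x <= z <= x + e -> x <= c1 <= x + e ->
  x <= c2 <= x + e -> f z = 0 -> f1 c1 <= 0 -> 0 <= f1 c2 ->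
  `|f x| <= M * e ^+ 2 /\ `|f (x + e)| <= M * e ^+ 2.
Proof.
move=> hz h1 h2 fz p1 p2.
have hb t : x <= t <= x + e -> `|f1 t| <= e * M.
  move=> ht; have := norm_le_oscillation hf1 (fun y _ => hM y) ht h1 h2 p1 p2.
  by rewrite addrAC subrr add0r.
have hb2 t : x <= t <= x + e -> `|f t| <= M * e ^+ 2.
  move=> ht; have := norm_le_oscillation hf hb ht hz hz.
  rewrite fz lexx => /(_ isT isT); rewrite addrAC subrr add0r.
  by move=> /le_trans; apply; rewrite le_eqVlt; apply/orP; left; apply/eqP; ring.
by split; apply: hb2; rewrite lexx ?lerDl ltW.
Qed.

(** Two zeros produce a zero of [f1] between them, and a zero without a sign change produces slopes
    of both signs around it. In both cases the cell would be flat at both ends by [turning_cell]. *)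
Lemma cell_zeros x : f x != 0 -> f (x + e) != 0 ->
  ~ (`|f x| <= M * e ^+ 2 /\ `|f (x + e)| <= M * e ^+ 2) ->
  if sign_change f x (x + e) then
    exists z, x < z < x + e /\ forall t, x < t < x + e -> f t = 0 <-> t = z
  else forall t, x < t < x + e -> f t != 0.
Proof.
move=> fx0 fy0 good.
have good' z c1 c2 : x <= z <= x + e -> x <= c1 <= x + e ->
    x <= c2 <= x + e -> f z = 0 -> f1 c1 <= 0 -> 0 <= f1 c2 -> False.
  by move=> *; apply: good; exact: (@turning_cell x z c1 c2).
have w z : x < z < x + e -> x <= z <= x + e by move=> /andP[/ltW -> /ltW ->].
have cf : continuous f.
  by move=> t; apply/differentiable_continuous/derivable1_diffP; exact: ex_derive.
rewrite /sign_change.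
have xe : x < x + e by rewrite ltrDl.
have tri (t u : R) : t != 0 -> ~~ (t < 0) -> 0 < t.
  by move=> t0; rewrite -leNgt le_eqVlt eq_sym (negbTE t0).
case: ifPn => [sc|].
  have [z zc fz] : exists2 z, z \in `[x, x + e] & f z = 0.
    apply: IVT; [exact: ltW|exact: continuous_subspaceT|].
    rewrite ge_min le_max; move: sc.
    have [p1|p1] := ltP (f x) 0; have [p2|p2] := ltP (f (x + e)) 0 => // _.
      by rewrite ?(ltW p1) ?p2 ?orbT.
    by rewrite ?(ltW p2) ?p1 ?orbT.
  have zin : x < z < x + e.
    move: zc; rewrite in_itv/= => /andP[xz ze].
    rewrite !lt_neqAle xz ze !andbT; apply/andP; split.
      by apply: contraNneq fx0 => ->; rewrite fz.
    by apply: contraNneq fy0 => <-; rewrite fz.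
  exists z; split => // t tin; split => [ft|-> //].
  have key u v : x < u < x + e -> x < v < x + e -> f u = 0 -> f v = 0 -> u < v -> False.
    move=> uin vin fu fv uv; have [c /andP[uc cv]] := is_derive_mvt hf uv.
    rewrite fu fv subrr => /esym/eqP; rewrite mulf_eq0 [(v - u == 0)]subr_eq0.
    rewrite (gt_eqF uv) orbF => /eqP fc.
    have cin : x <= c <= x + e.
      by case/andP: uin => h1 _; case/andP: vin => _ h2;
        rewrite (ltW (lt_trans h1 uc)) (ltW (lt_trans cv h2)).
    by apply: (good' u c c (w _ uin) cin cin fu); rewrite fc.
  by have [tz|zt|//] := ltgtP t z; exfalso; [exact: key tz|exact: key zt].
rewrite negbK => /eqP sc t tin; apply/eqP => ft.
case/andP: (tin) => xt te.
have [c1 /andP[xc1 c1t] e1] := is_derive_mvt hf xt.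
have [c2 /andP[tc2 c2e] e2] := is_derive_mvt hf te.
have in1 : x <= c1 <= x + e by rewrite (ltW xc1) (ltW (lt_trans c1t te)).
have in2 : x <= c2 <= x + e by rewrite (ltW c2e) (ltW (lt_trans xt tc2)).
move: e1 e2; rewrite ft sub0r subr0 => e1 e2.
have tx : 0 < t - x by rewrite subr_gt0.
have et : 0 < x + e - t by rewrite subr_gt0.
have [fx|fx] := ltP (f x) 0.
  apply: (good' t c2 c1 (w _ tin) in2 in1 ft).
    by rewrite -(pmulr_lle0 _ et) -e2 ltW// -sc.
  by rewrite -(pmulr_lge0 _ tx) -e1 oppr_ge0 ltW.
apply: (good' t c1 c2 (w _ tin) in1 in2 ft).
  by rewrite -(pmulr_lle0 _ tx) -e1 oppr_le0.
by rewrite -(pmulr_lge0 _ et) -e2 leNgt -sc -leNgt.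
Qed.

Lemma zeros_on_grid (c : nat) :
  (forall i, (i <= c)%N -> f (i%:R * e) != 0) ->
  (forall i, (i < c)%N -> ~ (`|f (i%:R * e)| <= M * e ^+ 2 /\
                             `|f (i.+1%:R * e)| <= M * e ^+ 2)) ->
  exists zs : seq R, [/\ uniq zs,
    size zs = (\sum_(i < c) sign_change f (i%:R * e) (i.+1%:R * e))%N &
    forall t, t \in zs <-> 0 < t < c%:R * e /\ f t = 0].
Proof.
elim: c => [|c IH] h1 h2.
  exists [::]; rewrite big_ord0; split => // t; split => //.
  by move=> []; rewrite mul0r => /andP[/lt_trans h /h]; rewrite ltxx.
have [||zs [uzs szs hzs]] := IH.
- by move=> i ic; apply: h1; exact: leqW.
- by move=> i ic; apply: h2; exact: leqW.
have eS : c.+1%:R * e = c%:R * e + e :> R by rewrite -addn1 natrD mulrDl mul1r.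
have h2c := h2 c (ltnSn c); rewrite eS in h2c.
have f0 := h1 c (leqnSn c); have f0' := h1 c.+1 (leqnn _); rewrite eS in f0'.
have ce0 : 0 <= c%:R * e by rewrite mulr_ge0// ltW.
have := cell_zeros f0 f0' h2c.
rewrite big_ord_recr /= -szs eS.
have split3 t : 0 < t < c%:R * e + e ->
    [\/ 0 < t < c%:R * e, t = c%:R * e | c%:R * e < t < c%:R * e + e].
  move=> /andP[t0 te]; have [h|h|h] := ltgtP t (c%:R * e).
  - by apply: Or31; rewrite t0.
  - by apply: Or33; rewrite te.
  - exact: Or32.
case: ifPn => _.
  move=> [z [/andP[zc ze] hz]]; exists (z :: zs); split.
  - rewrite /= uzs andbT; apply/negP => /hzs[/andP[_ h] _].
    by have := lt_trans h zc; rewrite ltxx.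
  - by rewrite /= addn1.
  move=> t; rewrite inE; split.
    move=> /orP[/eqP ->|/hzs[/andP[t0 tc] ft]].
      by split; [rewrite ze (le_lt_trans ce0 zc)|apply/hz => //; rewrite zc].
    by split => //; rewrite t0 (lt_le_trans tc)// lerDl ltW.
  move=> [tin ft]; case: (split3 t tin) => [tc|tc|tc].
  - by apply/orP; right; apply/hzs.
  - by move: f0; rewrite -tc ft eqxx.
  - by apply/orP; left; apply/eqP/(hz t tc).
move=> hn; exists zs; split => //; first by rewrite addn0.
move=> t; split.
  move=> /hzs[/andP[t0 tc] ft].
  by split => //; rewrite t0 (lt_le_trans tc)// lerDl ltW.
move=> [tin ft]; case: (split3 t tin) => [tc|tc|tc].
- by apply/hzs.
- by move: f0; rewrite -tc ft eqxx.
- by move: (hn t tc); rewrite ft eqxx.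
Qed.

End zeros_on_grid.

(** * Trigonometric sums with Gaussian coefficients *)

Section random_trigonometric.
Context {R : realType} d (T : measurableType d) {I : choiceType}.
Variables (X : I -> T -> R * R) (s : seq I) (om : I -> R).

Definition wave_norm : R := (Num.sqrt (size s)%:R)^-1.

(** Each derivative in [t] multiplies by [om i] and advances the phase by [pi / 2], so that one
    formula covers all orders [j]. *)
Definition trig_coef (nu : R) (j : nat) (t : R) (i : I) : R * R :=
  (nu * (om i ^+ j * cos (om i * t + j%:R * (pi / 2))),
   - (nu * (om i ^+ j * sin (om i * t + j%:R * (pi / 2))))).

Definition wave_coef := trig_coef wave_norm.

Definition wave (j : nat) (w : T) (t : R) : R := lform X s (wave_coef j t) w.

Lemma is_derive_affine (a b t : R) : is_derive t 1 (fun t : R => a * t + b) a.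
Proof.
have -> : (fun t : R => a * t + b) = (a \*: (@id R)) + cst b by [].
by apply: is_derive_eq; rewrite addr0 /GRing.scale /= mulr1.
Qed.

Lemma is_derive_wave j w (t : R) : is_derive t 1 (wave j w) (wave j.+1 w t).
Proof.
rewrite /wave /wave_coef; move: wave_norm => nu; rewrite /lform.
elim: s => [|i s' IH].
  rewrite (_ : (fun t => _) = cst 0); last by apply: funext => u; rewrite big_nil.
  by rewrite big_nil; exact: is_derive_cst.
pose c := j%:R * (pi / 2) : R.
have jS u : om i * u + j.+1%:R * (pi / 2) = om i * u + c + pi / 2.
  by rewrite /c -addn1 natrD mulrDl mul1r addrA.
pose F1 := ((X i w).1 * nu * om i ^+ j) \*: (cos \o (fun t => om i * t + c)).
pose F2 := ((X i w).2 * - nu * om i ^+ j) \*: (sin \o (fun t => om i * t + c)).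
pose F3 := fun t => lform X s' (trig_coef nu j t) w.
rewrite (_ : (fun t => _) = F1 + F2 + F3); last first.
  apply: funext => u; rewrite big_cons.
  transitivity (F1 u + F2 u + F3 u); last by [].
  congr (_ + _); rewrite /F1 /F2 /= -/c /GRing.scale /=; ring.
rewrite big_cons.
have d1 := is_derive1_comp (is_derive_cos _) (is_derive_affine (om i) c t).
have d2 := is_derive1_comp (is_derive_sin _) (is_derive_affine (om i) c t).
have d3 := IH.
apply: is_derive_eq; congr (_ + _).
rewrite /= jS cosDpihalf sinDpihalf /GRing.scale /= exprS; ring.
Qed.

End random_trigonometric.

(** * Covariance structure of sums and differences of values *)

Section spectral.
Context {R : realType} d (T : measurableType d) {I : choiceType}.
Variables (X : I -> T -> R * R) (s : seq I) (om : I -> R) (Om : R).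
Hypotheses (s0 : (0 < size s)%N) (Om0 : 0 < Om).
Hypothesis om_le : forall i, i \in s -> `|om i| <= Om.
Hypothesis om_sq : (size s)%:R * Om ^+ 2 / 2 <= \sum_(i <- s) om i ^+ 2.
Local Notation nu := (@wave_norm R I s).

Lemma wave_norm_sqr : nu ^+ 2 * (size s)%:R = 1.
Proof. by rewrite /wave_norm exprVn sqr_sqrtr// mulVf// pnatr_eq0 -lt0n. Qed.

(** The arithmetic mean over [s], since [nu ^+ 2] is the inverse of its size. *)
Definition average (f : I -> R) : R := nu ^+ 2 * \sum_(i <- s) f i.

Lemma average_le f b : (forall i, i \in s -> f i <= b) -> average f <= b.
Proof.
move=> h; rewrite -[leRHS]mul1r -wave_norm_sqr -mulrA ler_wpM2l ?sqr_ge0//.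
rewrite mulr_natl; apply: (@le_trans _ _ (\sum_(i <- s) b)).
  by rewrite big_seq [leRHS]big_seq; exact: ler_sum.
by rewrite big_const_seq count_predT iter_addr_0.
Qed.

Lemma averageN f : average (fun i => - f i) = - average f.
Proof. by rewrite /average sumrN mulrN. Qed.

Lemma average_norm_le f b : (forall i, i \in s -> `|f i| <= b) -> `|average f| <= b.
Proof.
move=> h; rewrite ler_norml lerNl -averageN.
apply/andP; split; apply: average_le => i /h; rewrite ler_norml => /andP[] //.
by rewrite lerNl.
Qed.

Lemma average_ge f b : (forall i, i \in s -> b <= f i) -> b <= average f.
Proof.
move=> h; rewrite -lerN2 -averageN; apply: average_le => i /h; by rewrite lerN2.
Qed.

Lemma averageB f g : average f - average g = average (fun i => f i - g i).
Proof. by rewrite /average -mulrBr sumrB. Qed.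

Lemma average_mulr f b : average f * b = average (fun i => f i * b).
Proof. by rewrite /average -mulrA mulr_suml. Qed.

Lemma average_om : Om ^+ 2 / 2 <= average (fun i => om i ^+ 2).
Proof.
rewrite /average -[leLHS]mul1r -[X in X * _ <= _]wave_norm_sqr -mulrA ler_wpM2l ?sqr_ge0//.
by apply: le_trans om_sq; rewrite mulrA.
Qed.

Lemma wave_coef_dot j t :
  lform_dot s (wave_coef s om j t) (wave_coef s om j t) = average (fun i => (om i ^+ j) ^+ 2).
Proof.
rewrite /lform_dot /average mulr_sumr; apply: eq_bigr => i _ /=.
set th := om i * t + j%:R * (pi / 2).
transitivity (nu ^+ 2 * (om i ^+ j) ^+ 2 * (cos th ^+ 2 + sin th ^+ 2)); first by ring.
by rewrite cos2Dsin2 mulr1.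
Qed.

Lemma wave_coef0_dot t : lform_dot s (wave_coef s om 0 t) (wave_coef s om 0 t) = 1.
Proof.
rewrite wave_coef_dot; apply/le_anti/andP; split;
by [apply: average_le => i _; rewrite expr0 expr1n |
    apply: average_ge => i _; rewrite expr0 expr1n].
Qed.

Lemma wave_coef_dot_le j t :
  Num.sqrt (lform_dot s (wave_coef s om j t) (wave_coef s om j t)) <= Om ^+ j.
Proof.
have Oj : 0 <= Om ^+ j by rewrite exprn_ge0// ltW.
rewrite -[leRHS]ger0_norm// -sqrtr_sqr ler_wsqrtr// wave_coef_dot.
apply: average_le => i /om_le h.
by rewrite -[leLHS]real_normK ?num_real// lerXn2r ?nnegrE// normrX lerXn2r ?nnegrE// ltW.
Qed.

Lemma sin_sqr_le (x : R) : sin x ^+ 2 <= x ^+ 2.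
Proof.
wlog x0 : x / 0 <= x.
  move=> h; have [/h //|/ltW x0] := leP 0 x.
  by have := h (- x); rewrite oppr_ge0 sinN !sqrrN => /(_ x0).
have [->|xn0] := eqVneq x 0; first by rewrite sin0.
have xp : 0 < x by rewrite lt_neqAle eq_sym xn0.
have [c _] := is_derive_mvt (fun y => is_derive_sin y) xp.
rewrite sin0 !subr0 => ->; rewrite exprMn ler_piMl ?sqr_ge0//.
Qed.

Lemma sin_sqr_ge (x : R) : `|x| <= 1 / 2 -> 3 / 4 * x ^+ 2 <= sin x ^+ 2.
Proof.
wlog x0 : x / 0 <= x.
  move=> h; have [/h //|/ltW x0] := leP 0 x.
  by have := h (- x); rewrite oppr_ge0 sinN !sqrrN normrN => /(_ x0).
rewrite ger0_norm// => x2.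
have [->|xn0] := eqVneq x 0; first by rewrite sin0 expr0n mulr0.
have xp : 0 < x by rewrite lt_neqAle eq_sym xn0.
have [c /andP[c0 cx]] := is_derive_mvt (fun y => is_derive_sin y) xp.
rewrite sin0 !subr0 => ->; rewrite exprMn ler_wpM2r ?sqr_ge0// cos2sin2.
have h1 := sin_sqr_le c.
have h2 : c ^+ 2 <= (1 / 2) ^+ 2 by rewrite lerXn2r ?nnegrE//; lra.
have h3 : (1 / 2) ^+ 2 = 1 / 4 :> R by field.
by rewrite h3 in h2; lra.
Qed.

Section pair_of_points.
Variable eta : R.
Hypotheses (eta0 : 0 < eta) (etaOm : eta * Om <= 1 / 2).
Let phi i := om i * eta / 2.

(** With [sin_weight], the values of [lform_dot] on the forms [f t + f (t + eta)] and
    [f (t + eta) - f t] before normalisation; they do not depend on [t]. *)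
Definition cos_weight := average (fun i => 4 * cos (phi i) ^+ 2).
Definition sin_weight := average (fun i => 4 * sin (phi i) ^+ 2).
Local Notation D1 := cos_weight.
Local Notation D2 := sin_weight.

Let phi_sqr i : phi i ^+ 2 = om i ^+ 2 * (eta ^+ 2 / 4).
Proof. by rewrite /phi; field. Qed.

Let om_sqr_le i : i \in s -> om i ^+ 2 <= Om ^+ 2.
Proof.
move=> /om_le h; rewrite -[leLHS]real_normK ?num_real//.
by rewrite lerXn2r ?nnegrE// ltW.
Qed.

Let phi_le i : i \in s -> `|phi i| <= 1 / 4.
Proof.
move=> /om_le h; rewrite /phi !normrM (gtr0_norm eta0) normfV (ger0_norm (ler0n _ 2)).
have h1 : `|om i| * eta <= Om * eta by rewrite ler_wpM2r// ltW.
by move: etaOm h1; rewrite mulrC; set A := Om * eta; set B := _ * eta; lra.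
Qed.

Let phi_sqr_le i : i \in s -> phi i ^+ 2 <= eta ^+ 2 * Om ^+ 2 / 4.
Proof.
move=> /om_sqr_le h; rewrite phi_sqr.
have e0 : 0 <= eta ^+ 2 / 4 by rewrite divr_ge0 ?sqr_ge0.
by apply: (le_trans (ler_wpM2r e0 h)); rewrite mulrA (mulrC (Om ^+ 2)).
Qed.

Let sin_phi_le i : i \in s -> sin (phi i) ^+ 2 <= 1 / 16.
Proof.
move=> /phi_le h; apply: (le_trans (sin_sqr_le _)).
have -> : 1 / 16 = (1 / 4) ^+ 2 :> R by field.
by rewrite -[leLHS]real_normK ?num_real// lerXn2r ?nnegrE//; lra.
Qed.

Lemma cos_weight_ge : 3 <= D1.
Proof. by apply: average_ge => i /sin_phi_le h; rewrite cos2sin2; lra. Qed.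

Lemma sin_weight_le : D2 <= eta ^+ 2 * Om ^+ 2.
Proof.
apply: average_le => i is'; have := phi_sqr_le is'; have := sin_sqr_le (phi i).
by set A := eta ^+ 2 * _; lra.
Qed.

(** The mean square of the frequencies is at least [Om^2 / 2], so the variance of the difference is
    of exact order [(eta Om)^2]; the factor 3/4 of [sin_sqr_ge] leaves 3/8, which exceeds 1/4. *)
Lemma sin_weight_ge : eta ^+ 2 * Om ^+ 2 / 4 <= D2.
Proof.
have h1 : average (fun i => om i ^+ 2 * (eta ^+ 2 * 3 / 4)) <= D2.
  rewrite /D2 /average ler_wpM2l ?sqr_ge0// big_seq [leRHS]big_seq.
  apply: ler_sum => i is'.
  have : `|phi i| <= 1 / 2 by apply: (le_trans (phi_le is')); lra.
  move=> /sin_sqr_ge; rewrite phi_sqr.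
  by set A := om i ^+ 2; set B := eta ^+ 2; set C := sin _ ^+ 2; nra.
apply: le_trans h1; rewrite -average_mulr.
have h2 := average_om; set B := average _ in h2 *.
have e2 : 0 <= eta ^+ 2 by exact: sqr_ge0.
have := ler_wpM2l e2 h2; have : 0 <= eta ^+ 2 * B.
  by rewrite mulr_ge0// (le_trans _ h2)// divr_ge0 ?sqr_ge0.
by set A := eta ^+ 2 in e2 *; set C := Om ^+ 2; nra.
Qed.

Let D1_gt0 : 0 < D1.
Proof. by have := cos_weight_ge; lra. Qed.

Lemma sin_weight_gt0 : 0 < D2.
Proof.
by apply: lt_le_trans sin_weight_ge; rewrite divr_gt0// mulr_gt0// exprn_gt0.
Qed.

Definition slope : R := Num.sqrt D2 / Num.sqrt D1.

Lemma slope_ge0 : 0 <= slope.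
Proof. by rewrite divr_ge0. Qed.

Lemma slope_sqr_le : slope ^+ 2 <= eta ^+ 2 * Om ^+ 2.
Proof.
rewrite /slope expr_div_n !sqr_sqrtr ?(ltW sin_weight_gt0) ?(ltW D1_gt0)//.
rewrite ler_pdivrMr//; apply: (le_trans sin_weight_le).
have e0 : 0 <= eta ^+ 2 * Om ^+ 2 by apply: mulr_ge0; exact: sqr_ge0.
by rewrite ler_peMr//; have := cos_weight_ge; lra.
Qed.

(** With phases taken at the midpoint [t + eta / 2], the sum has amplitudes [2 cos (phi i)] and the
    difference [2 sin (phi i)], in quadrature; this makes the two forms orthogonal and their
    correlations functions of [t - t']. *)
Definition sum_coef t i : R * R :=
  let c := nu * (2 * cos (phi i)) / Num.sqrt D1 in
  (c * cos (om i * (t + eta / 2)), - (c * sin (om i * (t + eta / 2)))).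

Definition diff_coef t i : R * R :=
  let c := nu * (2 * sin (phi i)) / Num.sqrt D2 in
  (- (c * sin (om i * (t + eta / 2))), - (c * cos (om i * (t + eta / 2)))).

Let mid t i : om i * (t + eta / 2) = om i * t + phi i.
Proof. by rewrite /phi; field. Qed.

Let right t i : om i * (t + eta) = om i * t + phi i + phi i.
Proof. by rewrite /phi; field. Qed.

Let sq1 : Num.sqrt D1 != 0. Proof. by rewrite sqrtr_eq0 -ltNge. Qed.
Let sq2 : Num.sqrt D2 != 0.
Proof. by rewrite sqrtr_eq0 -ltNge sin_weight_gt0. Qed.

Lemma lform_sum_coef t w : lform X s (sum_coef t) w =
  (wave X s om 0 w t + wave X s om 0 w (t + eta)) / Num.sqrt D1.
Proof.
rewrite /wave /lform -big_split /= mulr_suml; apply: eq_bigr => i _.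
rewrite /wave_coef /trig_coef /sum_coef /= !mul0r !addr0 expr0 !mul1r.
have [u ue] : exists u, u = om i * t + phi i by exists (om i * t + phi i).
rewrite right mid -ue; have -> : om i * t = u - phi i by rewrite ue addrK.
by rewrite !cosB !sinB !cosD !sinD; field.
Qed.

Lemma lform_diff_coef t w : lform X s (diff_coef t) w =
  (wave X s om 0 w (t + eta) - wave X s om 0 w t) / Num.sqrt D2.
Proof.
rewrite /wave /lform -sumrB /= mulr_suml; apply: eq_bigr => i _.
rewrite /wave_coef /trig_coef /diff_coef /= !mul0r !addr0 expr0 !mul1r.
have [u ue] : exists u, u = om i * t + phi i by exists (om i * t + phi i).
rewrite right mid -ue; have -> : om i * t = u - phi i by rewrite ue addrK.
by rewrite !cosB !sinB !cosD !sinD; field.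
Qed.

Definition cos_corr (f : I -> R) tau := average (fun i => f i * cos (om i * tau)).
Definition sin_corr (f : I -> R) tau := average (fun i => f i * sin (om i * tau)).
(** These weights remain bounded as [eta] tends to 0: [sin (phi i) ^+ 2] and [sin_weight] are both
    of order [eta^2], and the square of [weight12] is the product of the other two. *)
Definition weight11 i := 4 * cos (phi i) ^+ 2 / D1.
Definition weight22 i := 4 * sin (phi i) ^+ 2 / D2.
Definition weight12 i := 4 * (sin (phi i) * cos (phi i)) / (Num.sqrt D1 * Num.sqrt D2).

Let tauE t t' i : om i * (t - t') = om i * (t + eta / 2) - om i * (t' + eta / 2).
Proof. by ring. Qed.

Lemma dot_sum_sum t t' : lform_dot s (sum_coef t) (sum_coef t') = cos_corr weight11 (t - t').
Proof.
rewrite /lform_dot /cos_corr /average mulr_sumr; apply: eq_bigr => i _.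
have -> : weight11 i = 4 * cos (phi i) ^+ 2 / Num.sqrt D1 ^+ 2.
  by rewrite sqr_sqrtr// ltW.
by rewrite tauE cosB /sum_coef /=; field.
Qed.

Lemma dot_diff_diff t t' : lform_dot s (diff_coef t) (diff_coef t') = cos_corr weight22 (t - t').
Proof.
rewrite /lform_dot /cos_corr /average mulr_sumr; apply: eq_bigr => i _.
have -> : weight22 i = 4 * sin (phi i) ^+ 2 / Num.sqrt D2 ^+ 2.
  by rewrite sqr_sqrtr// ltW// sin_weight_gt0.
by rewrite tauE cosB /diff_coef /=; field.
Qed.

Lemma dot_sum_diff t t' : lform_dot s (sum_coef t) (diff_coef t') = sin_corr weight12 (t - t').
Proof.
rewrite /lform_dot /sin_corr /average mulr_sumr; apply: eq_bigr => i _.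
rewrite tauE sinB /diff_coef /sum_coef /weight12 /=.
by field; rewrite sq1 sq2.
Qed.

Lemma dot_diff_sum t t' : lform_dot s (diff_coef t) (sum_coef t') = - sin_corr weight12 (t - t').
Proof.
rewrite /lform_dot /sin_corr -averageN /average mulr_sumr; apply: eq_bigr => i _.
rewrite tauE sinB /diff_coef /sum_coef /weight12 /=.
by field; rewrite sq1 sq2.
Qed.

Lemma dot_sum1 t : lform_dot s (sum_coef t) (sum_coef t) = 1.
Proof.
rewrite dot_sum_sum subrr /cos_corr.
under eq_fun do rewrite mulr0 cos0 mulr1.
by rewrite /weight11 -average_mulr mulfV// gt_eqF.
Qed.

Lemma dot_diff1 t : lform_dot s (diff_coef t) (diff_coef t) = 1.
Proof.
rewrite dot_diff_diff subrr /cos_corr.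
under eq_fun do rewrite mulr0 cos0 mulr1.
by rewrite /weight22 -average_mulr mulfV// gt_eqF// sin_weight_gt0.
Qed.

Lemma dot_sum_diff0 t : lform_dot s (sum_coef t) (diff_coef t) = 0.
Proof.
rewrite dot_sum_diff subrr /sin_corr.
under eq_fun do rewrite mulr0 sin0 mulr0.
by rewrite /average big1 ?mulr0.
Qed.

Lemma weight11_le i : i \in s -> `|weight11 i| <= 4.
Proof.
move=> _; have c2 := sqr_ge0 (cos (phi i)).
have w0 : 0 <= weight11 i := divr_ge0 (mulr_ge0 (ler0n _ 4) c2) (ltW D1_gt0).
rewrite (ger0_norm w0) /weight11 ler_pdivrMr//.
by rewrite cos2sin2; have := sqr_ge0 (sin (phi i)); have := cos_weight_ge; lra.
Qed.

Lemma weight22_le i : i \in s -> `|weight22 i| <= 4.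
Proof.
move=> is'; have c2 := sqr_ge0 (sin (phi i)).
have w0 : 0 <= weight22 i := divr_ge0 (mulr_ge0 (ler0n _ 4) c2) (ltW sin_weight_gt0).
rewrite (ger0_norm w0) /weight22 ler_pdivrMr ?sin_weight_gt0// ler_wpM2l//.
apply: le_trans sin_weight_ge; apply: (le_trans (sin_sqr_le _)).
exact: phi_sqr_le.
Qed.

Lemma weight12_le i : i \in s -> `|weight12 i| <= 4.
Proof.
move=> is'; have h1 := weight11_le is'; have h2 := weight22_le is'.
have e : `|weight12 i| ^+ 2 = `|weight11 i| * `|weight22 i|.
  rewrite -normrX -normrM; congr `|_|.
  have -> : weight12 i ^+ 2 = 16 * (sin (phi i) * cos (phi i)) ^+ 2 /
      (Num.sqrt D1 ^+ 2 * Num.sqrt D2 ^+ 2).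
    by rewrite /weight12; field; rewrite sq1 sq2.
  rewrite (sqr_sqrtr (ltW D1_gt0)) (sqr_sqrtr (ltW sin_weight_gt0)).
  by rewrite /weight11 /weight22; field; rewrite !gt_eqF// sin_weight_gt0.
have : `|weight12 i| ^+ 2 <= 4 ^+ 2 by rewrite e expr2; exact: ler_pM.
by rewrite ler_pXn2r// nnegrE.
Qed.

End pair_of_points.

End spectral.

(** * Dirichlet kernels *)

Section dirichlet_kernel.
Context {R : realType}.
Implicit Types (th x y : R).

Lemma cos_lipschitz x y : `|cos x - cos y| <= `|x - y|.
Proof.
wlog xy : x y / y < x.
  move=> h; have [xy|xy|->] := ltgtP x y; last by rewrite !subrr.
    by rewrite distrC [leRHS]distrC; exact: h.
  exact: h.
have [c _ ->] := is_derive_mvt (fun y => is_derive_cos y) xy.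
by rewrite normrM normrN ler_piMl// sin_max.
Qed.

Lemma sin_lipschitz x y : `|sin x - sin y| <= `|x - y|.
Proof.
have := cos_lipschitz (x - pi / 2) (y - pi / 2).
by rewrite !cosBpihalf; have -> : x - pi / 2 - (y - pi / 2) = x - y by ring.
Qed.

(** The squared modulus of the sum of [exp (i a th)] over [a < M]. *)
Definition dirichlet_sqr (M : nat) th : R :=
  (\sum_(a < M) cos (a%:R * th)) ^+ 2 + (\sum_(a < M) sin (a%:R * th)) ^+ 2.

Lemma dirichlet_sqr_ge0 M th : 0 <= dirichlet_sqr M th.
Proof. by rewrite addr_ge0 ?sqr_ge0. Qed.

Lemma sum_cos_pairs M th :
  \sum_(a < M) \sum_(b < M) cos (a%:R * th - b%:R * th) = dirichlet_sqr M th.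
Proof.
rewrite /dirichlet_sqr !expr2 !mulr_suml -big_split; apply: eq_bigr => a _ /=.
by rewrite !mulr_sumr -big_split; apply: eq_bigr => b _ /=; rewrite cosB.
Qed.

Lemma dirichlet_sqr_le M th : dirichlet_sqr M th <= M%:R ^+ 2.
Proof.
rewrite -sum_cos_pairs (@le_trans _ _ (\sum_(a < M) \sum_(b < M) 1))//.
  by apply: ler_sum => a _; apply: ler_sum => b _; exact: cos_le1.
by rewrite !sumr_const !card_ord expr2 mulr_natr.
Qed.

(** Multiplied by [2 sin (th / 2)], both sums telescope; the end terms are two points of the unit
    circle, so their squared distance is at most 4. *)
Lemma sin_half_dirichlet M th : sin (th / 2) ^+ 2 * dirichlet_sqr M th <= 1.
Proof.
have c : 2 * sin (th / 2) * (\sum_(a < M) cos (a%:R * th)) =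
    sin (M%:R * th - th / 2) + sin (th / 2).
  elim: M => [|M IH].
    by rewrite big_ord0 mulr0 mul0r sub0r sinN addNr.
  rewrite big_ord_recr /= mulrDr IH.
  have -> : M.+1%:R * th - th / 2 = M%:R * th + th / 2.
    by rewrite -addn1 natrD; field.
  by rewrite sinB sinD; ring.
have s : 2 * sin (th / 2) * (\sum_(a < M) sin (a%:R * th)) =
    cos (th / 2) - cos (M%:R * th - th / 2).
  elim: M {c} => [|M IH].
    by rewrite big_ord0 mulr0 mul0r sub0r cosN subrr.
  rewrite big_ord_recr /= mulrDr IH.
  have -> : M.+1%:R * th - th / 2 = M%:R * th + th / 2.
    by rewrite -addn1 natrD; field.
  by rewrite cosB cosD; ring.
have e : 4 * (sin (th / 2) ^+ 2 * dirichlet_sqr M th) =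
    (2 * sin (th / 2) * (\sum_(a < M) cos (a%:R * th))) ^+ 2 +
    (2 * sin (th / 2) * (\sum_(a < M) sin (a%:R * th))) ^+ 2.
  by rewrite /dirichlet_sqr; ring.
rewrite -(ler_pM2l (ltr0Sn R 3)) e c s.
move: (M%:R * th - th / 2) => A; move: (th / 2) => B; have := cos_geN1 (A + B); rewrite cosD.
move: (cos2Dsin2 A) (cos2Dsin2 B).
by move: (cos A) (cos B) (sin A) (sin B) => a b p q hA hB h; lra.
Qed.

(** The trivial bound [M^2] serves for the term 1 of [1 + x^2], and the decay [1 / sin^2], valid as
    a power bound because the angle stays small, gives [x^2] times the kernel at most
    [(16/3) M^2 / L^2]. *)
Lemma dirichlet_sqr_decay (M : nat) (L x : R) : 0 < L -> (0 < M)%N ->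
  `|L / M%:R * x / 2| <= 1 / 2 ->
  dirichlet_sqr M (L / M%:R * x) <= M%:R ^+ 2 * (1 + 6 / L ^+ 2) / (1 + x ^+ 2).
Proof.
move=> L0 M0 hx; set th := L / M%:R * x in hx *.
have Mp : 0 < M%:R :> R by rewrite ltr0n.
have x2 : 0 < 1 + x ^+ 2 by rewrite ltr_pwDl ?sqr_ge0.
rewrite ler_pdivlMr//.
have h1 := dirichlet_sqr_le M th; have h2 := sin_half_dirichlet M th.
have d0 := dirichlet_sqr_ge0 M th.
have h3 := ler_wpM2r d0 (sin_sqr_ge hx).
have h4 : 3 / 4 * (th / 2) ^+ 2 * dirichlet_sqr M th <= 1 := le_trans h3 h2.
have e : x ^+ 2 * dirichlet_sqr M th =
    16 / 3 * (M%:R ^+ 2 / L ^+ 2) * (3 / 4 * (th / 2) ^+ 2 * dirichlet_sqr M th).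
  by rewrite /th; field; rewrite !gt_eqF.
have c0 : 0 <= M%:R ^+ 2 / L ^+ 2 by rewrite divr_ge0 ?sqr_ge0.
have h5 : x ^+ 2 * dirichlet_sqr M th <= 16 / 3 * (M%:R ^+ 2 / L ^+ 2).
  by rewrite e ler_piMr// mulr_ge0.
rewrite mulrDr mulr1 mulrC; set A := dirichlet_sqr M th in h1 h5 *.
rewrite (_ : M%:R ^+ 2 * (1 + 6 / L ^+ 2) = M%:R ^+ 2 + 6 * (M%:R ^+ 2 / L ^+ 2)); last by ring.
by set B := M%:R ^+ 2 / L ^+ 2 in c0 h5 *; set C := M%:R ^+ 2 in h1 *; lra.
Qed.

End dirichlet_kernel.

(** * Mean square of the correlations over the grid *)

Section correlation_sums.
Context {R : realType} {I : choiceType}.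
Variables (s : seq I) (om : I -> R) (Om : R).
Hypotheses (s0 : (0 < size s)%N) (Om0 : 0 < Om).
Hypothesis om_le : forall i, i \in s -> `|om i| <= Om.
Local Notation nu := (@wave_norm R I s).
Variable f : I -> R.
Hypothesis f_le : forall i, i \in s -> `|f i| <= 4.

Lemma cos_corr_lipschitz t t' :
  `|cos_corr s om f t - cos_corr s om f t'| <= 4 * Om * `|t - t'|.
Proof.
rewrite /cos_corr averageB; apply: average_norm_le => // i is'.
rewrite -mulrBr normrM -mulrA; apply: ler_pM => //; first exact: f_le.
apply: (le_trans (cos_lipschitz _ _)); rewrite -mulrBr normrM.
by rewrite ler_wpM2r// om_le.
Qed.

Lemma sin_corr_lipschitz t t' :
  `|sin_corr s om f t - sin_corr s om f t'| <= 4 * Om * `|t - t'|.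
Proof.
rewrite /sin_corr averageB; apply: average_norm_le => // i is'.
rewrite -mulrBr normrM -mulrA; apply: ler_pM => //; first exact: f_le.
apply: (le_trans (sin_lipschitz _ _)); rewrite -mulrBr normrM.
by rewrite ler_wpM2r// om_le.
Qed.

(** The cosine and sine parts together form the squared modulus of an exponential sum, whose double
    expansion contains only the differences of the frequencies. *)
Lemma corr_sqr t : cos_corr s om f t ^+ 2 + sin_corr s om f t ^+ 2 =
  nu ^+ 4 * \sum_(i <- s) \sum_(j <- s) f i * f j * cos (om i * t - om j * t).
Proof.
rewrite /cos_corr /sin_corr /average; move: nu => k.
rewrite !(exprMn _ (k ^+ 2)) -mulrDr -(exprM k 2 2); congr (_ * _).
rewrite !expr2 !mulr_suml -big_split; apply: eq_bigr => i _ /=.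
rewrite !mulr_sumr -big_split; apply: eq_bigr => j _ /=.
by rewrite cosB; ring.
Qed.

(** Summing over pairs of grid points first turns each pair of frequencies into a Dirichlet kernel
    at [om i - om j]. Its decay bounds the inner sum by [K], and one of the two factors [1 / n]
    survives. *)
Lemma sum_corr_sqr (M : nat) (L K : R) : 0 < L -> (0 < M)%N ->
  L / M%:R * Om <= 1 / 2 ->
  (forall i, i \in s -> \sum_(j <- s) (1 + (om i - om j) ^+ 2)^-1 <= K) ->
  \sum_(a < M) \sum_(b < M)
    (cos_corr s om f (a%:R * (L / M%:R) - b%:R * (L / M%:R)) ^+ 2 +
     sin_corr s om f (a%:R * (L / M%:R) - b%:R * (L / M%:R)) ^+ 2) <=
  16 * M%:R ^+ 2 * (1 + 6 / L ^+ 2) * K / (size s)%:R.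
Proof.
move=> L0 M0 eOm hK; set e := L / M%:R.
have e0 : 0 < e by rewrite divr_gt0// ltr0n.
have c0 : 0 <= M%:R ^+ 2 * (1 + 6 / L ^+ 2) :> R.
  by rewrite mulr_ge0 ?sqr_ge0// addr_ge0// divr_ge0 ?sqr_ge0.
under eq_bigr => a _ do under eq_bigr => b _ do rewrite corr_sqr.
have -> : \sum_(a < M) \sum_(b < M) nu ^+ 4 * (\sum_(i <- s) \sum_(j <- s)
    f i * f j * cos (om i * (a%:R * e - b%:R * e) - om j * (a%:R * e - b%:R * e))) =
  nu ^+ 4 * \sum_(i <- s) \sum_(j <- s) f i * f j * dirichlet_sqr M (e * (om i - om j)).
  transitivity (nu ^+ 4 * \sum_(a < M) \sum_(b < M) (\sum_(i <- s) \sum_(j <- s)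
    f i * f j * cos (om i * (a%:R * e - b%:R * e) - om j * (a%:R * e - b%:R * e)))).
    by rewrite mulr_sumr; apply: eq_bigr => a _; rewrite mulr_sumr.
  congr (_ * _).
  under eq_bigr do rewrite exchange_big /=.
  rewrite exchange_big /=; apply: eq_bigr => i _.
  under eq_bigr do rewrite exchange_big /=.
  rewrite exchange_big /=; apply: eq_bigr => j _.
  rewrite -sum_cos_pairs mulr_sumr; apply: eq_bigr => a _.
  rewrite mulr_sumr; apply: eq_bigr => b _; congr (_ * cos _); ring.
have key i j : i \in s -> j \in s ->
    f i * f j * dirichlet_sqr M (e * (om i - om j)) <=
    16 * (M%:R ^+ 2 * (1 + 6 / L ^+ 2)) * (1 + (om i - om j) ^+ 2)^-1.
  move=> is' js.
  have ff : f i * f j <= 16.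
    apply: (le_trans (ler_norm _)); rewrite normrM.
    apply: (le_trans (ler_pM _ _ (f_le is') (f_le js))) => //.
    by rewrite -natrM.
  (* The kernel is nonnegative, so the product of the weights can be replaced by its upper bound 16
     whatever its sign. *)
  apply: (le_trans (ler_wpM2r (dirichlet_sqr_ge0 _ _) ff)).
  rewrite -mulrA ler_wpM2l//; apply: dirichlet_sqr_decay => //.
  rewrite -/e -mulrA normrM gtr0_norm//.
  have h2 : `|(om i - om j) / 2| <= Om.
    rewrite normrM normfV (ger0_norm (ler0n _ 2)) ler_pdivrMr//.
    apply: (le_trans (ler_normB _ _)); rewrite mulr_natr mulr2n.
    by apply: lerD; exact: om_le.
  by apply: le_trans eOm; rewrite -/e ler_wpM2l// ltW.
apply: (@le_trans _ _ (nu ^+ 4 * \sum_(i <- s) (16 * (M%:R ^+ 2 * (1 + 6 / L ^+ 2)) * K))).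
  rewrite ler_wpM2l ?exprn_even_ge0// big_seq [leRHS]big_seq; apply: ler_sum => i is'.
  apply: (@le_trans _ _ (\sum_(j <- s) 16 * (M%:R ^+ 2 * (1 + 6 / L ^+ 2)) *
      (1 + (om i - om j) ^+ 2)^-1)).
    by rewrite big_seq [leRHS]big_seq; apply: ler_sum => j js; exact: key.
  by rewrite -mulr_sumr ler_wpM2l ?hK// mulr_ge0.
rewrite big_const_seq count_predT iter_addr_0 -mulr_natr.
have nn : nu ^+ 2 * (size s)%:R = 1 by exact: wave_norm_sqr.
have n0 : (size s)%:R != 0 :> R by rewrite pnatr_eq0 -lt0n.
have -> : nu ^+ 4 = (size s)%:R^-1 ^+ 2.
  have -> : nu ^+ 4 = (nu ^+ 2) ^+ 2 by rewrite -exprM.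
  by congr (_ ^+ 2); apply: (mulIf n0); rewrite nn mulVf.
by rewrite le_eqVlt; apply/orP; left; apply/eqP; field; rewrite n0 gt_eqF.
Qed.

End correlation_sums.

(** * Small values and absolute moments *)

Section gauss_estimates.
Context {R : realType}.
Local Notation mu := (@lebesgue_measure R).

Lemma gauss_density_le1 (x : R) : gauss_density x <= 1.
Proof.
rewrite /gauss_density mulr_ile1 ?invr_ge0 ?expR_ge0//.
  by rewrite invf_le1 ?sqrtr_gt0 ?pi_gt0// -[leLHS]sqrtr1 ler_wsqrtr//; have := @pi_ge2 R; lra.
by rewrite -expR0 ler_expR oppr_le0 sqr_ge0.
Qed.

Local Open Scope ereal_scope.

Lemma integral_gauss_itv (e : R) : (0 <= e)%R ->
  \int[gauss]_x (\1_(`[- e, e]) x)%:E <= (2 * e)%:E.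
Proof.
move=> e0.
have mI : measurable_fun setT (fun x : R => (\1_(`[(- e)%R, e]) x)%:E : \bar R).
  by apply/measurable_EFinP; exact: measurable_indic.
rewrite (ge0_integral_gauss mI)//.
apply: (@le_trans _ _ (\int[mu]_x (\1_(`[(- e)%R, e]) x)%:E)).
  apply: ge0_le_integral.
  - exact: measurableT.
  - by move=> x _; rewrite mule_ge0// lee_fin gauss_density_ge0.
  - by apply: emeasurable_funM => //; apply/measurable_EFinP; exact: measurable_gauss_density.
  - exact: mI.
  - by move=> x _; rewrite -EFinM lee_fin ler_piMr// gauss_density_le1.
have -> : \int[mu]_x (\1_(`[(- e)%R, e]) x)%:E =
    \int[mu]_(x in `[(- e)%R, e]) cst 1 x.
  rewrite [RHS]integral_mkcond; apply: eq_integral => x _.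
  by rewrite patchE indicE; case: ifP.
rewrite integral_cst//= lebesgue_measure_itv/= lte_fin.
case: ifPn => _; last by rewrite mule0 lee_fin mulr_ge0.
by rewrite mul1e -EFinD lee_fin; lra.
Qed.

Lemma integral_gauss_norm (k : R) : (0 <= k)%R ->
  \int[gauss]_x (`|k * x|%R)%:E <= (2 * k)%:E.
Proof.
move=> k0.
have mN : measurable_fun setT (fun x : R => (`|k * x|%R)%:E : \bar R).
  apply/measurable_EFinP; apply: measurableT_comp => //.
rewrite (ge0_integral_gauss mN)//.
have mg2 : measurable_fun setT (fun y : R => (gauss_density ((y - 0) / 2) / 2)%:E).
  by apply/measurable_EFinP; exact: measurable_gauss_density_affine.
have g20 (y : R) : 0 <= (gauss_density ((y - 0) / 2) / 2)%:E :> \bar R.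
  by rewrite lee_fin divr_ge0 ?gauss_density_ge0.
have one : \int[mu]_y (gauss_density ((y - 0) / 2) / 2)%:E = 1.
  have e := @ge0_integral_gauss_affine R 2%R 0%R (cst 1) (ltr0Sn _ _)
    (measurable_cst _) (fun _ => lee01).
  transitivity (\int[gauss]_(g in [set: R]) cst (1 : \bar R) g); last first.
    by rewrite integral_cst// [X in _ * X]probability_setT mule1.
  by rewrite e; apply: eq_integral => y _; rewrite mul1e.
have k4 : 0 <= (2 * k)%:E :> \bar R by rewrite lee_fin mulr_ge0.
rewrite -[leRHS]mule1 -one -(ge0_integralZl mu measurableT mg2 (fun _ _ => g20 _) k4).
apply: ge0_le_integral.
- exact: measurableT.
- by move=> y _; rewrite mule_ge0// lee_fin gauss_density_ge0.
- by apply: emeasurable_funM => //; apply/measurable_EFinP; exact: measurable_gauss_density.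
- by apply: emeasurable_funM => //; exact: measurable_cst.
move=> y _; rewrite -!EFinM lee_fin subr0 /gauss_density normrM (ger0_norm k0).
set p := ((Num.sqrt pi)^-1)%R.
have p0 : (0 <= p)%R by rewrite invr_ge0.
have hy : (`|y| * expR (- y ^+ 2 / 4) <= 1)%R.
  rewrite mulNr expRN ler_pdivrMr ?expR_gt0// mul1r.
  apply: le_trans (expR_ge1Dx _).
  rewrite -[(y ^+ 2)%R]real_normK ?num_real//.
  have := sqr_ge0 (`|y| / 2 - 1)%R; rewrite sqrrB; lra.
have e1 : (expR (- y ^+ 2) <= expR (- y ^+ 2 / 4) * expR (- (y / 2) ^+ 2))%R.
  rewrite -expRD ler_expR expr_div_n; have := sqr_ge0 y; lra.
have h1 : (`|y| * expR (- y ^+ 2) <= expR (- (y / 2) ^+ 2))%R.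
  apply: (le_trans (ler_wpM2l (normr_ge0 y) e1)).
  by rewrite mulrA ler_piMl// expR_ge0.
have kp : (0 <= k * p)%R by rewrite mulr_ge0.
have := ler_wpM2l kp h1.
set E := expR (- (y / 2) ^+ 2); set F := expR (- y ^+ 2) => h2.
rewrite (_ : (k * `|y| * (p * F) = k * p * (`|y| * F))%R); last by ring.
rewrite (_ : (2 * k * (p * E / 2) = k * p * E)%R)//; by field.
Qed.

End gauss_estimates.

Section wave_estimates.
Context {R : realType} d (T : measurableType d) (P : probability T R).
Context {I : choiceType} (A : set I) (X : I -> T -> R * R) (s : seq I).
Hypothesis mX : forall i, A i -> measurable_fun setT (X i).
Hypothesis indepX : mutually_independent P A X.
Hypothesis lawX : forall i, A i -> forall B, measurable B ->
  P (X i @^-1` B) = gauss2 B.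
Hypotheses (us : uniq s) (sA : {in s, forall i, A i}).
Local Open Scope ereal_scope.

Lemma probability_lform_le c (e : R) : lform_dot s c c = 1%R -> (0 <= e)%R ->
  P [set w | `|lform X s c w| <= e]%R <= (2 * e)%:E.
Proof.
move=> c1 e0.
have mI : measurable_fun setT (fun x : R => (\1_(`[(- e)%R, e]) x)%:E : \bar R).
  by apply/measurable_EFinP; exact: measurable_indic.
have I0 (x : R) : 0 <= (\1_(`[(- e)%R, e]) x)%:E :> \bar R by rewrite lee_fin.
have := integral_gauss_itv e0.
have := integral_lform mX indepX lawX us sA c mI I0.
rewrite c1 sqrtr1; under [in X in _ = X -> _]eq_integral do rewrite mul1r.
move=> <-; apply: le_trans.
have mE : measurable [set w | `|lform X s c w| <= e]%R.
  rewrite (_ : [set w | _] = lform X s c @^-1` `[(- e)%R, e]); last first.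
    by apply/seteqP; split => w /=; rewrite in_itv/= ler_norml.
  rewrite -[X in measurable X]setTI; apply: (measurable_lform mX sA c) => //.
rewrite -[in leLHS](setIT [set w | _]) -(integral_indic P measurableT mE).
rewrite le_eqVlt; apply/orP; left; apply/eqP; apply: eq_integral => w _.
rewrite !indicE; congr ((nat_of_bool _)%:R%:E).
by apply/idP/idP; rewrite !inE /= in_itv/= ler_norml.
Qed.

Lemma integral_norm_lform c :
  \int[P]_w (`|lform X s c w|%R)%:E <= (2 * Num.sqrt (lform_dot s c c))%:E.
Proof.
have mN : measurable_fun setT (fun x : R => (`|x|%R)%:E : \bar R).
  by apply/measurable_EFinP; exact: normr_measurable.
have N0 (x : R) : 0 <= (`|x|%R)%:E :> \bar R by rewrite lee_fin.
rewrite (integral_lform mX indepX lawX us sA c mN N0).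
exact: integral_gauss_norm.
Qed.

(** Presents the coordinates of [X i] as linear forms, so that the moment bound for forms applies to
    them. *)
Definition coordinate_coef (b : bool) (i j : I) : R * R :=
  if j == i then (if b then (1, 0) else (0, 1))%R else (0, 0)%R.

Lemma lform_coordinate b i w : i \in s ->
  lform X s (coordinate_coef b i) w = if b then (X i w).1 else (X i w).2.
Proof.
move=> is'; rewrite /lform (bigD1_seq i)//= big1 ?addr0.
  rewrite /coordinate_coef eqxx; case: b => /=; by rewrite ?mulr1 ?mulr0 ?addr0 ?add0r.
by move=> j /negbTE ji; rewrite /coordinate_coef ji /= !mulr0 addr0.
Qed.

Lemma coordinate_coef_dot b i : i \in s ->
  lform_dot s (coordinate_coef b i) (coordinate_coef b i) = 1%R.
Proof.
move=> is'; rewrite /lform_dot (bigD1_seq i)//= big1 ?addr0.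
  rewrite /coordinate_coef eqxx; case: b => /=; by rewrite ?mulr1 ?mulr0 ?addr0 ?add0r.
by move=> j /negbTE ji; rewrite /coordinate_coef ji /= !mulr0 addr0.
Qed.

Lemma integral_coordinate i : i \in s ->
  \int[P]_w (`|(X i w).1| + `|(X i w).2|)%:E <= 4%:E.
Proof.
move=> is'.
have h b : \int[P]_w (`|if b then (X i w).1 else (X i w).2|%R)%:E <= 2%:E.
  have := integral_norm_lform (coordinate_coef b i).
  rewrite coordinate_coef_dot// sqrtr1 mulr1; apply: le_trans.
  rewrite le_eqVlt; apply/orP; left; apply/eqP; apply: eq_integral => w _.
  by rewrite lform_coordinate.
have mXi := mX (sA is').
under eq_integral do rewrite EFinD.
rewrite ge0_integralD//.
- rewrite (_ : 4%:E = 2%:E + 2%:E); first by apply: leeD; [exact: (h true)|exact: (h false)].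
  by rewrite -EFinD; congr EFin; rewrite -natrD.
- by apply/measurable_EFinP; apply: measurableT_comp => //; exact: measurableT_comp.
- by apply/measurable_EFinP; apply: measurableT_comp => //; exact: measurableT_comp.
Qed.

End wave_estimates.

(** * Simultaneous control of all derivatives on a short block *)

Section block_moment.
Context {R : realType} d (T : measurableType d) (P : probability T R).
Context {I : choiceType} (A : set I) (X : I -> T -> R * R) (s : seq I).
Hypothesis mX : forall i, A i -> measurable_fun setT (X i).
Hypothesis indepX : mutually_independent P A X.
Hypothesis lawX : forall i, A i -> forall B, measurable B ->
  P (X i @^-1` B) = gauss2 B.
Hypotheses (us : uniq s) (sA : {in s, forall i, A i}).
Variables (om : I -> R) (Om : R).
Hypotheses (s0 : (0 < size s)%N) (Om0 : 0 < Om).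
Hypothesis om_le : forall i, i \in s -> `|om i| <= Om.
Local Notation nu := (@wave_norm R I s).
Local Notation f := (wave X s om).

(** Dominates every derivative on the whole line up to a power of [Om]. Its mean is only bounded by
    a multiple of the square root of the number of frequencies, so it can serve in a remainder but
    not as a uniform bound. *)
Definition amplitude (w : T) : R := nu * \sum_(i <- s) (`|(X i w).1| + `|(X i w).2|).

Let nu0 : 0 <= nu. Proof. by rewrite invr_ge0. Qed.

Lemma amplitude_ge0 w : 0 <= amplitude w.
Proof. by rewrite mulr_ge0// sumr_ge0// => i _; rewrite addr_ge0. Qed.

Lemma wave_le_amplitude j w t : `|f j w t| <= Om ^+ j * amplitude w.
Proof.
rewrite /wave /lform; apply: (le_trans (ler_norm_sum _ _ _)).
rewrite /amplitude mulrCA !mulr_sumr big_seq [leRHS]big_seq; apply: ler_sum => i is'.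
have oj : `|om i| ^+ j <= Om ^+ j by rewrite lerXn2r ?nnegrE ?(ltW Om0)// om_le.
have O0 : 0 <= Om ^+ j by rewrite exprn_ge0// ltW.
have b (u : R) : `|u| <= 1 -> `|nu * (om i ^+ j * u)| <= nu * Om ^+ j.
  move=> u1; rewrite normrM (ger0_norm nu0) ler_wpM2l// normrM normrX.
  by rewrite -[leRHS]mulr1; apply: ler_pM => //; rewrite exprn_ge0.
apply: (le_trans (ler_normD _ _)); rewrite !(normrM (X i w).1) !(normrM (X i w).2).
rewrite {1 2}/wave_coef /= normrN.
have -> : nu * (Om ^+ j * (`|(X i w).1| + `|(X i w).2|)) =
  nu * Om ^+ j * `|(X i w).1| + nu * Om ^+ j * `|(X i w).2| by ring.
by apply: lerD; rewrite mulrC ler_wpM2r// b// ?cos_max ?sin_max.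
Qed.

Lemma measurable_wave j t : measurable_fun setT (fun w => f j w t).
Proof. exact: (measurable_lform mX sA). Qed.

Lemma measurable_amplitude : measurable_fun setT amplitude.
Proof.
apply: measurable_funM; first exact: measurable_cst.
have [r rs] : exists r, r = s by exists s.
move: (sA); rewrite -rs; elim: r {rs} => [_|i s' IH sA'].
  by under eq_fun do rewrite big_nil; exact: measurable_cst.
under eq_fun do rewrite big_cons.
have mXi : measurable_fun setT (X i) by apply/mX/sA'; rewrite mem_head.
apply: measurable_funD; last by apply: IH => j js; apply: sA'; rewrite inE js orbT.
by apply: measurable_funD; apply: measurableT_comp => //; exact: measurableT_comp.
Qed.

Variables (t0 h : R).
Hypotheses (h0 : 0 < h) (hOm : h * Om <= 256^-1).
Local Notation q := (16^-1 : R).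
Let J := size s.

(* Expanding [f k] at [t0] up to the order [J], and bounding the remainder by
   [amplitude], controls all [h ^+ k * `|f k w t|] at once. *)
Definition taylor_bound (w : T) : R :=
  \sum_(j < J) (h / q) ^+ j * `|f j w t0| + q ^+ J * amplitude w.
Local Notation D := taylor_bound.

Let hOm0 : 0 <= h * Om. Proof. by rewrite mulr_ge0// ltW. Qed.

Let q2 : 256^-1 = q ^+ 2. Proof. by rewrite exprVn -natrX. Qed.

Let q01 : 0 <= q <= 1. Proof. by rewrite invr_ge0 ler0n invf_le1// ler1n. Qed.

Let hOmX j : (h * Om) ^+ j <= (q ^+ j) ^+ 2.
Proof.
have p0 : 0 <= (q ^+ 2 : R) by exact: sqr_ge0.
by rewrite -exprM mulnC exprM lerXn2r ?nnegrE ?p0 ?hOm0// -q2.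
Qed.

Let qle (a b : nat) : (a <= b)%N -> q ^+ b <= q ^+ a.
Proof. by move=> ab; apply: ler_wiXn2l => //; case/andP: q01. Qed.

Let qX0 (a : nat) : 0 <= q ^+ a. Proof. by rewrite exprn_ge0//; case/andP: q01. Qed.

Let crude k w t : h ^+ k * `|f k w t| <= (q ^+ k) ^+ 2 * amplitude w.
Proof.
apply: (le_trans (ler_wpM2l (exprn_ge0 _ (ltW h0)) (wave_le_amplitude k w t))).
by rewrite mulrA -exprMn ler_wpM2r// amplitude_ge0.
Qed.

(** Descending induction from the order [J]: by the mean value theorem, [h^k |f k|] at [t] exceeds
    its value at [t0] by at most [h^(k+1) |f (k+1)|] at an intermediate point. *)
Let tail k m w t : (k + m)%N = J -> t0 <= t <= t0 + h ->
  h ^+ k * `|f k w t| <=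
  \sum_(k <= j < J) h ^+ j * `|f j w t0| + (q ^+ J) ^+ 2 * amplitude w.
Proof.
elim: m k t => [|m IH] k t.
  by rewrite addn0 => -> _; rewrite big_geq// add0r; exact: crude.
move=> kJ tin.
have kJ' : (k.+1 + m)%N = J by rewrite addSnnS.
have kltJ : (k < J)%N by rewrite -kJ addnS ltnS leq_addr.
rewrite big_ltn// -addrA.
set S := \sum_(_ <= _ < _) _ + _ in IH *.
have hk : 0 < h ^+ k by rewrite exprn_gt0.
case/andP: (tin) => t0t th.
have [->|tt0] := eqVneq t t0.
  rewrite lerDl addr_ge0 ?mulr_ge0 ?sqr_ge0 ?amplitude_ge0// sumr_ge0// => j _.
  by rewrite mulr_ge0// exprn_ge0// ltW.
have t0t' : t0 < t by rewrite lt_neqAle eq_sym tt0.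
have [c /andP[c1 c2] e] := is_derive_mvt (is_derive_wave X s om k w) t0t'.
have cin : t0 <= c <= t0 + h by rewrite (ltW c1) (le_trans (ltW c2)).
have := IH k.+1 c kJ' cin; rewrite exprS -mulrA => hc.
have : `|f k w t| <= `|f k w t0| + `|f k.+1 w c| * h.
  have -> : f k w t = f k w t0 + f k.+1 w c * (t - t0) by rewrite -e; ring.
  apply: (le_trans (ler_normD _ _)); rewrite lerD2l normrM ler_wpM2l//.
  by rewrite gtr0_norm ?subr_gt0//; lra.
move=> /(ler_wpM2l (ltW hk)) /le_trans; apply; rewrite mulrDr lerD2l.
by apply: le_trans hc; rewrite le_eqVlt; apply/orP; left; apply/eqP; ring.
Qed.

(** Only orders [j >= k] occur in the expansion of [f k], and there
    [h^j = q^j (h / q)^j <= q^k (h / q)^j]. Beyond the order [J], half of the decay [q^(2k)] is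
    given up for the factor [q^J]. *)
Lemma wave_le_taylor_bound k w t : t0 <= t <= t0 + h ->
  h ^+ k * `|f k w t| <= q ^+ k * D w.
Proof.
move=> tin; have a0 := amplitude_ge0 w.
have D0 : 0 <= \sum_(j < J) (h / q) ^+ j * `|f j w t0|.
  apply: sumr_ge0 => j _; rewrite mulr_ge0// exprn_ge0// divr_ge0 ?(ltW h0)//.
have [kJ|Jk] := leqP k J; last first.
  apply: (le_trans (crude k w t)); rewrite expr2 -mulrA ler_wpM2l//.
  apply: (@le_trans _ _ (q ^+ J * amplitude w)); last by rewrite lerDr.
  by rewrite ler_wpM2r// qle// ltnW.
apply: (le_trans (tail w (subnKC kJ) tin)); rewrite mulrDr; apply: lerD; last first.
  by rewrite mulrA expr2 ler_wpM2r// ler_wpM2r// qle.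
rewrite mulr_sumr -(big_mkord xpredT (fun j => q ^+ k * ((h / q) ^+ j * `|f j w t0|))).
rewrite [leRHS](big_cat_nat (n := k))//= -[leLHS]add0r; apply: lerD.
  apply: sumr_ge0 => j _; rewrite !mulr_ge0// exprn_ge0// divr_ge0 ?(ltW h0)//.
rewrite big_nat_cond [leRHS]big_nat_cond; apply: ler_sum => j /andP[/andP[kj _] _].
rewrite mulrA ler_wpM2r// expr_div_n mulrCA.
rewrite ler_peMr ?exprn_ge0 ?(ltW h0)//.
have qj0 : 0 < q ^+ j by rewrite exprn_gt0// invr_gt0.
by rewrite ler_pdivlMr// mul1r qle.
Qed.

Lemma measurable_taylor_bound : measurable_fun setT D.
Proof.
apply: measurable_funD; last by apply: measurable_funM => //; exact: measurable_amplitude.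
apply: measurable_sum => j; apply: measurable_funM => //.
by apply: measurableT_comp => //; exact: measurable_wave.
Qed.

Lemma taylor_bound_ge0 w : 0 <= D w.
Proof.
rewrite addr_ge0 ?mulr_ge0 ?amplitude_ge0// sumr_ge0// => j _.
by rewrite mulr_ge0// exprn_ge0// divr_ge0 ?(ltW h0)//.
Qed.

(** The mean of [|f j|] is at most [2 Om^j], and [h Om <= q^2] makes the terms geometric, with sum
    at most 32/15. Taking [J] as the number of frequencies lets [q^J] beat the mean of [amplitude],
    since [4 J <= 16^J]. *)
Lemma integral_taylor_bound : (\int[P]_w (D w)%:E <= 4%:E)%E.
Proof.
have geo : \sum_(j < J) q ^+ j <= 16 / 15.
  have e : (1 - q) * \sum_(j < J) q ^+ j = 1 - q ^+ J.
    elim: J => [|m IH]; first by rewrite big_ord0 mulr0 expr0 subrr.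
    by rewrite big_ord_recr /= mulrDr IH exprS; ring.
  have := qX0 J; move: (\sum_(j < J) _) (q ^+ J) e => S z; lra.
have mw j : measurable_fun setT (fun w => ((h / q) ^+ j * `|f j w t0|)%:E).
  apply/measurable_EFinP; apply: measurable_funM => //.
  by apply: measurableT_comp => //; exact: measurable_wave.
have hq0 j : 0 <= (h / q) ^+ j.
  by rewrite exprn_ge0// divr_ge0 ?(ltW h0)//.
have mA : measurable_fun setT (fun w => (q ^+ J * amplitude w)%:E).
  by apply/measurable_EFinP; apply: measurable_funM => //; exact: measurable_amplitude.
have intw j : (\int[P]_w ((h / q) ^+ j * `|f j w t0|)%:E <= (2 * q ^+ j)%:E)%E.
  under eq_integral do rewrite EFinM.
  rewrite ge0_integralZl//; last 2 first.
  - apply/measurable_EFinP; apply: measurableT_comp => //; exact: measurable_wave.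
  - by rewrite lee_fin.
  have hq0' : (0 <= ((h / q) ^+ j)%:E :> \bar R)%E by rewrite lee_fin.
  apply: (le_trans (lee_wpmul2l hq0' (integral_norm_lform mX indepX lawX us sA _))).
  rewrite -EFinM lee_fin mulrCA ler_wpM2l//.
  have := wave_coef_dot_le s0 Om0 om_le j t0.
  move=> /(ler_wpM2l (hq0 j)) /le_trans; apply.
  rewrite expr_div_n mulrAC -exprMn ler_pdivrMr ?exprn_gt0 ?invr_gt0//.
have intA : (\int[P]_w (q ^+ J * amplitude w)%:E <= 1%:E)%E.
  under eq_integral do rewrite /amplitude mulrA EFinM.
  have msum (r : seq I) : {in r, forall i, A i} ->
      measurable_fun setT (fun w => (\sum_(i <- r) (`|(X i w).1| + `|(X i w).2|))%:E) /\
      (\int[P]_w (\sum_(i <- r) (`|(X i w).1| + `|(X i w).2|))%:E =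
       \sum_(i <- r) \int[P]_w (`|(X i w).1| + `|(X i w).2|)%:E)%E.
    elim: r => [_|i r IH rA].
      split; first by under eq_fun do rewrite big_nil; exact: measurable_cst.
      by rewrite big_nil; under eq_integral do rewrite big_nil; rewrite integral0.
    have [|m e] := IH; first by move=> j jr; apply: rA; rewrite inE jr orbT.
    have mXi : measurable_fun setT (X i) by apply/mX/rA; rewrite mem_head.
    have mi : measurable_fun setT (fun w => (`|(X i w).1| + `|(X i w).2|)%:E).
      apply/measurable_EFinP; apply: measurable_funD; apply: measurableT_comp => //;
      exact: measurableT_comp.
    split.
      under eq_fun do rewrite big_cons EFinD; exact: emeasurable_funD.
    rewrite big_cons -e; under eq_integral do rewrite big_cons EFinD.
    rewrite ge0_integralD//.
    by move=> w _; rewrite lee_fin sumr_ge0// => j _; rewrite addr_ge0.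
  have [m e] := msum s sA.
  have c0 : 0 <= q ^+ J * nu by rewrite mulr_ge0.
  rewrite ge0_integralZl ?lee_fin//; last first.
    by move=> w _; rewrite lee_fin sumr_ge0// => j _; rewrite addr_ge0.
  rewrite e.
  apply: (@le_trans _ _ ((q ^+ J * nu)%:E * \sum_(i <- s) 4%:E)%E).
    apply: lee_wpmul2l; first by rewrite lee_fin.
    rewrite big_seq [leRHS]big_seq; apply: lee_sum => i is'.
    exact: (integral_coordinate mX indepX lawX us sA is').
  rewrite sumEFin -EFinM lee_fin big_const_seq count_predT iter_addr_0 -/J.
  have nu1 : nu <= 1.
    rewrite /wave_norm invf_le1 ?sqrtr_gt0 ?ltr0n// -[leLHS]sqrtr1 ler_wsqrtr//.
    by rewrite ler1n.
  have J4 : q ^+ J * (4 *+ J) <= 1.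
    have Jn : (4 * J <= 16 ^ J)%N.
      elim: J => // p IH; rewrite mulnS expnS (_ : 16 = 4 + 12)%N// mulnDl.
      by rewrite leq_add// ?(leq_trans IH) ?leq_pmull ?leq_pmulr ?expn_gt0.
    rewrite exprVn mulrC ler_pdivrMr ?exprn_gt0// mul1r -mulrnA -natrX.
    by rewrite ler_nat.
  apply: le_trans J4; rewrite mulrAC; rewrite -[leRHS]mulr1.
  by apply: ler_wpM2l => //; rewrite mulr_ge0// mulrn_wge0.
under eq_integral do rewrite EFinD -sumEFin.
have S0 w : setT w -> (0 <= \sum_(j < J) ((h / q) ^+ j * `|f j w t0|)%:E)%E.
  by move=> _; apply: sume_ge0 => j _; rewrite lee_fin mulr_ge0.
have A0 w : setT w -> (0 <= (q ^+ J * amplitude w)%:E)%E.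
  by move=> _; rewrite lee_fin mulr_ge0// amplitude_ge0.
rewrite (ge0_integralD _ measurableT S0 _ A0 mA); last first.
  by apply: emeasurable_sum => j _; exact: mw.
rewrite (ge0_integral_sum _ measurableT); last 2 first.
- by move=> j; exact: mw.
- by move=> j w _; rewrite lee_fin mulr_ge0.
apply: (@le_trans _ _ ((\sum_(j < J) 2 * q ^+ j)%:E + 1%:E)%E).
  by apply: leeD => //; rewrite -sumEFin; apply: lee_sum => j _; exact: intw.
rewrite -EFinD lee_fin -mulr_sumr.
by move: (\sum_(j < J) _) geo => S; lra.
Qed.

End block_moment.

(** * Sign changes along a grid *)

Section counting.
Context {R : realType} d (T : measurableType d) (P : probability T R).

Definition hits (A : nat -> set T) (n : nat) (w : T) : nat :=
  (\sum_(a < n) (w \in A a))%N.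

Lemma hits_indic A n w : (hits A n w)%:R = \sum_(a < n) \1_(A a) w :> R.
Proof. by rewrite natr_sum. Qed.

Lemma hits_le A n w : (hits A n w <= n)%N.
Proof.
rewrite -[leqRHS]card_ord -sum1_card; apply: leq_sum => a _; exact: leq_b1.
Qed.

Lemma measurable_hits A n : (forall a, measurable (A a)) ->
  measurable_fun setT (fun w => (hits A n w)%:R : R).
Proof.
move=> mA; under eq_fun do rewrite hits_indic.
by apply: measurable_sum => a; exact: measurable_indic.
Qed.

Lemma integral_hits_mul A B m n : (forall a, measurable (A a)) ->
  (forall b, measurable (B b)) ->
  (\int[P]_w ((hits A m w)%:R * (hits B n w)%:R)%:E =
   \sum_(a < m) \sum_(b < n) P (A a `&` B b))%E.
Proof.
move=> mA mB.
have e w : ((hits A m w)%:R * (hits B n w)%:R)%:E =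
    (\sum_(a < m) \sum_(b < n) (\1_(A a `&` B b) w)%:E)%E :> \bar R.
  rewrite !hits_indic mulr_suml -sumEFin; apply: eq_bigr => a _.
  rewrite mulr_sumr -sumEFin; apply: eq_bigr => b _; by rewrite indicI.
under eq_integral do rewrite e.
have mAB a b : measurable_fun setT (fun w => (\1_(A a `&` B b) w)%:E : \bar R).
  by apply/measurable_EFinP; apply: measurable_indic; exact: measurableI.
have AB0 a b w : setT w -> (0 <= (\1_(A a `&` B b) w)%:E :> \bar R)%E.
  by move=> _; rewrite lee_fin.
rewrite (ge0_integral_sum _ measurableT); last 2 first.
- by move=> a; apply: emeasurable_sum => b _; exact: mAB.
- by move=> a w _; apply: sume_ge0 => b _; exact: AB0.
apply: eq_bigr => a _; rewrite (ge0_integral_sum _ measurableT); last 2 first.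
- by move=> b; exact: mAB.
- by move=> b w; exact: AB0.
apply: eq_bigr => b _; rewrite integral_indic ?setIT//; exact: measurableI.
Qed.

Lemma integral_hits A n : (forall a, measurable (A a)) ->
  (\int[P]_w ((hits A n w)%:R%:E : \bar R) = \sum_(a < n) P (A a))%E.
Proof.
move=> mA; under eq_integral do rewrite hits_indic -sumEFin.
rewrite (ge0_integral_sum _ measurableT).
- by apply: eq_bigr => a _; rewrite integral_indic ?setIT.
- by move=> a; apply/measurable_EFinP; exact: measurable_indic.
- by move=> a w _; rewrite lee_fin.
Qed.

Lemma integral_hits_dev A n (q : R) : (forall a, measurable (A a)) ->
  (forall a, P (A a) = q%:E) ->
  (\int[P]_w (((hits A n w)%:R - n%:R * q) ^+ 2)%:E =
   (\sum_(a < n) \sum_(b < n) (fine (P (A a `&` A b)) - q ^+ 2))%:E)%E.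
Proof.
move=> mA PA; set e := n%:R * q; pose Y w := (hits A n w)%:R : R.
have q0 : 0 <= q by rewrite -lee_fin -(PA 0%N).
have e0 : 0 <= e by rewrite mulr_ge0.
have mY : measurable_fun setT Y by exact: measurable_hits.
have intY : (\int[P]_w (Y w)%:E = e%:E)%E.
  rewrite integral_hits//; under eq_bigr do rewrite PA.
  by rewrite sumEFin sumr_const card_ord -mulr_natl.
have intYY := integral_hits_mul n n mA mA.
have {}intYY : (\int[P]_w (Y w * Y w)%:E =
    (\sum_(a < n) \sum_(b < n) fine (P (A a `&` A b)))%:E)%E.
  rewrite intYY -sumEFin; apply: eq_bigr => a _; rewrite -sumEFin.
  apply: eq_bigr => b _; rewrite fineK// fin_num_measure//; exact: measurableI.
have mD : measurable_fun setT (fun w => ((Y w - e) ^+ 2)%:E).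
  by apply/measurable_EFinP; apply: measurable_funX; exact: measurable_funB.
have mC : measurable_fun setT (fun w => (2 * e)%:E * (Y w)%:E)%E.
  by apply: measurable_funeM; apply/measurable_EFinP.
have C0 w : setT w -> (0 <= (2 * e)%:E * (Y w)%:E)%E.
  by move=> _; rewrite mule_ge0 ?lee_fin ?mulr_ge0.
have D0 w : setT w -> (0 <= ((Y w - e) ^+ 2)%:E)%E by move=> _; rewrite lee_fin sqr_ge0.
have YY0 w : setT w -> (0 <= (Y w * Y w)%:E)%E by move=> _; rewrite lee_fin mulr_ge0.
have mYY : measurable_fun setT (fun w => (Y w * Y w)%:E).
  by apply/measurable_EFinP; exact: measurable_funM.
(* The identity is written with the cross term moved to the left, so that every integrand is
   nonnegative. *)
have key : (\int[P]_w ((Y w - e) ^+ 2)%:E + (2 * e ^+ 2)%:E =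
    (\sum_(a < n) \sum_(b < n) fine (P (A a `&` A b)) + e ^+ 2)%:E)%E.
  have -> : (2 * e ^+ 2)%:E = (\int[P]_w ((2 * e)%:E * (Y w)%:E))%E.
    have mYE : measurable_fun setT (fun w => (Y w)%:E) by apply/measurable_EFinP.
    have Y0 w : setT w -> (0 <= (Y w)%:E)%E by move=> _; rewrite lee_fin.
    have e20 : (0 <= (2 * e)%:E)%E by rewrite lee_fin mulr_ge0.
    rewrite (ge0_integralZl _ measurableT mYE Y0 e20).
    by rewrite intY -EFinM expr2 mulrA.
  rewrite -(ge0_integralD _ measurableT D0 mD C0 mC).
  have -> : (\int[P]_w (((Y w - e) ^+ 2)%:E + (2 * e)%:E * (Y w)%:E) =
      \int[P]_w ((Y w * Y w)%:E + cst (e ^+ 2)%:E w))%E.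
    by apply: eq_integral => w _ /=; rewrite -EFinM -!EFinD; congr EFin; ring.
  rewrite ge0_integralD//; last by move=> w _; rewrite lee_fin sqr_ge0.
  have PT : ((e ^+ 2)%:E * P setT = (e ^+ 2)%:E)%E by rewrite probability_setT mule1.
  by rewrite integral_cst// intYY EFinD; congr (_ + _)%E; exact: PT.
have -> : \sum_(a < n) \sum_(b < n) (fine (P (A a `&` A b)) - q ^+ 2) =
    \sum_(a < n) \sum_(b < n) fine (P (A a `&` A b)) - e ^+ 2.
  rewrite -[e ^+ 2]opprK -[RHS]/(_ - _).
  under eq_bigr do rewrite sumrB sumr_const card_ord.
  rewrite sumrB sumr_const card_ord opprK /e exprMn -mulrnA -[in LHS]mulr_natl natrM.
  by rewrite expr2.
move: key; move: (\int[P]_w _)%E => [x| |]//.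
by rewrite -EFinD => -[h]; congr EFin; lra.
Qed.

Lemma sqr_sum_odd n c : (n <= c)%N -> (n * n = \sum_(k < c) (k < n) * k.*2.+1)%N.
Proof.
move=> nc; rewrite -(subnKC nc) big_split_ord /= [X in (_ + X)%N]big1; last first.
  by move=> k _; rewrite ltnNge leq_addr.
rewrite addn0; under eq_bigr do rewrite ltn_ord mul1n.
elim: n {nc} => [|n IH]; first by rewrite big_ord0.
by rewrite big_ord_recr /= -IH -mul2n; ring.
Qed.

(** The square of an integer is a sum of consecutive odd numbers, which turns the second moment into
    the tail sum of [(2k + 1) P(k < hits)]; then [2k + 1 <= 2^(k+1)] leaves 6 times a geometric
    series of sum at most 1. *)
Lemma hits_second_moment A c : (forall a, measurable (A a)) ->
  (forall k, P [set w | (k <= hits A c w)%N] <= (6 * 4^-1 ^+ k)%:E)%E ->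
  (\sum_(a < c) \sum_(b < c) P (A a `&` A b) <= 6%:E)%E.
Proof.
move=> mA tailA.
have mk k : measurable [set w | (k <= hits A c w)%N].
  rewrite (_ : [set w | _] = (fun w => (hits A c w)%:R : R) @^-1` `[k%:R, +oo[).
    by rewrite -[X in measurable X]setTI; apply: measurable_hits => //; exact: measurable_itv.
  by apply/seteqP; split => w /=; rewrite in_itv/= andbT ler_nat.
rewrite -integral_hits_mul//.
have e w : ((hits A c w)%:R * (hits A c w)%:R)%:E =
    (\sum_(k < c) (k.*2.+1)%:R%:E * (\1_[set w | (k < hits A c w)%N] w)%:E)%E :> \bar R.
  rewrite -natrM (sqr_sum_odd (hits_le A c w)) natr_sum -sumEFin.
  apply: eq_bigr => k _; rewrite natrM mulrC -EFinM; congr (_ * _)%:E.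
  rewrite indicE; congr (nat_of_bool _)%:R.
  by apply/idP/idP => [h|/set_mem//]; exact: mem_set.
under eq_integral do rewrite e.
have m1 (k : nat) : measurable_fun setT
    (fun w => (\1_[set w | (k < hits A c w)%N] w)%:E : \bar R).
  by apply/measurable_EFinP; exact: measurable_indic.
have p0 (k : nat) w : setT w ->
    (0 <= (\1_[set w | (k < hits A c w)%N] w)%:E :> \bar R)%E.
  by move=> _; rewrite lee_fin.
rewrite (ge0_integral_sum _ measurableT); last 2 first.
- by move=> k; apply: measurable_funeM; exact: m1.
- by move=> k w h; apply: mule_ge0; [rewrite lee_fin | exact: p0].
apply: (@le_trans _ _ (\sum_(k < c) (6 * 2^-1 ^+ k.+1)%:E)%E); last first.
  rewrite sumEFin lee_fin -mulr_sumr -[leRHS]mulr1 ler_wpM2l//.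
  have -> : \sum_(k < c) 2^-1 ^+ k.+1 = 1 - 2^-1 ^+ c :> R.
    elim: c {mA tailA mk e m1 p0} => [|n IH]; first by rewrite big_ord0 expr0 subrr.
    by rewrite big_ord_recr /= IH exprS; field.
  by rewrite gerBl exprn_ge0// invr_ge0.
apply: lee_sum => k _.
rewrite ge0_integralZl//; last first.
rewrite integral_indic ?setIT//.
apply: (@le_trans _ _ ((k.*2.+1)%:R%:E * (6 * 4^-1 ^+ k.+1)%:E)%E).
  by apply: lee_wpmul2l; [rewrite lee_fin | exact: tailA].
rewrite -EFinM lee_fin mulrCA ler_wpM2l//.
have -> : 4^-1 ^+ k.+1 = 2^-1 ^+ k.+1 * 2^-1 ^+ k.+1 :> R.
  by rewrite -exprMn -invfM -natrM.
rewrite mulrA -[leRHS]mul1r ler_wpM2r ?exprn_ge0 ?invr_ge0//.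
rewrite exprVn ler_pdivrMr ?exprn_gt0// mul1r -natrX ler_nat.
elim: (nat_of_ord k) => // n IH; rewrite doubleS expnS.
apply: (@leq_trans (n.*2.+1 + 2)); first by rewrite addn2.
by rewrite mul2n -[leqRHS]addnn leq_add// expnS leq_pmulr ?expn_gt0.
Qed.

End counting.

(** * Events of sign change, cones and flat cells *)

Section events.
Context {R : realType} d (T : measurableType d) (P : probability T R).
Context {I : choiceType} (A : set I) (X : I -> T -> R * R) (s : seq I).
Hypothesis mX : forall i, A i -> measurable_fun setT (X i).
Hypothesis indepX : mutually_independent P A X.
Hypothesis lawX : forall i, A i -> forall B, measurable B ->
  P (X i @^-1` B) = gauss2 B.
Hypotheses (us : uniq s) (sA : {in s, forall i, A i}).
Variables (om : I -> R) (Om : R).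
Hypotheses (s0 : (0 < size s)%N) (Om0 : 0 < Om).
Hypothesis om_le : forall i, i \in s -> `|om i| <= Om.
Hypothesis om_sq : (size s)%:R * Om ^+ 2 / 2 <= \sum_(i <- s) om i ^+ 2.
Local Notation f := (wave X s om).

Definition change_event (t t' : R) : set T := [set w | sign_change (f 0 w) t t'].

Lemma measurable_negative t : measurable [set w | f 0 w t < 0].
Proof.
rewrite (_ : [set w | _] = (fun w => f 0 w t) @^-1` `]-oo, 0[); last first.
  by apply/seteqP; split => w /=; rewrite in_itv.
rewrite -[X in measurable X]setTI; apply: (measurable_wave mX sA om 0 t) => //.
Qed.

Lemma measurable_change_event t t' : measurable (change_event t t').
Proof.
have m := measurable_negative.
rewrite (_ : change_event t t' =
  ([set w | f 0 w t < 0] `\` [set w | f 0 w t' < 0]) `|`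
  ([set w | f 0 w t' < 0] `\` [set w | f 0 w t < 0])); last first.
  apply/seteqP; split => w; rewrite /change_event /sign_change /=.
    by case: (f 0 w t < 0); case: (f 0 w t' < 0) => // _; [left | right]; split.
  by case: (f 0 w t < 0); case: (f 0 w t' < 0) => // -[[]|[]].
by apply: measurableU; exact: measurableD.
Qed.

Lemma probability_wave_le t (e : R) : 0 <= e ->
  (P [set w | (`|f 0 w t| <= e)%R] <= (2 * e)%:E)%E.
Proof.
by apply: (probability_lform_le mX indepX lawX us sA); exact: wave_coef0_dot.
Qed.

Lemma measurable_wave_le t (e : R) : measurable [set w | `|f 0 w t| <= e].
Proof.
rewrite (_ : [set w | _] = (fun w => `|f 0 w t|) @^-1` `]-oo, e]); last first.
  by apply/seteqP; split => w /=; rewrite in_itv.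
rewrite -[X in measurable X]setTI.
by apply: (measurableT_comp (@normr_measurable _ _) (measurable_wave mX sA om 0 t)).
Qed.

Section pair.
Variable eta : R.
Hypotheses (eta0 : 0 < eta) (etaOm : eta * Om <= 1 / 2).
Local Notation U := (sum_coef s om eta).
Local Notation V := (diff_coef s om eta).
Local Notation k := (slope s om eta).
Local Notation D1 := (cos_weight s om eta).
Local Notation D2 := (sin_weight s om eta).

Definition strip_event t : set T :=
  [set w | strip k (lform X s (U t) w, lform X s (V t) w)].

(** The normalisations cancel against [slope]. The resulting inequality says that the product of the
    two values is at most 0. *)
Lemma strip_eventE t : strip_event t =
  [set w | `|f 0 w t + f 0 w (t + eta)| <= `|f 0 w (t + eta) - f 0 w t|].
Proof.
have d1 : 0 < D1 by apply: lt_le_trans (cos_weight_ge s0 om_le eta0 etaOm).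
have d2 := sin_weight_gt0 s0 Om0 om_le om_sq eta0 etaOm.
have s1 : 0 < Num.sqrt D1 by rewrite sqrtr_gt0.
have s2 : 0 < Num.sqrt D2 by rewrite sqrtr_gt0.
apply/funext => w; rewrite /strip_event /strip /=; congr is_true.
rewrite (lform_sum_coef _ s0 om_le eta0 etaOm).
rewrite (lform_diff_coef _ s0 Om0 om_le om_sq eta0 etaOm) !normrM !normfV (gtr0_norm s1) (gtr0_norm s2).
rewrite /slope mulrAC mulrCA mulfV ?gt_eqF// mulr1 ler_pM2r ?invr_gt0//.
Qed.

Lemma measurable_strip_event t : measurable (strip_event t).
Proof.
have m : measurable_fun setT (fun w => (lform X s (U t) w, lform X s (V t) w)).
  exact: (measurable_fun_pair (measurable_lform mX sA _) (measurable_lform mX sA _)).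
rewrite (_ : strip_event t = setT `&` (fun w => (lform X s (U t) w, lform X s (V t) w))
  @^-1` strip k); first by apply: m => //; exact: measurable_strip.
by rewrite setTI.
Qed.

Lemma change_event_sub_strip t : change_event t (t + eta) `<=` strip_event t.
Proof.
rewrite strip_eventE => w; rewrite /change_event /sign_change /=.
move: (f 0 w t) (f 0 w (t + eta)) => x y.
have [x0|x0] := ltP x 0; have [y0|y0] := ltP y 0 => // _.
  by rewrite (ger0_norm (_ : 0 <= y - x)) ?ler_norml; lra.
by rewrite (ler0_norm (_ : y - x <= 0)) ?ler_norml; lra.
Qed.

Lemma probability_strip_event t : P (strip_event t) = gauss2 (strip k).
Proof.
apply: (probability_lform2 mX indepX lawX us sA).
- exact: measurable_strip.
- exact: (dot_sum1 s0 om_le eta0 etaOm).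
- exact: (dot_sum_diff0 s0 Om0 om_le om_sq eta0 etaOm).
- exact: (dot_diff1 s0 Om0 om_le om_sq eta0 etaOm).
Qed.

(** The cone and the sign change differ only when [f] vanishes at an end of the cell, a null
    event. *)
Lemma probability_change_event t : P (change_event t (t + eta)) = gauss2 (strip k).
Proof.
rewrite -(probability_strip_event t); apply/eqP; rewrite eq_le; apply/andP; split.
  apply: le_measure; rewrite ?inE; [exact: measurable_change_event| |].
    exact: measurable_strip_event.
  exact: change_event_sub_strip.
pose Z u := [set w | `|f 0 w u| <= 0].
have Z0 u : P (Z u) = 0%E.
  apply/eqP; rewrite eq_le measure_ge0 andbT.
  by have := @probability_wave_le u 0 (lexx _); rewrite mulr0.
have mZ u : measurable (Z u) by exact: measurable_wave_le.
have mC := measurable_change_event t (t + eta).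
apply: (@le_trans _ _ (P (change_event t (t + eta) `|` (Z t `|` Z (t + eta))))).
  apply: le_measure; rewrite ?inE; [exact: measurable_strip_event| |].
    by apply: measurableU => //; exact: measurableU.
  rewrite strip_eventE => w; rewrite /change_event /Z /sign_change /= !normr_le0.
  move: (f 0 w t) (f 0 w (t + eta)) => x y.
  have [->|x0] := eqVneq x 0; first by right; left.
  have [->|y0] := eqVneq y 0; first by right; right.
  move=> h; left; move: h x0 y0.
  have [x0|x0] := ltP x 0; have [y0|y0] := ltP y 0 => // h x1 y1; exfalso.
    move: h; rewrite (ler0_norm (_ : x + y <= 0)) ?ler_normr; lra.
  have x2 : 0 < x by rewrite lt_neqAle eq_sym x1.
  have y2 : 0 < y by rewrite lt_neqAle eq_sym y1.
  move: h; rewrite (ger0_norm (_ : 0 <= x + y)) ?ler_normr; lra.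
apply: (le_trans (measureU2 _ mC (measurableU _ _ (mZ t) (mZ (t + eta))))).
rewrite -[leRHS]adde0 leeD2l//.
apply: (le_trans (measureU2 _ (mZ t) (mZ (t + eta)))).
have l u : (P (Z u) <= 0)%E by rewrite Z0.
by have := leeD (l t) (l (t + eta)); rewrite adde0.
Qed.

Definition corr_small (tau : R) : Prop :=
  [/\ `|cos_corr s om (weight11 s om eta) tau| <= 32^-1,
      `|sin_corr s om (weight12 s om eta) tau| <= 32^-1 &
      `|cos_corr s om (weight22 s om eta) tau| <= 32^-1].

(** The sum of the squared entries of the cross correlation matrix of the two pairs; its two mixed
    entries are opposite, hence the repeated sine term. *)
Definition corr_sqr_norm (tau : R) : R :=
  cos_corr s om (weight11 s om eta) tau ^+ 2 + sin_corr s om (weight12 s om eta) tau ^+ 2 +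
  sin_corr s om (weight12 s om eta) tau ^+ 2 + cos_corr s om (weight22 s om eta) tau ^+ 2.

Lemma corr_sqr_norm_ge0 tau : 0 <= corr_sqr_norm tau.
Proof. by rewrite !addr_ge0 ?sqr_ge0. Qed.

Lemma probability_change_pair t t' : corr_small (t - t') ->
  (P (change_event t (t + eta) `&` change_event t' (t' + eta)) <=
   gauss2 (strip k) * gauss2 (strip k) +
   (3200 * corr_sqr_norm (t - t') * k ^+ 2)%:E)%E.
Proof.
move=> [h1 h2 h3].
have e11 := dot_sum_sum s0 om_le eta0 etaOm t t'.
have e12 := dot_sum_diff s0 Om0 om_le om_sq eta0 etaOm t t'.
have e21 := dot_diff_sum s0 Om0 om_le om_sq eta0 etaOm t t'.
have e22 := dot_diff_diff s0 Om0 om_le om_sq eta0 etaOm t t'.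
apply: (@le_trans _ _ (P (strip_event t `&` strip_event t'))).
  apply: le_measure; rewrite ?inE.
  - by apply: measurableI; exact: measurable_change_event.
  - by apply: measurableI; exact: measurable_strip_event.
  - by apply: setISS; exact: change_event_sub_strip.
have := probability_strips mX indepX lawX us sA (slope_ge0 s om eta)
  (dot_sum1 s0 om_le eta0 etaOm t)
  (dot_sum_diff0 s0 Om0 om_le om_sq eta0 etaOm t)
  (dot_diff1 s0 Om0 om_le om_sq eta0 etaOm t)
  (dot_sum1 s0 om_le eta0 etaOm t')
  (dot_sum_diff0 s0 Om0 om_le om_sq eta0 etaOm t')
  (dot_diff1 s0 Om0 om_le om_sq eta0 etaOm t').
by rewrite e11 e12 e21 e22 normrN sqrrN => /(_ h1 h2 h2 h3).
Qed.

(** Otherwise all correlations at [tau'] would be below 1/64, as [4096 = 64^2], and the Lipschitz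
    bound would leave them below [1/64 + 1/64 = 1/32] at [tau]. *)
Lemma corr_sqr_norm_ge tau tau' : ~ corr_small tau ->
  4 * Om * `|tau - tau'| <= 64^-1 -> 4096^-1 <= corr_sqr_norm tau'.
Proof.
move=> ns lip; rewrite leNgt; apply/negP => lt; apply: ns.
have key u v u' : `|u - v| <= 4 * Om * `|tau - tau'| -> corr_sqr_norm tau' = v ^+ 2 + u' ->
    0 <= u' -> `|u| <= 32^-1 :> R.
  move=> h e u'0.
  have v2 : v ^+ 2 <= 64^-1 ^+ 2.
    rewrite exprVn -natrX; apply: le_trans (ltW lt); rewrite e; lra.
  have v1 : `|v| <= 64^-1 by rewrite -(@ler_pXn2r _ 2) ?nnegrE// real_normK ?num_real.
  apply: (le_trans (_ : _ <= `|u - v| + `|v|)); last lra.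
  by rewrite -[in leLHS](subrK v u) ler_normD.
split.
- apply: (key _ _ _ (cos_corr_lipschitz s0 om_le (weight11_le s0 om_le eta0 etaOm) tau tau')).
    by rewrite /corr_sqr_norm -!addrA.
  by rewrite !addr_ge0 ?sqr_ge0.
- apply: (key _ _ _ (sin_corr_lipschitz s0 om_le
    (weight12_le s0 Om0 om_le om_sq eta0 etaOm) tau tau')).
    by rewrite /corr_sqr_norm addrAC addrC.
  by rewrite !addr_ge0 ?sqr_ge0.
- apply: (key _ _ _ (cos_corr_lipschitz s0 om_le
    (weight22_le s0 Om0 om_le om_sq eta0 etaOm) tau tau')).
    by rewrite /corr_sqr_norm addrC.
  by rewrite !addr_ge0 ?sqr_ge0.
Qed.

(* Since [f 2] is bounded, a cell with two zeros is flat at both ends. *)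
Definition flat_event (M t : R) : set T :=
  [set w | `|f 0 w t| <= M * eta ^+ 2] `&` [set w | `|f 0 w (t + eta)| <= M * eta ^+ 2].

Lemma measurable_flat_event M t : measurable (flat_event M t).
Proof. by apply: measurableI; exact: measurable_wave_le. Qed.

(** Flatness confines both normalised variables: [U] to order [eta^2] and [V], divided by a quantity
    of order [eta Om], to order [eta / Om]. Independence multiplies the two, and the order [eta^3]
    outweighs the number of cells, of order [1 / eta]. *)
Lemma probability_flat_event M t : 0 <= M ->
  (P (flat_event M t) <= (32 * M ^+ 2 * eta ^+ 3 / Om)%:E)%E.
Proof.
move=> M0.
have d1 := cos_weight_ge s0 om_le eta0 etaOm.
have d2 := sin_weight_ge s0 om_le om_sq eta0 etaOm.
have r1 : 1 <= Num.sqrt D1 by rewrite -[leLHS]sqrtr1 ler_wsqrtr//; lra.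
have eO : 0 < eta * Om by rewrite mulr_gt0.
have r2 : eta * Om / 2 <= Num.sqrt D2.
  rewrite -(ler_pXn2r (n := 2))// ?nnegrE ?divr_ge0 ?(ltW eO)// sqr_sqrtr.
    by apply: le_trans d2; rewrite expr_div_n exprMn -natrX.
  by apply: le_trans d2; rewrite divr_ge0// mulr_ge0// sqr_ge0.
pose al := 2 * (M * eta ^+ 2); pose be := 4 * M * eta / Om.
have al0 : 0 <= al by rewrite mulr_ge0// mulr_ge0 ?sqr_ge0.
have be0 : 0 <= be by rewrite divr_ge0 ?(ltW Om0)// !mulr_ge0// ltW.
pose J (e : R) := [set` `[- e, e]] : set R.
have mJ e : measurable (J e) by exact: measurable_itv.
pose B := J al `*` J be.
have mB : measurable B by exact: measurableX.
have gJ e : 0 <= e -> (gauss (J e) <= (2 * e)%:E)%E.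
  move=> e0; have := integral_gauss_itv e0; rewrite integral_indic ?setIT//.
have gB : (gauss2 B <= (2 * al)%:E * (2 * be)%:E)%E.
  rewrite (_ : gauss2 B = gauss (J al) * gauss (J be))%E; last exact: product_measure1E.
  by apply: lee_pmul => //; exact: gJ.
have lawB := probability_lform2 mX indepX lawX us sA mB (dot_sum1 s0 om_le eta0 etaOm t)
  (dot_sum_diff0 s0 Om0 om_le om_sq eta0 etaOm t)
  (dot_diff1 s0 Om0 om_le om_sq eta0 etaOm t).
have mS : measurable [set w | B (lform X s (U t) w, lform X s (V t) w)].
  have m : measurable_fun setT (fun w => (lform X s (U t) w, lform X s (V t) w)).
    exact: (measurable_fun_pair (measurable_lform mX sA _) (measurable_lform mX sA _)).
  by rewrite -[X in measurable X]setTI; apply: m.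
apply: (@le_trans _ _ ((2 * al)%:E * (2 * be)%:E)%E); last first.
  rewrite -EFinM lee_fin le_eqVlt; apply/orP; left; apply/eqP; rewrite /al /be.
  by field; rewrite gt_eqF.
apply: le_trans gB; rewrite -lawB; apply: le_measure; rewrite ?inE//.
  exact: measurable_flat_event.
move=> w; rewrite /flat_event /B /J /= !in_itv/= -!ler_norml.
rewrite (lform_sum_coef _ s0 om_le eta0 etaOm).
rewrite (lform_diff_coef _ s0 Om0 om_le om_sq eta0 etaOm) !normrM !normfV.
have p1 : 0 < Num.sqrt D1 by lra.
have p2 : 0 < Num.sqrt D2 by lra.
rewrite (gtr0_norm p1) (gtr0_norm p2) => -[hx hy]; split.
  rewrite ler_pdivrMr//; apply: (le_trans (ler_normD _ _)).
  rewrite -[leLHS]mulr1; apply: ler_pM => //.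
  by rewrite /al; lra.
rewrite ler_pdivrMr//; apply: (le_trans (ler_normB _ _)).
apply: (@le_trans _ _ (be * (eta * Om / 2))); last by rewrite ler_wpM2l.
have -> : be * (eta * Om / 2) = 2 * (M * eta ^+ 2) by rewrite /be; field; rewrite gt_eqF.
lra.
Qed.

End pair.
End events.

Lemma big_blocks (V : nmodType) (F : nat -> V) K c :
  \sum_(a < K * c) F a = \sum_(i < K) \sum_(r < c) F (i * c + r)%N.
Proof.
elim: K => [|K IH]; first by rewrite mul0n !big_ord0.
by rewrite mulSnr big_split_ord /= IH big_ord_recr.
Qed.

(** * Blocks of cells and the variance of the count *)

Section grid.
Context {R : realType} d (T : measurableType d) (P : probability T R).
Context {I : choiceType} (A : set I) (X : I -> T -> R * R) (s : seq I).
Hypothesis mX : forall i, A i -> measurable_fun setT (X i).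
Hypothesis indepX : mutually_independent P A X.
Hypothesis lawX : forall i, A i -> forall B, measurable B ->
  P (X i @^-1` B) = gauss2 B.
Hypotheses (us : uniq s) (sA : {in s, forall i, A i}).
Variables (om : I -> R) (Om : R).
Hypotheses (s0 : (0 < size s)%N) (Om0 : 0 < Om).
Hypothesis om_le : forall i, i \in s -> `|om i| <= Om.
Hypothesis om_sq : (size s)%:R * Om ^+ 2 / 2 <= \sum_(i <- s) om i ^+ 2.
Local Notation f := (wave X s om).
Variable eta : R.
Hypothesis eta0 : 0 < eta.

Definition cell_event (a : nat) : set T :=
  change_event X s om (a%:R * eta) (a.+1%:R * eta).

Lemma measurable_cell_event a : measurable (cell_event a).
Proof. exact: (measurable_change_event mX sA). Qed.

Lemma hits_cell_event a c w : hits (fun r => cell_event (a + r)) c w =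
  (\sum_(r < c) sign_change (f 0 w) ((a + r)%:R * eta) ((a + r).+1%:R * eta))%N.
Proof.
apply: eq_bigr => r _; congr nat_of_bool.
by apply/idP/idP => [/set_mem//|h]; exact: mem_set.
Qed.

Section block.
Variable c : nat.
Hypotheses (c0 : (0 < c)%N) (cOm : c%:R * eta * Om <= 256^-1).
Let h := c%:R * eta.
Let h0 : 0 < h. Proof. by rewrite mulr_gt0// ltr0n. Qed.

(** With [k] sign changes in the block, [|f|] is at most [h^k] times the supremum of the [k]-th
    derivative, and [taylor_bound] controls that product by [16^-k D] for the random order [k] as
    well. *)
Lemma wave_le_hits a w :
  `|f 0 w (a%:R * eta)| <=
  16^-1 ^+ hits (fun r => cell_event (a + r)) c w * taylor_bound X s om (a%:R * eta) h w.
Proof.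
set t0 := a%:R * eta; set D := taylor_bound _ _ _ _ _ _.
pose g (r : nat) := (a + r)%:R * eta.
have gS r : g r < g r.+1 by rewrite /g ltr_pM2r// ltr_nat addnS.
have [x [xs [px sx ax _]]] := alternates_grid (f 0 w) c gS.
have {}sx : size xs = hits (fun r => cell_event (a + r)) c w.
  by rewrite sx hits_cell_event; apply: eq_bigr => r _; rewrite /g addnS.
have g0 : g 0%N = t0 by rewrite /g addn0.
have gc : g c = t0 + h by rewrite /g natrD mulrDl.
rewrite g0 gc in ax.
set k := hits _ _ _ in sx *.
have hk : 0 < h ^+ k by rewrite exprn_gt0.
have b t : t0 <= t <= t0 + h -> `|f k w t| <= 16^-1 ^+ k * D / h ^+ k.
  move=> tin; rewrite ler_pdivlMr// mulrC.
exact: (wave_le_taylor_bound X Om0 om_le h0 cOm k w tin).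
have tin : t0 <= t0 <= t0 + h by rewrite lexx lerDl ltW.
have := alternates_bound (fun j x => is_derive_wave X s om j w x) b sx px ax tin.
by rewrite addrAC subrr add0r mulrC divfK// gt_eqF.
Qed.

(* Many sign changes in a short block require that [f] is tiny or that
   [taylor_bound] is huge. *)
Lemma block_second_moment a :
  (\sum_(r < c) \sum_(r' < c) P (cell_event (a + r) `&` cell_event (a + r')) <= 6%:E)%E.
Proof.
apply: (hits_second_moment (A := fun r => cell_event (a + r))).
  by move=> r; exact: measurable_cell_event.
move=> k; set t0 := a%:R * eta; pose D := taylor_bound X s om t0 h.
have mD : measurable_fun setT D by exact: (measurable_taylor_bound mX sA).
pose S := [set w | 4 ^+ k <= D w].
have mS : measurable S.
  rewrite (_ : S = setT `&` D @^-1` `[4 ^+ k, +oo[); first by apply: mD.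
  by rewrite setTI; apply/seteqP; split => w /=; rewrite /S /= in_itv/= andbT.
have k0 : 0 < 4 ^+ k :> R by rewrite exprn_gt0.
have PS : (P S <= (4 * 4^-1 ^+ k)%:E)%E.
  have : ((4 ^+ k)%:E * P S <= 4%:E)%E.
    apply: le_trans (integral_taylor_bound mX indepX lawX us sA s0 Om0 om_le t0 h0 cOm).
    rewrite -(setIT S) -(integral_indic P measurableT mS).
    rewrite -(ge0_integralZl _ measurableT) ?lee_fin ?(ltW k0)//; last first.
      by apply/measurable_EFinP; exact: measurable_indic.
    apply: ge0_le_integral => //.
    - by apply: measurable_funeM; apply/measurable_EFinP; exact: measurable_indic.
    - by apply/measurable_EFinP.
    move=> w _; rewrite -EFinM lee_fin indicE.
    case: (boolP (w \in S)) => [/set_mem wS|_]; first by rewrite mulr1.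
    rewrite mulr0; exact: (taylor_bound_ge0 X s om t0 h0).
  rewrite -(@fineK _ (P S)) ?fin_num_measure// -EFinM !lee_fin mulrC exprVn.
  by rewrite ler_pdivlMr.
have PW := probability_wave_le mX indepX lawX us sA om s0 t0 (_ : 0 <= 4^-1 ^+ k).
have {}PW : (P [set w | (`|f 0 w t0| <= 4^-1 ^+ k)%R] <= (2 * 4^-1 ^+ k)%:E)%E.
  by apply: PW; rewrite exprn_ge0// invr_ge0.
have mW : measurable [set w | (`|f 0 w t0| <= 4^-1 ^+ k)%R] by exact: (measurable_wave_le mX sA).
apply: (@le_trans _ _ (P ([set w | (`|f 0 w t0| <= 4^-1 ^+ k)%R] `|` S))).
  apply: le_measure; rewrite ?inE; last 1 first.
  - move=> w /= kh; rewrite /S /=.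
    have := wave_le_hits a w; set N := hits _ _ _; rewrite -/t0 -/(D w) => b.
    have [|Dw] := leP (4 ^+ k) (D w); [by right | left].
    have D0 : 0 <= D w by exact: (taylor_bound_ge0 X s om t0 h0).
    (* At least [k] hits and [D < 4^k] give [|f| <= 16^-k 4^k = 4^-k], so both exceptional events
       have probability of order [4^-k]. *)
    apply: (le_trans b); apply: (@le_trans _ _ (16^-1 ^+ k * 4 ^+ k)).
      apply: ler_pM => //; last exact: ltW.
      by apply: ler_wiXn2l => //; rewrite invf_le1// ler1n.
    have -> : 16^-1 = 4^-1 * 4^-1 :> R by rewrite -invfM -natrM.
    by rewrite exprMn -mulrA -exprMn mulVf// expr1n mulr1.
  - rewrite (_ : [set w | _] = (fun w => (hits (fun r => cell_event (a + r)) c w)%:R : R)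
      @^-1` `[k%:R, +oo[).
      rewrite -[X in measurable X]setTI; apply: measurable_hits => //.
      by move=> r; exact: measurable_cell_event.
    by apply/seteqP; split => w /=; rewrite in_itv/= andbT ler_nat.
  - exact: measurableU.
apply: (le_trans (measureU2 _ mW mS)); apply: (le_trans (leeD PW PS)).
by rewrite -EFinD lee_fin -mulrDl; lra.
Qed.

End block.

Section variance.
Variables (K c : nat) (L B : R).
Hypotheses (K0 : (0 < K)%N) (c0 : (0 < c)%N) (L0 : 0 < L).
Hypotheses (etaE : eta = L / (K * c)%:R) (KOm : L / K%:R * Om <= 512^-1).
Hypothesis sepB :
  forall i, i \in s -> \sum_(j <- s) (1 + (om i - om j) ^+ 2)^-1 <= B.

Definition joint (a b : nat) : R := fine (P (cell_event a `&` cell_event b)).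
Definition cell_probability : R := fine (gauss2 (strip (slope s om eta))).
Local Notation g := cell_probability.
Let rho (a b : nat) : R := corr_sqr_norm s om eta (a%:R * eta - b%:R * eta).

Let mA a := measurable_cell_event a.

Let jointE a b : P (cell_event a `&` cell_event b) = (joint a b)%:E.
Proof. by rewrite fineK// fin_num_measure//; exact: measurableI. Qed.

Let gE : gauss2 (strip (slope s om eta)) = g%:E.
Proof. by rewrite fineK// fin_num_measure//; exact: measurable_strip. Qed.

Lemma probability_cell_event a : eta * Om <= 1 / 2 -> P (cell_event a) = g%:E.
Proof.
move=> etaOm; rewrite -gE.
have e : a.+1%:R * eta = a%:R * eta + eta by rewrite -natr1 mulrDl mul1r.
rewrite /cell_event e.
exact: (probability_change_event mX indepX lawX us sA s0 Om0 om_le om_sq eta0 etaOm).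
Qed.

Let cn0 : c%:R != 0 :> R. Proof. by rewrite pnatr_eq0 -lt0n. Qed.
Let Kn0 : K%:R != 0 :> R. Proof. by rewrite pnatr_eq0 -lt0n. Qed.
Let blockE : c%:R * eta = L / K%:R.
Proof. by rewrite etaE natrM; field; rewrite cn0 Kn0. Qed.
Let cOm : c%:R * eta * Om <= 512^-1. Proof. by rewrite blockE. Qed.
Let etaOm' : eta * Om <= 512^-1.
Proof.
apply: le_trans cOm; rewrite -mulrA ler_peMl ?ler1n// ltW// mulr_gt0//.
Qed.
Let etaOm : eta * Om <= 1 / 2. Proof. by move: etaOm'; lra. Qed.

(** Two distinct blocks reduce to the second moments of each of them through
    [2 u v <= u^2 + v^2]. *)
Lemma block_pair_moment a b :
  \sum_(r < c) \sum_(r' < c) joint (a + r) (b + r') <= 6.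
Proof.
rewrite -lee_fin -sumEFin; under eq_bigr do rewrite -sumEFin.
under eq_bigr do under eq_bigr do rewrite -jointE.
have cOm2 : c%:R * eta * Om <= 256^-1 by move: cOm; lra.
have ma r : measurable (cell_event (a + r)) by exact: mA.
have mb r : measurable (cell_event (b + r)) by exact: mA.
rewrite -(integral_hits_mul P c c ma mb).
have ha := block_second_moment c0 cOm2 a; have hb := block_second_moment c0 cOm2 b.
rewrite -(integral_hits_mul P c c ma ma) in ha.
rewrite -(integral_hits_mul P c c mb mb) in hb.
pose u w := (hits (fun r => cell_event (a + r)) c w)%:R : R.
pose v w := (hits (fun r => cell_event (b + r)) c w)%:R : R.
have mu : measurable_fun setT u by exact: measurable_hits.
have mv : measurable_fun setT v by exact: measurable_hits.
have muv (x y : T -> R) : measurable_fun setT x -> measurable_fun setT y ->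
    measurable_fun setT (fun w => (x w * y w)%:E).
  by move=> mx my; apply/measurable_EFinP; exact: measurable_funM.
have p0 w : 0 <= u w by []. have q0 w : 0 <= v w by [].
suff : (2%:E * \int[P]_w (u w * v w)%:E <= 2%:E * 6%:E)%E by rewrite lee_pmul2l.
rewrite -(ge0_integralZl _ measurableT (muv _ _ mu mv))//; last first.
  by move=> w _; rewrite lee_fin mulr_ge0.
apply: (@le_trans _ _ (\int[P]_w ((u w * u w)%:E + (v w * v w)%:E))%E).
  apply: ge0_le_integral => //.
  - by move=> w _; rewrite mule_ge0// lee_fin mulr_ge0.
  - by apply: measurable_funeM; exact: muv.
  - by apply: emeasurable_funD; exact: muv.
  - move=> w _; rewrite -EFinM -EFinD lee_fin.
    have := sqr_ge0 (u w - v w); rewrite sqrrB !expr2; lra.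
rewrite ge0_integralD//; last 4 first.
- by move=> w _; rewrite lee_fin mulr_ge0.
- exact: muv.
- by move=> w _; rewrite lee_fin mulr_ge0.
- exact: muv.
by apply: (le_trans (leeD ha hb)); rewrite -EFinD -EFinM lee_fin; lra.
Qed.

(** The diagonal terms of the second moment of a block already sum to [c g]. This bounds the mean
    number of sign changes uniformly in the mesh. *)
Lemma cell_probability_le : c%:R * g <= 6.
Proof.
have diag r : joint r r = g.
  by rewrite /joint setIid probability_cell_event.
apply: le_trans (block_pair_moment 0 0).
rewrite mulr_natl -[X in _ *+ X]card_ord -sumr_const; apply: ler_sum => r _.
rewrite (bigD1 r)//= diag lerDl sumr_ge0// => r' _; exact: fine_ge0.
Qed.

(** The squared slope is at most [(c eta Om)^2 / c^2], hence at most [1 / c^2]. The constant 3200 is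
    enlarged to the one that [block_cov] needs for large correlations. *)
Let small_block a b : corr_small s om eta (a%:R * eta - b%:R * eta) ->
  joint a b - g ^+ 2 <= 6 * 4096 / c%:R ^+ 2 * rho a b.
Proof.
move=> h.
have e a' : a'.+1%:R * eta = a'%:R * eta + eta by rewrite -natr1 mulrDl mul1r.
have := probability_change_pair mX indepX lawX us sA s0 Om0 om_le om_sq eta0 etaOm h.
rewrite -!e -/(cell_event a) -/(cell_event b) jointE gE -EFinM -EFinD lee_fin.
rewrite -lerBlDl -expr2 => /le_trans; apply.
rewrite mulrAC ler_wpM2r ?corr_sqr_norm_ge0//.
have k2 := slope_sqr_le s0 Om0 om_le om_sq eta0 etaOm.
apply: (le_trans (ler_wpM2l (ler0n R 3200) k2)).
have -> : 3200 * (eta ^+ 2 * Om ^+ 2) = 3200 * (c%:R * eta * Om) ^+ 2 / c%:R ^+ 2 :> R.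
  by field.
rewrite ler_wpM2r ?invr_ge0 ?sqr_ge0//.
have z0 : 0 <= c%:R * eta * Om by rewrite !mulr_ge0// ltW.
have : (c%:R * eta * Om) ^+ 2 <= 1 by rewrite expr_le1//; move: cOm; lra.
by move: ((c%:R * eta * Om) ^+ 2) => z; lra.
Qed.

Let block_cov i j :
  \sum_(r < c) \sum_(r' < c) (joint (i * c + r) (j * c + r') - g ^+ 2) <=
  6 * 4096 / c%:R ^+ 2 * \sum_(r < c) \sum_(r' < c) rho (i * c + r) (j * c + r').
Proof.
pose tau (r r' : nat) : R := (i * c + r)%:R * eta - (j * c + r')%:R * eta.
have [small|] := pselect (forall r r' : 'I_c, corr_small s om eta (tau r r')).
  rewrite mulr_sumr; apply: ler_sum => r _; rewrite mulr_sumr; apply: ler_sum => r' _.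
  by apply: small_block; exact: small.
(* A correlation that is large at one pair of cells remains so on the whole pair
   of blocks, which pays for the crude bound [block_pair_moment]. *)
move=> /existsNP [r1 /existsNP [r2 ns]].
have big (r r' : 'I_c) : 4096^-1 <= rho (i * c + r) (j * c + r').
  apply: (corr_sqr_norm_ge s0 Om0 om_le om_sq eta0 etaOm ns).
  have lec (u v : 'I_c) : `|u%:R - v%:R| <= c%:R :> R.
    rewrite ler_norml; apply/andP; split.
      by rewrite lerNl opprB lerBlDr (le_trans (_ : _ <= c%:R))// ?ler_nat ?(ltnW (ltn_ord _))// lerDl.
    by rewrite lerBlDr (le_trans (_ : _ <= c%:R))// ?ler_nat ?(ltnW (ltn_ord _))// lerDl.
  have -> : tau r1 r2 - ((i * c + r)%:R * eta - (j * c + r')%:R * eta) =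
      ((r1%:R - r%:R) - (r2%:R - r'%:R)) * eta.
    by rewrite /tau !natrD; ring.
  rewrite normrM (gtr0_norm eta0).
  (* Moving both cells inside their blocks shifts the time difference by at most two block lengths,
     and [4 Om] times this is at most [8 / 512 = 1 / 64]. *)
  have : `|r1%:R - r%:R - (r2%:R - r'%:R)| <= 2 * c%:R :> R.
    by apply: (le_trans (ler_normB _ _)); have := lec r1 r; have := lec r2 r'; lra.
  move=> /(ler_wpM2r (ltW eta0)) /(ler_wpM2l (_ : 0 <= 4 * Om)) h.
  apply: (le_trans (h _)); first by rewrite mulr_ge0// ltW.
  by move: cOm; rewrite -!mulrA (mulrC Om); lra.
apply: (@le_trans _ _ 6).
  apply: le_trans (block_pair_moment (i * c) (j * c)).
  by apply: ler_sum => r _; apply: ler_sum => r' _; rewrite gerBl sqr_ge0.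
rewrite mulrAC ler_pdivlMr ?exprn_gt0 ?ltr0n//.
have : \sum_(r < c) \sum_(r' < c) 4096^-1 <=
    \sum_(r < c) \sum_(r' < c) rho (i * c + r) (j * c + r').
  by apply: ler_sum => r _; apply: ler_sum => r' _; exact: big.
rewrite !sumr_const !card_ord -mulrnA -[_ *+ (c * c)]mulr_natr (natrM _ c c) -expr2.
by move: (\sum_(r < c) _) (c%:R ^+ 2) => z y; lra.
Qed.

(** The factor [c^-2] of [block_cov] cancels the [c^2] in the number of pairs of cells, so the bound
    depends on the number [K] of blocks but not on the mesh. *)
Lemma sum_joint_cov :
  \sum_(a < K * c) \sum_(b < K * c) (joint a b - g ^+ 2) <=
  6 * 4096 * 64 * K%:R ^+ 2 * (1 + 6 / L ^+ 2) * B / (size s)%:R.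
Proof.
have Mgt : (0 < K * c)%N by rewrite muln_gt0 K0.
have sum_rho : \sum_(a < K * c) \sum_(b < K * c) rho a b <=
    64 * (K * c)%:R ^+ 2 * (1 + 6 / L ^+ 2) * B / (size s)%:R.
  have hM : L / (K * c)%:R * Om <= 1 / 2 by rewrite -etaE.
  have h1 := sum_corr_sqr s0 om_le (weight11_le s0 om_le eta0 etaOm) L0 Mgt hM sepB.
  have h2 := sum_corr_sqr s0 om_le (weight12_le s0 Om0 om_le om_sq eta0 etaOm) L0 Mgt hM sepB.
  have h3 := sum_corr_sqr s0 om_le (weight22_le s0 Om0 om_le om_sq eta0 etaOm) L0 Mgt hM sepB.
  apply: (@le_trans _ _ (4 * (16 * (K * c)%:R ^+ 2 * (1 + 6 / L ^+ 2) * B / (size s)%:R))).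
    rewrite -etaE in h1 h2 h3.
    have := lerD (lerD h1 h2) (lerD h2 h3); rewrite -!big_split /=.
    under eq_bigr do rewrite -!big_split /=.
    move=> h; apply: (le_trans (_ : _ <= _)); last first.
      by apply: (le_trans h); lra.
    apply: ler_sum => a _; apply: ler_sum => b _; rewrite /rho /corr_sqr_norm.
    set t := a%:R * eta - b%:R * eta.
    (* [sum_corr_sqr] controls sums of a cosine and a sine square; the squares absent from [rho] are
       added, and the mixed weight is used twice, which gives [4 * 16 = 64]. *)
    have := sqr_ge0 (sin_corr s om (weight11 s om eta) t).
    have := sqr_ge0 (cos_corr s om (weight12 s om eta) t).
    have := sqr_ge0 (sin_corr s om (weight22 s om eta) t).
    lra.
  by rewrite le_eqVlt; apply/orP; left; apply/eqP; field; rewrite pnatr_eq0 -lt0n s0 gt_eqF.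
have block2 (F : nat -> nat -> R) : \sum_(a < K * c) \sum_(b < K * c) F a b =
    \sum_(i < K) \sum_(j < K) \sum_(r < c) \sum_(r' < c) F (i * c + r)%N (j * c + r')%N.
  rewrite (big_blocks (fun a => \sum_(b < K * c) F a b)); apply: eq_bigr => i _.
  rewrite [RHS]exchange_big /=; apply: eq_bigr => r _; exact: big_blocks.
rewrite (block2 (fun a b => joint a b - g ^+ 2)).
apply: (@le_trans _ _ (6 * 4096 / c%:R ^+ 2 * \sum_(a < K * c) \sum_(b < K * c) rho a b)).
  rewrite (block2 rho) mulr_sumr; apply: ler_sum => i _.
  by rewrite mulr_sumr; apply: ler_sum => j _; exact: block_cov.
have k0 : 0 <= 6 * 4096 / c%:R ^+ 2 :> R.
  exact: (divr_ge0 (mulr_ge0 (ler0n R 6) (ler0n R 4096)) (sqr_ge0 _)).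
apply: (le_trans (ler_wpM2l k0 sum_rho)).
rewrite natrM le_eqVlt; apply/orP; left; apply/eqP; field.
by rewrite pnatr_eq0 -lt0n s0 gt_eqF.
Qed.

End variance.
End grid.

(** * Zeros as a limit of sign changes *)

Section almost_everywhere.
Context {R : realType} d (T : measurableType d) (P : probability T R).
Local Open Scope ereal_scope.

(* [f] need not be measurable, as [P] may be incomplete: its integral is then the
   supremum of the integrals of the simple functions below [f]. *)
Lemma ge0_integral_null_modification (f g : T -> \bar R) (N : set T) :
  measurable N -> P N = 0 -> (forall x, 0 <= f x) -> (forall x, 0 <= g x) ->
  measurable_fun setT g -> (forall x, ~ N x -> f x = g x) ->
  \int[P]_x f x = \int[P]_x g x.
Proof.
move=> mN PN f0 g0 mg fg.
have mono (u v : T -> \bar R) : (forall x, 0 <= u x) -> (forall x, u x <= v x) ->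
    \int[P]_x u x <= \int[P]_x v x.
  move=> u0 uv; have v0 x : 0 <= v x by exact: le_trans (uv x).
  rewrite !ge0_integralTE//; apply: le_ereal_sup => _ [h hu <-].
  by exists h => // x; exact: le_trans (uv x).
(* Overwriting [g] on [N] by the constants [+oo] and 0 gives two measurable functions with the same
   integral that enclose [f]. *)
pose G (c : \bar R) x := if x \in N then c else g x.
have mG c : measurable_fun setT (G c).
  apply: measurable_fun_ifT => //; apply: (measurable_fun_bool true).
  rewrite setTI (_ : _ @^-1` _ = N)//.
  by apply/seteqP; split => x /=; [move=> /set_mem | exact: mem_set].
have G0 c x : 0 <= c -> 0 <= G c x by move=> c0; rewrite /G; case: ifP.
have intG c : 0 <= c -> \int[P]_x G c x = \int[P]_x g x.
  move=> c0; apply: ge0_ae_eq_integral => //; first by move=> x _; exact: G0.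
  exists N; split => // x /= h; apply: contrapT => nN; apply: h => _.
  by rewrite /G memNset.
apply/eqP; rewrite eq_le; apply/andP; split.
  rewrite -(intG +oo)//; apply: mono => // x; rewrite /G.
  by case: ifPn => [_|/negP nN]; rewrite ?leey// fg// => h; apply: nN; exact: mem_set.
rewrite -(intG 0)//; apply: mono => x; first exact: G0.
rewrite /G; case: ifPn => [_//|/negP nN].
by rewrite fg// => h; apply: nN; exact: mem_set.
Qed.

Local Close Scope ereal_scope.

(* Fatou's lemma for the squared deviations, monotone convergence for the means. *)
Lemma variance_monotone_limit (Z : T -> R) (Zn : nat -> T -> R) (N : set T) (E V : R) :
  measurable N -> P N = 0%E -> (forall w, 0 <= Z w) ->
  (forall n, measurable_fun setT (Zn n)) -> (forall n w, 0 <= Zn n w) ->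
  (forall w, {homo Zn^~ w : n m / (n <= m)%N >-> n <= m}) ->
  (forall w, ~ N w -> \forall n \near \oo, Zn n w = Z w) ->
  (forall n, \int[P]_w (Zn n w)%:E <= E%:E)%E ->
  (forall n, \int[P]_w ((Zn n w - fine (\int[P]_w (Zn n w)%:E)) ^+ 2)%:E <= V%:E)%E ->
  ('V_P[Z] <= V%:E)%E.
Proof.
move=> mN PN Z0 mZ Zn0 homo lim intE varV.
pose e n := fine (\int[P]_w (Zn n w)%:E).
have mZE n : measurable_fun setT (fun w => (Zn n w)%:E) by apply/measurable_EFinP.
have Zn0E n w : setT w -> (0 <= (Zn n w)%:E)%E by move=> _; rewrite lee_fin.
have homoE w : setT w -> {homo (fun n => (Zn n w)%:E) : n m / (n <= m)%N >-> (n <= m)%E}.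
  by move=> _ n m nm; rewrite lee_fin homo.
have eE n : (\int[P]_w (Zn n w)%:E)%E = (e n)%:E.
  rewrite fineK// ge0_fin_numE; first by rewrite (le_lt_trans (intE n))// ltry.
  by apply: integral_ge0; exact: Zn0E.
pose Zi w := limn (fun n => (Zn n w)%:E).
have mZi : measurable_fun setT Zi.
  apply: (emeasurable_fun_cvg (fun n w => (Zn n w)%:E)) => // w _.
  exact: ereal_nondecreasing_is_cvgn (homoE w I).
have cvgZ w : ~ N w -> (Zn n w)%:E @[n --> \oo] --> (Z w)%:E.
  move=> /lim h; apply: cvg_near_cst; near=> n; congr EFin; near: n; exact: h.
have ZiE w : ~ N w -> (Z w)%:E = Zi w by move=> /cvgZ h; apply/esym; exact: cvg_lim h.
have Zi0 w : (0 <= Zi w)%E.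
  apply: lime_ge; first exact: ereal_nondecreasing_is_cvgn (homoE w I).
  by apply: nearW => n; exact: Zn0E.
have intZ : (\int[P]_w (Z w)%:E = \int[P]_w Zi w)%E.
  by apply: (ge0_integral_null_modification mN PN).
have intZi : (\int[P]_w (Zn n w)%:E)%E @[n --> \oo] --> (\int[P]_w (Z w)%:E)%E.
  by rewrite intZ; exact: (cvg_monotone_convergence measurableT mZE Zn0E homoE).
have EZ : (\int[P]_w (Z w)%:E <= E%:E)%E.
  rewrite -(cvg_lim _ intZi)//; apply: lime_le; first by apply/cvg_ex; exists (\int[P]_w (Z w)%:E)%E.
  exact: nearW.
have EZ0 : (0 <= \int[P]_w (Z w)%:E)%E by apply: integral_ge0 => w _; rewrite lee_fin.
have finZ : (\int[P]_w (Z w)%:E)%E \is a fin_num.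
  by rewrite ge0_fin_numE// (le_lt_trans EZ)// ltry.
pose m := fine (\int[P]_w (Z w)%:E)%E.
have cvge : e n @[n --> \oo] --> m.
  by apply: (fine_cvg (f := fun n => \int[P]_w (Zn n w)%:E)%E); rewrite fineK.
pose D n w := ((Zn n w - e n) ^+ 2)%:E.
have mD n : measurable_fun setT (D n).
  apply/measurable_EFinP; apply: measurable_funX; exact: measurable_funB.
have D0 n w : setT w -> (0 <= D n w)%E by move=> _; rewrite lee_fin sqr_ge0.
have mI : measurable_fun setT (fun w => limn_einf (D^~ w)).
  apply: (emeasurable_fun_cvg (fun n w => einfs (D^~ w) n)).
    by move=> n; exact: measurable_fun_einfs.
  by move=> w _; rewrite limn_einf_lim; exact: is_cvg_einfs.
have cvgD w : ~ N w -> D n w @[n --> \oo] --> ((Z w - m) ^+ 2)%:E.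
  move=> /lim h; apply: cvg_EFin; first exact: nearW.
  have : (Z w - e n) ^+ 2 @[n --> \oo] --> (Z w - m) ^+ 2.
    have c : Z w - e n @[n --> \oo] --> Z w - m by apply: cvgB => //; exact: cvg_cst.
    by rewrite expr2; under eq_fun do rewrite expr2; exact: cvgM.
  apply: cvg_trans; apply: near_eq_cvg; near=> n; congr (_ ^+ 2).
  by congr (_ - _); apply/esym; near: n.
have I0 w : (0 <= limn_einf (D^~ w))%E.
  rewrite limn_einf_lim; apply: lime_ge; first exact: is_cvg_einfs.
  by apply: nearW => n; apply: le_ereal_inf_tmp => _ [k _ <-]; exact: D0.
rewrite /variance covariance.unlock expectation.unlock.
have -> : (\int[P]_w (((Z \- cst m) * (Z \- cst m)) w)%:E = \int[P]_w limn_einf (D^~ w))%E.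
  apply: (ge0_integral_null_modification mN PN) => //.
    by move=> w; rewrite lee_fin /= -expr2 sqr_ge0.
  by move=> w /cvgD /cvg_limn_einf_sup [-> _].
apply: (le_trans (fatou _ measurableT mD D0)).
rewrite limn_einf_lim; apply: lime_le; first exact: is_cvg_einfs.
apply: nearW => n; apply: (le_trans _ (varV n)).
by apply: ereal_inf_lbound; exists n => //=.
Unshelve. all: by end_near.
Qed.
End almost_everywhere.

(** * Dyadic refinement of the grid *)

Section zero_count.
Context {R : realType} d (T : measurableType d) (P : probability T R).
Context {I : choiceType} (A : set I) (X : I -> T -> R * R) (s : seq I).
Hypothesis mX : forall i, A i -> measurable_fun setT (X i).
Hypothesis indepX : mutually_independent P A X.
Hypothesis lawX : forall i, A i -> forall B, measurable B ->
  P (X i @^-1` B) = gauss2 B.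
Hypotheses (us : uniq s) (sA : {in s, forall i, A i}).
Variables (om : I -> R) (Om : R).
Hypotheses (s0 : (0 < size s)%N) (Om0 : 0 < Om).
Hypothesis om_le : forall i, i \in s -> `|om i| <= Om.
Hypothesis om_sq : (size s)%:R * Om ^+ 2 / 2 <= \sum_(i <- s) om i ^+ 2.
Local Notation f := (wave X s om).
Variables (K : nat) (L B : R).
Hypotheses (K0 : (0 < K)%N) (L0 : 0 < L) (KOm : L / K%:R * Om <= 512^-1).
Hypothesis sepB :
  forall i, i \in s -> \sum_(j <- s) (1 + (om i - om j) ^+ 2)^-1 <= B.

Let ncells (n : nat) : nat := (K * 2 ^ n)%N.
Let mesh (n : nat) : R := L / (ncells n)%:R.

Let ncells_gt0 n : (0 < ncells n)%N.
Proof. by rewrite muln_gt0 K0 expn_gt0. Qed.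

Let mesh_gt0 n : 0 < mesh n.
Proof. by rewrite divr_gt0// ltr0n. Qed.

Let mesh_double n : mesh n = 2 * mesh n.+1.
Proof.
have e : ncells n.+1 = (2 * ncells n)%N by rewrite /ncells expnS mulnCA.
by rewrite /mesh e natrM; field; rewrite pnatr_eq0 -lt0n ncells_gt0.
Qed.

Let mesh_ncells n : (ncells n)%:R * mesh n = L.
Proof. by rewrite /mesh mulrCA mulfV ?mulr1// pnatr_eq0 -lt0n. Qed.

Let mesh_le n : mesh n <= L / K%:R.
Proof.
rewrite /mesh /ncells natrM invfM mulrA ler_piMr ?divr_ge0 ?(ltW L0)//.
by rewrite invf_le1 ?ltr0n ?expn_gt0// ler1n expn_gt0.
Qed.

Let meshOm n : mesh n * Om <= 1 / 2.
Proof.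
apply: (@le_trans _ _ (L / K%:R * Om)); first by rewrite ler_wpM2r ?(ltW Om0)// mesh_le.
by move: KOm; lra.
Qed.

Let count (n : nat) (w : T) : R := (hits (cell_event X s om (mesh n)) (ncells n) w)%:R.

Let measurable_cell n a : measurable (cell_event X s om (mesh n) a).
Proof. exact: (measurable_cell_event mX sA). Qed.

Let countE n w : hits (cell_event X s om (mesh n)) (ncells n) w =
  (\sum_(a < ncells n) sign_change (f 0 w) (a%:R * mesh n) (a.+1%:R * mesh n))%N.
Proof. exact: (hits_cell_event X s om (mesh n) 0 (ncells n) w). Qed.

(** A change over a cell forces a change over one of its two halves. *)
Let count_le w : {homo count^~ w : n m / (n <= m)%N >-> n <= m}.
Proof.
apply: homo_leq => [//|y x z|n]; first exact: le_trans.
rewrite /count ler_nat !countE.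
have -> : ncells n.+1 = (ncells n * 2)%N by rewrite /ncells expnS mulnCA mulnC.
rewrite (big_blocks (fun a => nat_of_bool (sign_change (f 0 w) (a%:R * mesh n.+1)
  (a.+1%:R * mesh n.+1)))).
apply: leq_sum => i _; rewrite big_ord_recl big_ord1 /= /bump /= addn0 addn1.
have -> : i%:R * mesh n = (i * 2)%:R * mesh n.+1 by rewrite mesh_double natrM; ring.
have -> : i.+1%:R * mesh n = (i * 2).+2%:R * mesh n.+1.
  by rewrite mesh_double -[(i * 2).+2]/(i.+1 * 2)%N natrM; ring.
rewrite /sign_change.
by case: (f 0 w _ < 0); case: (f 0 w _ < 0); case: (f 0 w _ < 0).
Qed.

Let bad n (M : nat) : set T :=
  \big[setU/set0]_(a < ncells n) flat_event X s om (mesh n) M%:R (a%:R * mesh n).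

Let measurable_bad n M : measurable (bad n M).
Proof.
by apply: bigsetU_measurable => a _; exact: (measurable_flat_event mX sA).
Qed.

(** The flat events have probability of order [mesh^3] and there are [L / mesh] of them; of the
    resulting decay [4^-n] only [2^-n] is kept. *)
Let probability_bad n M :
  (P (bad n M) <= (32 * M%:R ^+ 2 * L * (L / K%:R) ^+ 2 / Om / 2 ^+ n)%:E)%E.
Proof.
have h a := probability_flat_event mX indepX lawX us sA s0 Om0 om_le om_sq
  (mesh_gt0 n) (meshOm n) (a%:R * mesh n) (ler0n R M).
have mF a : measurable (flat_event X s om (mesh n) M%:R (a%:R * mesh n)).
  exact: (measurable_flat_event mX sA).
apply: (le_trans (Boole_inequality P (fun a _ => mF a))).
apply: (@le_trans _ _ (\sum_(a < ncells n) (32 * M%:R ^+ 2 * mesh n ^+ 3 / Om)%:E)%E).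
  by apply: lee_sum => a _; exact: h.
rewrite sumEFin lee_fin sumr_const card_ord -[_ *+ ncells n]mulr_natl.
have -> : (ncells n)%:R * (32 * M%:R ^+ 2 * mesh n ^+ 3 / Om) =
    32 * M%:R ^+ 2 * ((ncells n)%:R * mesh n) / Om * mesh n ^+ 2 by ring.
rewrite mesh_ncells.
have -> : 32 * M%:R ^+ 2 * L * (L / K%:R) ^+ 2 / Om / 2 ^+ n =
  32 * M%:R ^+ 2 * L / Om * ((L / K%:R) ^+ 2 / 2 ^+ n) by ring.
rewrite ler_wpM2l ?divr_ge0 ?mulr_ge0 ?sqr_ge0 ?(ltW Om0) ?(ltW L0)//.
have -> : mesh n ^+ 2 = (L / K%:R) ^+ 2 / 2 ^+ n / 2 ^+ n.
  rewrite /mesh /ncells natrM natrX; field.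
  by rewrite expf_neq0// pnatr_eq0 -lt0n.
rewrite ler_piMr ?divr_ge0 ?sqr_ge0 ?exprn_ge0//.
by rewrite invf_le1 ?exprn_gt0// exprn_ege1// ler1n.
Qed.

(** The counts increase with [n], so infinitely many good grids suffice to identify their limit. It
    is thus enough that being bad at all [n >= n0] is a null event, without summing
    probabilities. *)
Let always_bad M n0 : set T := \bigcap_(n in [set n | (n0 <= n)%N]) bad n M.

Let negligible_always_bad M n0 : P.-negligible (always_bad M n0).
Proof.
have mI : measurable (always_bad M n0).
  by apply: bigcap_measurable => [|n _]; [exists n0 => /= | exact: measurable_bad].
exists (always_bad M n0); split => //.
set C := 32 * M%:R ^+ 2 * L * (L / K%:R) ^+ 2 / Om.
have h n : (n0 <= n)%N -> (P (always_bad M n0) <= (C / 2 ^+ n)%:E)%E.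
  move=> nn; apply: le_trans (probability_bad n M); apply: le_measure; rewrite ?inE//.
  by move=> w; exact.
have finI : P (always_bad M n0) \is a fin_num by rewrite fin_num_measure.
move: h; rewrite -(fineK finI); set x := fine _ => h.
have x0 : 0 <= x by exact: fine_ge0.
congr EFin; apply/eqP; rewrite eq_le x0 andbT leNgt; apply/negP => xgt.
have C0 : 0 <= C by rewrite !mulr_ge0 ?invr_ge0 ?(ltW L0) ?(ltW Om0)// sqr_ge0.
pose n := maxn n0 (Num.truncn (C / x)).+1.
have := h n (leq_maxl _ _); rewrite lee_fin ler_pdivlMr ?exprn_gt0// leNgt => /negP; apply.
have Cx : C / x < n%:R.
  apply: (lt_le_trans (truncnS_gt _)) => //.
  by rewrite ler_nat leq_maxr.
rewrite ltr_pdivrMr// in Cx; apply: (lt_le_trans Cx).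
by rewrite mulrC ler_pM2l// -natrX ler_nat ltnW// ltn_expl.
Qed.

Let grid_zero n (a : nat) : set T := [set w | f 0 w (a%:R * mesh n) = 0].

Let negligible_grid_zero n a : P.-negligible (grid_zero n a).
Proof.
have mW := measurable_wave_le mX sA om (a%:R * mesh n) 0.
exists [set w | `|f 0 w (a%:R * mesh n)| <= 0]; split => //.
  apply/eqP; rewrite eq_le measure_ge0 andbT.
  have := probability_wave_le mX indepX lawX us sA om s0 (a%:R * mesh n) (lexx 0).
  by rewrite mulr0.
by move=> w /= ->; rewrite normr0.
Qed.

(** [Z] has to be the number of zeros only where the end values are nonzero and the zeros are
    finitely many; elsewhere it may be any nonnegative function, as these exceptions lie in a null
    set. *)
Theorem zero_count_variance (Z : T -> R) : (forall w, 0 <= Z w) ->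
  (forall w (zs : seq R), f 0 w 0 != 0 -> f 0 w L != 0 -> uniq zs ->
    (forall t, t \in zs <-> 0 < t < L /\ f 0 w t = 0) -> Z w = (size zs)%:R) ->
  ('V_P[Z] <=
    (6 * 4096 * 64 * K%:R ^+ 2 * (1 + 6 / L ^+ 2) * B / (size s)%:R)%:E)%E.
Proof.
move=> Z0 ZE.
have n1 : P.-negligible (\bigcup_n \bigcup_a grid_zero n a).
  by apply: negligible_bigcup => n; apply: negligible_bigcup => a; exact: negligible_grid_zero.
have n2 : P.-negligible (\bigcup_M \bigcup_n always_bad M n).
  by apply: negligible_bigcup => M; apply: negligible_bigcup => n; exact: negligible_always_bad.
have [N [mN PN subN]] := negligibleU n1 n2.
have cellP n a : P (cell_event X s om (mesh n) a) = (cell_probability s om (mesh n))%:E.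
  exact: (probability_cell_event mX indepX lawX us sA s0 Om0 om_le om_sq
    (mesh_gt0 n) a (meshOm n)).
have intC n : (\int[P]_w (count n w)%:E =
    ((ncells n)%:R * cell_probability s om (mesh n))%:E)%E.
  rewrite integral_hits//; under eq_bigr do rewrite cellP.
  by rewrite sumEFin sumr_const card_ord mulr_natl.
apply: (variance_monotone_limit (Zn := count) (E := 6 * K%:R) mN PN Z0).
- by move=> n; exact: measurable_hits.
- by move=> n w; rewrite /count.
- exact: count_le.
- move=> w nN.
  have ngz n a : f 0 w (a%:R * mesh n) != 0.
    by apply/eqP => h; apply: nN; apply: subN; left; exists n => //; exists a.
  (* An integer bound for the second derivative: with integer [M], countably many null events cover
     all outcomes although [amplitude] is unbounded. *)
  pose M := (Num.truncn (Om ^+ 2 * amplitude X s w)).+1.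
  have hM t : `|f 2 w t| <= M%:R.
    apply: (le_trans (wave_le_amplitude X Om0 om_le 2 w t)).
    by apply: ltW; exact: truncnS_gt.
  have often n0 : exists2 n, (n0 <= n)%N & count n w = Z w.
    have : ~ always_bad M n0 w.
      by move=> h; apply: nN; apply: subN; right; exists M => //; exists n0.
    move=> /existsNP [n /not_implyP [nn nbad]]; exists n => //.
    have nflat a : (a < ncells n)%N -> ~ (`|f 0 w (a%:R * mesh n)| <= M%:R * mesh n ^+ 2 /\
        `|f 0 w (a.+1%:R * mesh n)| <= M%:R * mesh n ^+ 2).
      move=> an [h1 h2]; apply: nbad.
      suff : (\bigcup_(a in `I_(ncells n))
          flat_event X s om (mesh n) M%:R (a%:R * mesh n)) w by rewrite bigcup_mkord.
      exists a => //.
      have e : a%:R * mesh n + mesh n = a.+1%:R * mesh n by rewrite -natr1 mulrDl mul1r.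
      by split => //=; rewrite e.
    have [zs [uzs szs hzs]] := zeros_on_grid (fun t => is_derive_wave X s om 0 w t)
      (fun t => is_derive_wave X s om 1 w t) hM (mesh_gt0 n) (fun a _ => ngz n a) nflat.
    rewrite mesh_ncells in hzs.
    have z0 := ngz n 0%N; rewrite mul0r in z0.
    have zL := ngz n (ncells n); rewrite mesh_ncells in zL.
    by rewrite (ZE w zs z0 zL uzs hzs) szs /count countE.
  (* From the first good grid on, the count lies between its value there and its value at a later
     good grid, both equal to [Z w]. *)
  have [n3 _ e3] := often 0%N.
  exists n3 => // n /= n3n; apply/eqP; rewrite eq_le -{2}e3 count_le// andbT.
  by have [n4 n4n <-] := often n; exact: count_le.
- move=> n; rewrite intC lee_fin /ncells natrM -mulrA mulrC.
  have h := cell_probability_le mX indepX lawX us sA s0 Om0 om_le om_sq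
    (mesh_gt0 n) K0 (expn_gt0 2 n : (0 < 2 ^ n)%N) erefl KOm.
  by rewrite ler_wpM2r.
- move=> n; rewrite intC /=.
  rewrite (integral_hits_dev _ (measurable_cell n) (cellP n)) lee_fin.
  exact: (sum_joint_cov mX indepX lawX us sA s0 Om0 om_le om_sq
    (mesh_gt0 n) K0 (expn_gt0 2 n : (0 < 2 ^ n)%N) L0 erefl KOm sepB).
Qed.

End zero_count.

(** * Lattice points on a circle *)

Lemma sum_injective_le (R : realDomainType) (I : eqType) (J : finType) (s : seq I)
    (h : I -> J) (F : J -> R) : uniq s -> {in s &, injective h} ->
  (forall j, 0 <= F j) -> \sum_(i <- s) F (h i) <= \sum_j F j.
Proof.
move=> us hinj F0; rewrite -(big_map h xpredT F).
rewrite big_uniq ?map_inj_in_uniq//=.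
by rewrite [leRHS](bigID (mem [seq h i | i <- s]))/= lerDl sumr_ge0.
Qed.

(** Telescoping: the next term is at most [1 / (p+1) - 1 / (p+2)], which the correction
    [- 1 / (p+1)] in the induction hypothesis absorbs. *)
Lemma sum_inv_sqr_le (R : realFieldType) (n : nat) :
  \sum_(k < n) (1 + k%:R ^+ 2)^-1 <= 3 :> R.
Proof.
have h p : \sum_(k < p.+2) (1 + k%:R ^+ 2)^-1 <= 3 - p.+1%:R^-1 :> R.
  elim: p => [|p IH].
    by rewrite big_ord_recl big_ord1 /= expr0n expr1n /= addr0 !invr1 (_ : 1 + 1 = 2)//; lra.
  rewrite big_ord_recr /=.
  have x0 : 0 < p.+1%:R :> R by rewrite ltr0n.
  have e : p.+2%:R = p.+1%:R + 1 :> R by rewrite natr1.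
  rewrite e; move: IH x0; move: (\sum_(k < p.+2) _) p.+1%:R => S x IH x0.
  have k : (1 + (x + 1) ^+ 2)^-1 <= x^-1 - (x + 1)^-1.
    have x1 : 0 < x + 1 by lra.
    have -> : x^-1 - (x + 1)^-1 = (x * (x + 1))^-1.
      by field; rewrite (lt0r_neq0 x0) (lt0r_neq0 x1).
    rewrite lef_pV2 ?posrE; nra.
  lra.
case: n => [|[|n]].
- by rewrite big_ord0.
- by rewrite big_ord1 expr0n /= addr0 invr1; lra.
- by apply: (le_trans (h n)); rewrite gerBl invr_ge0.
Qed.

Section lattice_points.
Variable m : nat.
Hypothesis m0 : (0 < m)%N.

Definition points : seq (int * int) := fset_set (lattice_circle m).

(** Selects one point of each pair [mu], [- mu] by the lexicographic sign. *)
Definition positive (mu : int * int) : bool :=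
  (0 < mu.1) || ((mu.1 == 0) && (0 < mu.2)).

Definition half_points : seq (int * int) := [seq mu <- points | positive mu].

Lemma mem_points mu : (mu \in points) = (mu.1 ^+ 2 + mu.2 ^+ 2 == m%:Z).
Proof.
rewrite /points in_fset_set ?mem_setE//; last exact: finite_lattice_circle.
by apply/idP/eqP => [/set_mem|h]; [|exact: mem_set].
Qed.

Lemma uniq_points : uniq points. Proof. exact: fset_uniq. Qed.

Lemma size_points : size points = lattice_count m. Proof. by []. Qed.

Lemma positiveN mu : mu \in points -> positive (- mu) = ~~ positive mu.
Proof.
rewrite mem_points; case: mu => x y; rewrite /positive /= => /eqP e.
rewrite !oppr_gt0 oppr_eq0.
have [x0|x0|x0] := ltgtP x 0 => //=.
have [y0|y0|y0] := ltgtP y 0 => //=.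
by move: e; rewrite x0 y0 expr0n /= => -[e]; move: m0; rewrite -e.
Qed.

Lemma points_half : perm_eq points (half_points ++ [seq - mu | mu <- half_points]).
Proof.
have inN mu : (- mu \in points) = (mu \in points).
  by rewrite !mem_points /= !sqrrN.
apply: uniq_perm; first exact: uniq_points.
  rewrite cat_uniq filter_uniq ?uniq_points// map_inj_uniq ?filter_uniq ?uniq_points//.
    rewrite andbT; apply/hasPn => _ /mapP[mu + ->].
    rewrite mem_filter => /andP[p mup]; rewrite /= mem_filter positiveN// p.
  exact: oppr_inj.
move=> mu; rewrite mem_cat mem_filter.
have -> : (mu \in [seq - nu | nu <- half_points]) = ~~ positive mu && (mu \in points).
  rewrite -[mu in LHS]opprK (mem_map oppr_inj) mem_filter inN.
  by case: (boolP (mu \in points)) => [h|]; rewrite ?andbF// positiveN.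
by case: (positive mu) => //=; rewrite orbF.
Qed.

Lemma sum_points (V : nmodType) (F : int * int -> V) :
  \sum_(mu <- points) F mu = \sum_(mu <- half_points) (F mu + F (- mu)).
Proof. by rewrite (perm_big _ points_half)/= big_cat big_map big_split. Qed.

Lemma size_points_half : lattice_count m = (2 * size half_points)%N.
Proof.
by rewrite -size_points (perm_size points_half) size_cat size_map mul2n addnn.
Qed.

(** A quarter turn preserves the lattice circle, which makes the mean squares of two orthogonal
    coordinates equal. *)
Lemma points_rot : perm_eq points [seq (- mu.2, mu.1) | mu : int * int <- points].
Proof.
have inj : injective (fun mu : int * int => (- mu.2, mu.1)).
  by move=> [x y] [x' y'] /= [/oppr_inj -> ->].
apply: uniq_perm; rewrite ?map_inj_uniq ?uniq_points//.
move=> [x y]; have -> : (x, y) = ((fun mu : int * int => (- mu.2, mu.1)) (y, - x)).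
  by rewrite /= opprK.
by rewrite (mem_map inj) !mem_points /= !sqrrN addrC.
Qed.

Section frequencies.
Context {R : realType}.
Variable alpha : R * R.
Hypothesis alpha1 : alpha.1 ^+ 2 + alpha.2 ^+ 2 = 1.

Local Notation x mu := (dotp (int_vec R mu) alpha).
Local Notation y mu := (dotp (int_vec R mu) (- alpha.2, alpha.1)).

Let xyE mu : mu \in points -> x mu ^+ 2 + y mu ^+ 2 = m%:R.
Proof.
rewrite mem_points => /eqP e.
have -> : m%:R = (mu.1 ^+ 2 + mu.2 ^+ 2)%:~R :> R by rewrite e.
rewrite rmorphD !rmorphXn /= /dotp /int_vec /= -[RHS]mulr1 -alpha1; ring.
Qed.

(** The components along [alpha] and orthogonal to it have equal square sums by the quarter turn,
    and these add up to [m] for each point. The mean square of the frequencies is therefore exactly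
    half of the maximal [Om^2], whatever [alpha]. *)
Lemma sum_dotp_sqr : \sum_(mu <- half_points) x mu ^+ 2 = (size half_points)%:R * m%:R / 2.
Proof.
have e1 : \sum_(mu <- points) x mu ^+ 2 = 2 * \sum_(mu <- half_points) x mu ^+ 2.
  rewrite sum_points mulr_sumr; apply: eq_bigr => mu _.
  by rewrite /dotp /int_vec /= !rmorphN /=; ring.
have e2 : \sum_(mu <- points) y mu ^+ 2 = \sum_(mu <- points) x mu ^+ 2.
  rewrite [RHS](perm_big _ points_rot)/= big_map; apply: eq_bigr => mu _.
  by rewrite /dotp /int_vec /= !rmorphN /=; ring.
have : \sum_(mu <- points) (x mu ^+ 2 + y mu ^+ 2) = (lattice_count m)%:R * m%:R.
  rewrite big_seq (eq_bigr (fun=> m%:R)); last by move=> mu /xyE.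
  by rewrite -big_seq big_const_seq count_predT iter_addr_0 mulr_natl.
rewrite big_split /= e2 e1 size_points_half natrM; lra.
Qed.

Lemma dotp_le mu : mu \in points -> `|x mu| <= Num.sqrt m%:R.
Proof.
by move=> /xyE e; rewrite -sqrtr_sqr ler_wsqrtr// -e lerDl sqr_ge0.
Qed.

(* Two lattice points in a strip of width 1 orthogonal to [alpha], on the same
   side of the line [R alpha], satisfy [|mu - nu|^2 <= 1 + 2 sqrt m]. *)
Lemma strip_injective mu nu : mu \in points -> nu \in points ->
  (forall mu nu, mu \in points -> nu \in points -> mu != nu ->
    1 + 2 * Num.sqrt m%:R < (x mu - x nu) ^+ 2 + (y mu - y nu) ^+ 2) ->
  `|x mu - x nu| <= 1 -> (0 <= y mu) = (0 <= y nu) -> mu = nu.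
Proof.
move=> mup nup sep x1 yy; apply/eqP; apply: contraT => ne.
have := sep _ _ mup nup ne; rewrite ltNge => /negP; case.
have e1 := xyE mup; have e2 := xyE nup.
have d1 := dotp_le mup; have d2 := dotp_le nup.
(* On the same side of the line, the difference of the two ordinates is at most their sum in
   absolute value; the circle equation then trades the difference of squares of the [y] for that of
   the [x]. *)
have yle : (y mu - y nu) ^+ 2 <= `|y mu ^+ 2 - y nu ^+ 2|.
  have -> : y mu ^+ 2 - y nu ^+ 2 = (y mu - y nu) * (y mu + y nu) by ring.
  rewrite normrM -[leLHS]real_normK ?num_real// expr2 ler_wpM2l//.
  move: yy; move: (y mu) (y nu) => u v.
  have [u0|u0] := leP 0 u; have [v0|v0] := leP 0 v => // _.
    by rewrite (ger0_norm (addr_ge0 u0 v0)) ler_norml; lra.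
  have s0 : u + v <= 0 by lra.
  by rewrite (ler0_norm s0) ler_norml; lra.
have ye : `|y mu ^+ 2 - y nu ^+ 2| = `|x mu - x nu| * `|x mu + x nu|.
  rewrite -normrM -[LHS]normrN; congr `|_|; move: e1 e2.
  move: (x mu) (x nu) (y mu) (y nu) => a b c e <-; nra.
have xx : `|x mu + x nu| <= 2 * Num.sqrt m%:R.
  by apply: (le_trans (ler_normD _ _)); lra.
apply: lerD.
  by rewrite -real_normK ?num_real// expr_le1.
apply: (le_trans yle); rewrite ye -[leRHS]mul1r; exact: ler_pM.
Qed.

(** The points are sorted by the side of [R alpha], the sign of [x mu - x nu] and the integer part
    [k] of its modulus. Each class holds at most one point, contributing at most [1 / (1 + k^2)],
    whence [12 = 4 * 3]. *)
Lemma sum_frequencies_le (mu : int * int) : mu \in half_points ->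
  (forall mu nu, mu \in points -> nu \in points -> mu != nu ->
    1 + 2 * Num.sqrt m%:R < (x mu - x nu) ^+ 2 + (y mu - y nu) ^+ 2) ->
  \sum_(nu <- half_points) (1 + (2 * pi * x mu - 2 * pi * x nu) ^+ 2)^-1 <= 12.
Proof.
move=> muh sep.
have hp nu : nu \in half_points -> nu \in points by rewrite mem_filter => /andP[].
pose k nu := Num.truncn `|x mu - x nu|.
pose J := (\max_(nu <- half_points) k nu).+1.
pose h nu : bool * bool * 'I_J := ((0 <= x mu - x nu, 0 <= y nu), inord (k nu)).
have kJ nu : nu \in half_points -> (k nu < J)%N.
  by move=> nuh; rewrite ltnS; apply: leq_bigmax_seq.
pose F (z : bool * bool * 'I_J) : R := (1 + z.2%:R ^+ 2)^-1.
apply: (@le_trans _ _ (\sum_(nu <- half_points) F (h nu))).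
  rewrite big_seq [leRHS]big_seq; apply: ler_sum => nu nuh.
  rewrite /F /h /= inordK ?kJ//.
  rewrite lef_pV2 ?posrE ?ltr_pwDl ?sqr_ge0// lerD2l.
  have kle : (k nu)%:R <= `|x mu - x nu| by rewrite truncn_le.
  rewrite -[leRHS]real_normK ?num_real// lerXn2r ?nnegrE//.
  apply: (le_trans kle); rewrite -mulrBr normrM ler_peMl//.
  by have p2 := @pi_ge2 R; rewrite ger0_norm ?mulr_ge0 ?pi_ge0//; lra.
apply: (@le_trans _ _ (\sum_z F z)).
  apply: sum_injective_le; first by rewrite filter_uniq// uniq_points.
    move=> nu nu' nuh nuh' [es ey] /(congr1 val); rewrite /= !inordK ?kJ// => ek.
    apply: strip_injective => //; try exact: hp.
    (* Equal sign and equal integer part place [x nu] and [x nu'] within distance 1, which is the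
       strip of [strip_injective]. *)
    have t1 := truncn_itv (normr_ge0 (x mu - x nu)).
    have t2 := truncn_itv (normr_ge0 (x mu - x nu')).
    move: t1 t2 es; rewrite -/(k nu) -/(k nu') ek -natr1.
    move: (x mu) (x nu) (x nu') ((k nu')%:R) => a b b' t /andP[p1 p2] /andP[q1 q2].
    have [s1|s1] := leP 0 (a - b); have [s2|s2] := leP 0 (a - b') => // _;
      move: p1 p2 q1 q2; rewrite ?(ger0_norm s1) ?(ger0_norm s2) ?(ltr0_norm s1) ?(ltr0_norm s2) ler_norml; lra.
  by move=> z; rewrite invr_ge0 addr_ge0 ?sqr_ge0.
rewrite /F -(pair_bigA _ (fun _ j => (1 + (nat_of_ord j)%:R ^+ 2)^-1))/=.
rewrite sumr_const card_prod card_bool.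
by have := sum_inv_sqr_le R J; move: (\sum_j _) => S; rewrite -mulr_natr; lra.
Qed.

End frequencies.
End lattice_points.

(** * The segment in the torus *)

Section law.
Context {R : realType}.

(** [gauss] is the image of [normal_prob] under the identity; the two product measures are integrals
    of the same sections. *)
Lemma gauss2E (B : set (R * R)) : measurable B ->
  gauss2 B = (normal_prob 0 (Num.sqrt 2^-1) \x normal_prob 0 (Num.sqrt 2^-1))%E B.
Proof.
move=> mB.
have -> : gauss2 B = (\int[@gauss R]_x gauss (xsection B x))%E by [].
have m := measurable_fun_xsection (@gauss R) mB.
exact: (ge0_integral_distribution _ m).
Qed.

End law.

(** * Periods of the line in the torus *)

Section torus.
Context {R : realType}.
Variable alpha : R * R.
Hypothesis alpha1 : alpha.1 ^+ 2 + alpha.2 ^+ 2 = 1.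

Definition line_point (t : R) : R * R := torus_proj (t * alpha.1, t * alpha.2).

Definition period (t : R) : Prop :=
  exists u v : int, t * alpha.1 = u%:~R /\ t * alpha.2 = v%:~R.

Lemma frac_partD (x : R) (n : int) : frac_part (x + n%:~R) = frac_part x.
Proof.
rewrite /frac_part floorDrz ?intr_int// intrKfloor rmorphD /=; ring.
Qed.

Lemma frac_part_eq (x y : R) : frac_part x = frac_part y ->
  x - y = (Num.floor x - Num.floor y)%:~R.
Proof. by rewrite /frac_part rmorphB /=; lra. Qed.

Lemma line_pointD t tau : period tau -> line_point (t + tau) = line_point t.
Proof.
move=> [u [v [hu hv]]].
by rewrite /line_point !mulrDl hu hv /torus_proj /= !frac_partD.
Qed.

Lemma line_point_period t t' : line_point t = line_point t' -> period (t - t').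
Proof.
rewrite /line_point /torus_proj => -[h1 h2].
exists (Num.floor (t * alpha.1) - Num.floor (t' * alpha.1)).
exists (Num.floor (t * alpha.2) - Num.floor (t' * alpha.2)).
by rewrite !mulrBl -!frac_part_eq.
Qed.

(** Since [|alpha| = 1], the square of a period is the squared length of an integer vector. Periods
    are thus discrete, and a least positive one is found by minimising over naturals. *)
Lemma period_sqr tau : period tau -> exists n : nat, tau ^+ 2 = n%:R.
Proof.
move=> [u [v [hu hv]]]; exists (absz (u ^+ 2 + v ^+ 2)).
rewrite natr_absz ger0_norm ?addr_ge0 ?sqr_ge0// rmorphD !rmorphXn /= -hu -hv.
by rewrite -[LHS]mulr1 -alpha1; ring.
Qed.

Lemma periodMz tau (n : nat) : period tau -> period (n%:R * tau).
Proof.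
move=> [u [v [hu hv]]]; exists (n%:Z * u), (n%:Z * v).
by rewrite -!mulrA hu hv !rmorphM /=.
Qed.

(* Either the segment is simple, or it covers the closed geodesic whose length
   [L'] is the least period. *)
Lemma simple_segment (L : R) : 0 < L -> exists L', [/\ 0 < L' <= L,
  forall t t', 0 <= t < L' -> 0 <= t' < L' -> line_point t = line_point t' -> t = t' &
  torus_segment alpha L = [set line_point t | t in `[0, L']]].
Proof.
move=> L0.
have inj L' : (forall tau, 0 < tau < L' -> ~ period tau) ->
    forall t t', 0 <= t < L' -> 0 <= t' < L' -> line_point t = line_point t' -> t = t'.
  move=> np t t'; wlog tt : t t' / t <= t'.
    move=> h ht ht' e; have [tt|tt] := leP t t'; first exact: h.
    by apply/esym; apply: h => //; exact: ltW.
  move=> ht ht' e; have [//|tt'] := eqVneq t t'.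
  have := line_point_period (esym e) => /np; case.
  move: ht ht'; have : t < t' by rewrite lt_neqAle tt'.
  by move=> h1 /andP[h2 h3] /andP[h4 h5]; apply/andP; split; lra.
pose Q (n : nat) := `[< exists2 tau, 0 < tau < L & period tau /\ tau ^+ 2 = n%:R >].
have [exQ|nQ] := pselect (exists n, Q n); last first.
  exists L; rewrite L0 lexx; split => //; apply: inj => tau h p; apply: nQ.
  by have [n e] := period_sqr p; exists n; apply/asboolP; exists tau.
case: (ex_minnP exQ) => n0 /asboolP[tau0 /andP[t0 t0L] [p0 e0]] min.
exists tau0; split; first by rewrite t0 ltW.
  apply: inj => tau /andP[h1 h2] p; have [n e] := period_sqr p.
  have : Q n by apply/asboolP; exists tau => //; rewrite h1 (lt_trans h2).
  move=> /min; rewrite -(@ler_nat R) -e -e0 leNgt => /negP; apply.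
  by rewrite ltrXn2r// ?nnegrE ltW.
apply/seteqP; split => _ [t /= + <-]; rewrite in_itv/= => /andP[h1 h2]; last first.
  by exists t => //=; rewrite in_itv/= h1 (le_trans h2)// ltW.
pose k := Num.truncn (t / tau0).
have /andP[k1 k2] := truncn_itv (divr_ge0 h1 (ltW t0)).
rewrite ler_pdivlMr// in k1; rewrite ltr_pdivrMr// -natr1 mulrDl mul1r in k2.
exists (t - k%:R * tau0) => /=.
  by rewrite in_itv/= subr_ge0 k1 /= lerBlDl ltW.
rewrite -[in RHS](subrK (k%:R * tau0) t).
exact/esym/line_pointD/periodMz.
Qed.

End torus.

Section separation.
Context {R : realType}.
Variable alpha : R * R.
Hypothesis alpha1 : alpha.1 ^+ 2 + alpha.2 ^+ 2 = 1.
Local Notation x mu := (dotp (int_vec R mu) alpha).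
Local Notation y mu := (dotp (int_vec R mu) (- alpha.2, alpha.1)).

(** The square is [r * r^(1 - 2 eps)] with a positive exponent because [eps < 1/2]; beyond the
    threshold the second factor is at least 3, and [3 r >= 1 + 2 r]. *)
Lemma powR_sqr_ge (eps r : R) : 0 < eps -> eps < 2^-1 -> 1 <= r ->
  3 `^ (1 - 2 * eps)^-1 <= r -> 1 + 2 * r <= (r `^ (1 - eps)) ^+ 2.
Proof.
move=> e0 e1 r1 hr; have r0 : r != 0 by rewrite gt_eqF// (lt_le_trans ltr01).
have d0 : 0 < 1 - 2 * eps by lra.
have -> : (r `^ (1 - eps)) ^+ 2 = r * r `^ (1 - 2 * eps).
  rewrite expr2 -powRD ?r0 ?implybT//.
  rewrite (_ : 1 - eps + (1 - eps) = 1 + (1 - 2 * eps)); last by ring.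
  by rewrite powRD ?r0 ?implybT// powRr1//; lra.
have h : 3 <= r `^ (1 - 2 * eps).
  have -> : 3 = (3 `^ (1 - 2 * eps)^-1) `^ (1 - 2 * eps) :> R.
    by rewrite -powRrM mulVf ?gt_eqF// powRr1.
  by apply: ge0_ler_powR; rewrite ?nnegrE ?powR_ge0// ?ltW//; lra.
have := ler_wpM2l (_ : 0 <= r) h; move=> /(_ _); move: (r * _) => z; lra.
Qed.

Lemma points_separated (m : nat) (eps : R) : 0 < eps -> eps < 2^-1 ->
  1 <= Num.sqrt m%:R :> R -> 3 `^ (1 - 2 * eps)^-1 <= Num.sqrt m%:R :> R ->
  (Num.sqrt m%:R) `^ (1 - eps) < min_lattice_distance R m ->
  forall mu nu, mu \in points m -> nu \in points m -> mu != nu ->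
    1 + 2 * Num.sqrt m%:R < (x mu - x nu) ^+ 2 + (y mu - y nu) ^+ 2.
Proof.
move=> e0 e1 r1 r3 sep mu nu mup nup ne.
apply: (le_lt_trans (powR_sqr_ge e0 e1 r1 r3)).
have dle : min_lattice_distance R m <= euclid_norm (int_vec R (mu - nu)).
  apply: ge_inf; first by exists 0 => _ [? [? [_ _ _ ->]]]; exact: sqrtr_ge0.
  exists mu, nu; split => //.
    by move: mup; rewrite mem_points => /eqP.
  by move: nup; rewrite mem_points => /eqP.
have -> : (x mu - x nu) ^+ 2 + (y mu - y nu) ^+ 2 =
    euclid_norm (int_vec R (mu - nu)) ^+ 2.
  rewrite sqr_sqrtr ?addr_ge0 ?sqr_ge0// /dotp /int_vec /= !rmorphB /=.
  rewrite -[RHS]mulr1 -alpha1; ring.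
by rewrite ltrXn2r ?nnegrE ?powR_ge0 ?sqrtr_ge0// (lt_le_trans sep).
Qed.

End separation.

(** There are finitely many circles below [M], so their lattice counts are bounded: counts tending
    to infinity force the radii to do so. *)
Lemma lattice_count_infty (m : nat -> nat) (M : nat) :
  lattice_count (m k) @[k --> \oo] --> \oo -> \forall k \near \oo, (M <= m k)%N.
Proof.
move=> /cvgnyPge /(_ (\sum_(j < M) lattice_count j).+1); apply: filterS => k.
rewrite ltnNge => /negP h; rewrite leqNgt; apply/negP => mM; apply: h.
by rewrite (bigD1 (Ordinal mM))//= leq_addr.
Qed.

(** * From the wave on the torus to the Gaussian process on the line *)

Section restriction_to_line.
Context {R : realType} {d : measure_display} {T : measurableType d}.
Variables (P : probability T R) (m : nat) (a : int * int -> T -> R[i]).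
Variable alpha : R * R.
Hypothesis m0 : (0 < m)%N.
Hypothesis ha : wave_coefficients P m a.
Hypothesis s0 : (0 < size (half_points m))%N.

Definition frequency (mu : int * int) : R := 2 * pi * dotp (int_vec R mu) alpha.

Local Notation X := (fun mu => re_im (a mu)).
Local Notation f := (wave X (half_points m) frequency).

(** The terms of [mu] and [- mu] are conjugate, so each pair contributes twice a real part; both
    sides are nonzero real multiples of the same sum [S]. *)
Lemma random_wave_line w t :
  random_wave m a w (t * alpha.1, t * alpha.2) = 0 <-> f 0 w t = 0.
Proof.
set nu := @wave_norm R _ (half_points m).
pose S := \sum_(mu <- half_points m) ((X mu w).1 * cos (frequency mu * t) -
  (X mu w).2 * sin (frequency mu * t)).
have nu0 : nu != 0 by rewrite invr_eq0 sqrtr_eq0 -ltNge ltr0n.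
have -> : f 0 w t = nu * S.
  rewrite /wave /lform mulr_sumr; apply: eq_bigr => mu _.
  by rewrite /wave_coef /trig_coef /= mul0r addr0 -/nu; ring.
have -> : random_wave m a w (t * alpha.1, t * alpha.2) =
    (((Num.sqrt (lattice_count m)%:R)^-1) * (2 * S))%:C%C.
  rewrite rmorphM /=; congr (_ * _).
  rewrite fsbig_finite; last exact: finite_lattice_circle.
  rewrite (sum_points m0) /S mulr_sumr rmorph_sum /= big_seq [RHS]big_seq.
  apply: eq_bigr => mu; rewrite mem_filter => /andP[_].
  rewrite mem_points => /eqP mup.
  have [_ conj _] := ha; rewrite (conj _ _ mup).
  have e : 2 * pi * dotp (int_vec R mu) (t * alpha.1, t * alpha.2) = frequency mu * t.
    by rewrite /frequency /dotp /=; ring.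
  have eN : 2 * pi * dotp (int_vec R (- mu)) (t * alpha.1, t * alpha.2) = - (frequency mu * t).
    by rewrite -e /dotp /int_vec /= !rmorphN /=; ring.
  rewrite e eN /expi cosN sinN /re_im /=; case: (a mu w) => u v /=.
  by apply/eqP; rewrite eq_complex /=; apply/andP; split; apply/eqP; ring.
have N0 : (Num.sqrt (lattice_count m)%:R)^-1 != 0 :> R.
  rewrite invr_eq0 sqrtr_eq0 -ltNge ltr0n (size_points_half m0) muln_gt0 s0//.
split => [/complexI /eqP|].
  by rewrite !mulf_eq0 (negbTE N0) pnatr_eq0 /= => /eqP ->; rewrite mulr0.
by move=> /eqP; rewrite mulf_eq0 (negbTE nu0) /= => /eqP ->; rewrite !mulr0.
Qed.

(** The parametrisation is injective on [[0, L'[], and the ends, which may be the same point of a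
    closed geodesic, are not zeros; points and parameters are therefore equally many. *)
Lemma nodal_intersections_line (L L' : R) w (zs : seq R) :
  0 < L' <= L ->
  (forall t t', 0 <= t < L' -> 0 <= t' < L' ->
    line_point alpha t = line_point alpha t' -> t = t') ->
  torus_segment alpha L = [set line_point alpha t | t in `[0, L']] ->
  f 0 w 0 != 0 -> f 0 w L' != 0 -> uniq zs ->
  (forall t, t \in zs <-> 0 < t < L' /\ f 0 w t = 0) ->
  nodal_intersections m a alpha L w = (size zs)%:R.
Proof.
move=> /andP[L0 LL] inj seg z0 zL uzs zsE; rewrite /nodal_intersections; congr (_%:R).
pose Y : {fset (R * R)} := [fset z in map (line_point alpha) zs]%fset.
have -> : [set z | random_wave m a w z = 0] `&` torus_segment alpha L = [set` Y].
  rewrite seg; apply/seteqP; split => z /=; rewrite /Y !inE.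
    move=> [+ [t + tz]]; rewrite -tz random_wave_torus => /random_wave_line ft.
    rewrite in_itv/= => /andP[t0 tL]; apply/map_f/zsE; split => //.
    rewrite !lt_neqAle t0 tL !andbT; apply/andP; split; apply/eqP => e.
      by move: ft z0; rewrite -e => ->; rewrite eqxx.
    by move: ft zL; rewrite e => ->; rewrite eqxx.
  move=> /mapP[t /zsE[/andP[t0 tL] ft] ->]; split.
    by rewrite random_wave_torus; apply/random_wave_line.
  by exists t => //=; rewrite in_itv/= !ltW.
rewrite set_fsetK card_fseq undup_id ?size_map// map_inj_in_uniq//.
move=> t t' /zsE[/andP[h1 h2] _] /zsE[/andP[h3 h4] _].
by apply: inj; rewrite ?(ltW h1) ?(ltW h3).
Qed.

Lemma half_points_positive mu : mu \in half_points m ->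
  lattice_circle m mu /\ ~ (- mu \in half_points m).
Proof.
rewrite mem_filter => /andP[p mup]; split; first by move: mup; rewrite mem_points => /eqP.
by rewrite mem_filter (positiveN m0 mup) p.
Qed.

Lemma variance_nodal_intersections (L L' : R) (K : nat) :
  alpha.1 ^+ 2 + alpha.2 ^+ 2 = 1 -> 0 < L' <= L ->
  (forall t t', 0 <= t < L' -> 0 <= t' < L' ->
    line_point alpha t = line_point alpha t' -> t = t') ->
  torus_segment alpha L = [set line_point alpha t | t in `[0, L']] ->
  (forall mu nu, mu \in points m -> nu \in points m -> mu != nu ->
    1 + 2 * Num.sqrt m%:R <
    (dotp (int_vec R mu) alpha - dotp (int_vec R nu) alpha) ^+ 2 +
    (dotp (int_vec R mu) (- alpha.2, alpha.1) -
     dotp (int_vec R nu) (- alpha.2, alpha.1)) ^+ 2) ->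
  (0 < K)%N -> L' / K%:R * (2 * pi * Num.sqrt m%:R) <= 512^-1 ->
  ('V_P[nodal_intersections m a alpha L] <=
   (6 * 4096 * 64 * K%:R ^+ 2 * (1 + 6 / L' ^+ 2) * 12 / (size (half_points m))%:R)%:E)%E.
Proof.
move=> alpha1 hL inj seg sep K0 KOm.
have [hg hc hi] := ha.
pose A := [set mu | mu \in half_points m].
have AE mu : A mu -> lattice_circle m mu by move=> /half_points_positive[].
have mX mu : A mu -> measurable_fun setT (X mu) by move=> /AE /hg [].
have lawX mu : A mu -> forall B, measurable B -> P (X mu @^-1` B) = gauss2 B.
  by move=> /AE /hg [_ h] B mB; rewrite gauss2E//; exact: h.
(* The half circle contains no two opposite points, so the independence of the coefficients applies
   to it. *)
have indepX : mutually_independent P A X.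
  by apply: hi => // mu /half_points_positive[].
have us : uniq (half_points m) by rewrite filter_uniq// uniq_points.
have sA : {in half_points m, forall mu, A mu} by [].
have sqrt_m : 0 < Num.sqrt m%:R :> R by rewrite sqrtr_gt0 ltr0n.
have Om0 : 0 < 2 * pi * Num.sqrt m%:R :> R by rewrite !mulr_gt0// pi_gt0.
have pi20 : 0 <= 2 * pi :> R by rewrite mulr_ge0// pi_ge0.
have om_le mu : mu \in half_points m -> `|frequency mu| <= 2 * pi * Num.sqrt m%:R.
  rewrite mem_filter => /andP[_ mup]; rewrite /frequency normrM (ger0_norm pi20).
  by rewrite ler_wpM2l// dotp_le.
have om_sq : (size (half_points m))%:R * (2 * pi * Num.sqrt m%:R) ^+ 2 / 2 <=
    \sum_(mu <- half_points m) frequency mu ^+ 2.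
  under eq_bigr do rewrite /frequency exprMn.
  rewrite -mulr_sumr (sum_dotp_sqr m0 alpha1) [in leLHS]exprMn sqr_sqrtr//.
  by rewrite le_eqVlt; apply/orP; left; apply/eqP; field.
have sepB mu : mu \in half_points m ->
    \sum_(nu <- half_points m) (1 + (frequency mu - frequency nu) ^+ 2)^-1 <= 12.
  by move=> muh; exact: (sum_frequencies_le alpha1 muh sep).
have /andP[L0 LL] := hL.
apply: (zero_count_variance mX indepX lawX us sA s0 Om0 om_le om_sq K0 L0 KOm sepB).
  by move=> w.
by move=> w zs h0 hL' uzs zsE; exact: (nodal_intersections_line hL inj seg h0 hL' uzs zsE).
Qed.

End restriction_to_line.

Theorem theorem1p5 (R : realType) (alpha : R * R) (L : R) (m : nat -> nat)
  (halpha : euclid_norm alpha = 1)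
  (hL : 0 < L)
  (hS : forall k : nat, sum_of_two_squares (m k))
  (hN : lattice_count (m k) @[k --> \oo] --> \oo)
  (hsep : exists eps : R, [/\ 0 < eps, eps < 2^-1
     & \forall k \near \oo,
         (Num.sqrt (m k)%:R) `^ (1 - eps) < min_lattice_distance R (m k)]) :
  exists C : R, \forall k \near \oo,
    forall (d : measure_display) (T : measurableType d) (P : probability T R)
      (a : int * int -> T -> R[i]),
      wave_coefficients P (m k) a ->
      ('V_P[nodal_intersections (m k) a alpha L]
         <= (C * ((m k)%:R / (lattice_count (m k))%:R))%:E)%E.
Proof.
have alpha1 : alpha.1 ^+ 2 + alpha.2 ^+ 2 = 1.
  by rewrite -[LHS]sqr_sqrtr ?addr_ge0 ?sqr_ge0// -/(euclid_norm alpha) halpha expr1n.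
(* [L'] depends on [alpha] and [L] alone, so it may enter the constant. *)
have [L' [hL' inj seg]] := simple_segment alpha1 hL.
have /andP[L0 _] := hL'.
have [eps [e0 e1 sepk]] := hsep.
(* The radius beyond which [powR_sqr_ge] applies; [r >= 1] also absorbs the rounding in the choice
   of [K]. *)
pose thr : R := Num.max 1 (3 `^ (1 - 2 * eps)^-1).
pose M := (Num.truncn (thr ^+ 2)).+1.
pose c : R := 1024 * pi * L' + 1.
(* [c] is chosen so that [K <= c sqrt m], hence [K^2 <= c^2 m]; the last factor 2 is the ratio of
   the whole circle to its half. *)
exists (6 * 4096 * 64 * c ^+ 2 * (1 + 6 / L' ^+ 2) * 12 * 2).
have countk : \forall k \near \oo, (0 < lattice_count (m k))%N by move/cvgnyPge : hN; apply.
near=> k => d T P a ha.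
have mM : (M <= m k)%N by near: k; exact: lattice_count_infty.
have sep : (Num.sqrt (m k)%:R) `^ (1 - eps) < min_lattice_distance R (m k) by near: k.
have N0 : (0 < lattice_count (m k))%N by near: k.
have m0 : (0 < m k)%N by apply: leq_trans mM.
have thrm : thr <= Num.sqrt (m k)%:R.
  have thr0 : 0 <= thr by rewrite le_max ler01.
  rewrite -[leLHS](ger0_norm thr0) -sqrtr_sqr ler_wsqrtr//.
  by apply: (le_trans (ltW (truncnS_gt _))); rewrite ler_nat.
have m1 : 1 <= Num.sqrt (m k)%:R :> R by apply: le_trans thrm; rewrite le_max lexx.
have m3 : 3 `^ (1 - 2 * eps)^-1 <= Num.sqrt (m k)%:R :> R.
  by apply: le_trans thrm; rewrite le_max lexx orbT.
have s0 : (0 < size (half_points (m k)))%N.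
  by move: N0; rewrite (size_points_half m0) muln_gt0.
have separated := points_separated alpha1 e0 e1 m1 m3 sep.
set r := Num.sqrt (m k)%:R in m1.
have r0 : 0 <= r by exact: sqrtr_ge0.
have u0 : 0 <= 512 * L' * (2 * pi * r).
  exact: (mulr_ge0 (mulr_ge0 (ler0n R 512) (ltW L0))
    (mulr_ge0 (mulr_ge0 (ler0n R 2) (pi_ge0 R)) r0)).
pose K := (Num.truncn (512 * L' * (2 * pi * r))).+1.
have K1 : 512 * L' * (2 * pi * r) <= K%:R by rewrite ltW// truncnS_gt.
have K2 : K%:R <= c * r.
  rewrite /K -natr1; apply: (@le_trans _ _ (512 * L' * (2 * pi * r) + 1)).
    by rewrite lerD2r truncn_le.
  rewrite /c (_ : (1024 * pi * L' + 1) * r = 512 * L' * (2 * pi * r) + r) ?lerD2l//.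
  by rewrite (_ : 1024 = 512 * 2)//; ring.
have Kp : 0 < K%:R :> R by rewrite ltr0n.
have KOm : L' / K%:R * (2 * pi * r) <= 512^-1.
  by rewrite mulrAC ler_pdivrMr// ler_pdivlMl ?ltr0n// mulrA.
apply: (le_trans (variance_nodal_intersections m0 ha s0 alpha1 hL' inj seg separated _ KOm)) => //.
have K3 : K%:R ^+ 2 <= c ^+ 2 * (m k)%:R.
  rewrite -[(m k)%:R]sqr_sqrtr// -exprMn lerXn2r ?nnegrE//.
  exact: le_trans (ltW Kp) K2.
rewrite lee_fin (size_points_half m0) natrM.
have n0 : (size (half_points (m k)))%:R != 0 :> R by rewrite pnatr_eq0 -lt0n.
have w0 : 0 <= 1 + 6 / L' ^+ 2 by rewrite addr_ge0// divr_ge0// sqr_ge0.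
have p0 : 0 <= 6 * 4096 * 64 :> R.
  exact: (mulr_ge0 (mulr_ge0 (ler0n R 6) (ler0n R 4096)) (ler0n R 64)).
move: (6 * 4096 * 64) (1 + 6 / L' ^+ 2) ((size _)%:R) p0 w0 n0 (ler0n R (size (half_points (m k)))).
move: (K%:R) (m k)%:R K3 => kk mm K3 p w n p0 w0 n0 n1.
have -> : p * c ^+ 2 * w * 12 * 2 * (mm / (2 * n)) = p * w * 12 / n * (c ^+ 2 * mm) by field.
have -> : p * kk ^+ 2 * w * 12 / n = p * w * 12 / n * kk ^+ 2 by field.
by rewrite ler_wpM2l// divr_ge0// !mulr_ge0.
Unshelve. all: by end_near.
Qed.
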